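(* Let $y=\gamma\otimes\hat\gamma$ be a torus of tensor product (notation in the context) which is a Willmore surface in $S^{(n+1)(m+1)-1}$. Then \[W(y)\geq 2\pi^2\sqrt{3},\] and equality holds if and only if $y$ coincides, up to an isometry of the ambient sphere and a reparametrization, with the Ejiri torus $E$ (lying in a totally geodesic $S^5$).
   Context: Let $\gamma:\mathbb{R}\to S^n\subset\mathbb{R}^{n+1}$ and $\hat\gamma:\mathbb{R}\to S^m\subset\mathbb{R}^{m+1}$ be smooth closed curves parametrized by arc length $s$, $\hat s$, with periods $L$, $\hat L$ equal to their lengths. Their Frenet curvatures in the sphere are $k_1,k_2,\dots$ (resp. $\hat k_1,\hat k_2,\dots$), defined through an orthonormal frame $\{\gamma,\beta_0,\beta_1,\dots\}$ by $\gamma'=\beta_0$, $\beta_0'=k_1\beta_1-\gamma$, $\beta_1'=k_2\beta_2-k_1\beta_0$, $\dots$ (and similarly for $\hat\gamma$); thus $k_1$ is the geodesic curvature of $\gamma$ in $S^n$. For $x\in\mathbb{R}^{n+1}$, $\hat x\in\mathbb{R}^{m+1}$ the tensor product is $x\otimes\hat x=(x_1\hat x_1,\dots,x_1\hat x_{m+1},x_2\hat x_1,\dots,x_{n+1}\hat x_{m+1})\in\mathbb{R}^{(n+1)(m+1)}$. The torus of tensor product is $y=\gamma\otimes\hat\gamma:(s,\hat s)\mapsto\gamma(s)\otimes\hat\gamma(\hat s)$, a conformal flat immersion of $\mathbb{R}^2/(L\mathbb{Z}\times\hat L\mathbb{Z})$ into $S^{(n+1)(m+1)-1}$. For a closed immersed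 surface $x:M\to S^N$ with mean curvature vector $\vec H$ and Gauss curvature $K$, the Willmore functional is $W(x)=\int_M(|\vec H|^2-K+1)\,dM$; $x$ is a Willmore surface if it is a critical point of $W$ under all variations. The Ejiri torus is $E:(s,\hat s)\mapsto\frac{1}{\sqrt3}\big(\cos\hat s\cos\sqrt3 s,\ \sin\hat s\cos\sqrt3 s,\ \cos\hat s\sin\sqrt3 s,\ \sin\hat s\sin\sqrt3 s,\ \sqrt2\cos\hat s,\ \sqrt2\sin\hat s\big)\in S^5$, i.e. the tensor product of the circle $\big(\tfrac{1}{\sqrt3}\cos\sqrt3 s,\tfrac{1}{\sqrt3}\sin\sqrt3 s,\sqrt{2/3}\big)$ with the great circle $(\cos\hat s,\sin\hat s)$. *)

(* Defs.v *)
From Stdlib Require Import Reals Lra Lia ZArith.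
Open Scope R_scope.

Fixpoint sumN (N : nat) (f : nat -> R) : R :=
  match N with
  | O => 0
  | S k => sumN k f + f k
  end.

(* Vectors of R^N are represented by functions nat -> R; only the
   components 0..N-1 are ever used. *)
Definition dot (N : nat) (u v : nat -> R) : R := sumN N (fun i => u i * v i).

(* Tensor product x (x) xh of x in R^(n+1), xh in R^(m+1):
   component number i*(m+1)+j is x_i * xh_j. *)
Definition tensor (m : nat) (x xh : nat -> R) : nat -> R :=
  fun k => x (Nat.div k (S m)) * xh (Nat.modulo k (S m)).

Definition smooth1 (f : R -> R) : Prop :=
  exists D : nat -> R -> R, D O = f /\
    forall k s, derivable_pt_lim (D k) s (D (S k) s).

Definition cont2 (f : R -> R -> R) : Prop :=
  forall s u eps, eps > 0 -> exists delta, delta > 0 /\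
    forall s' u', Rabs (s' - s) < delta -> Rabs (u' - u) < delta ->
      Rabs (f s' u' - f s u) < eps.

Definition smooth2 (f : R -> R -> R) : Prop :=
  exists D : nat -> nat -> R -> R -> R, D O O = f /\
    forall k l, cont2 (D k l) /\
      forall s u,
        derivable_pt_lim (fun s' => D k l s' u) s (D (S k) l s u) /\
        derivable_pt_lim (fun u' => D k l s u') u (D k (S l) s u).

Definition cont3 (f : R -> R -> R -> R) : Prop :=
  forall t s u eps, eps > 0 -> exists delta, delta > 0 /\
    forall t' s' u', Rabs (t' - t) < delta -> Rabs (s' - s) < delta ->
      Rabs (u' - u) < delta -> Rabs (f t' s' u' - f t s u) < eps.

Definition smooth3 (f : R -> R -> R -> R) : Prop :=
  exists D : nat -> nat -> nat -> R -> R -> R -> R, D O O O = f /\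
    forall a k l, cont3 (D a k l) /\
      forall t s u,
        derivable_pt_lim (fun t' => D a k l t' s u) t (D (S a) k l t s u) /\
        derivable_pt_lim (fun s' => D a k l t s' u) s (D a (S k) l t s u) /\
        derivable_pt_lim (fun u' => D a k l t s u') u (D a k (S l) t s u).

Definition sphere_curve (n : nat) (gamma : R -> nat -> R) (L : R) : Prop :=
  (forall i, (i < S n)%nat -> smooth1 (fun s => gamma s i)) /\
  (forall s, dot (S n) (gamma s) (gamma s) = 1) /\
  (forall s, exists dg : nat -> R,
      (forall i, (i < S n)%nat -> derivable_pt_lim (fun s' => gamma s' i) s (dg i)) /\
      dot (S n) dg dg = 1) /\
  L > 0 /\
  (forall s i, (i < S n)%nat -> gamma (s + L) i = gamma s i) /\
  (forall T, 0 < T < L -> exists s i, (i < S n)%nat /\ gamma (s + T) i <> gamma s i).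

(* Pointwise integrand (|H|^2 - K + 1) sqrt(det g) of a surface in the unit
   sphere S^(N-1) of R^N, from the position x and its partial derivatives
   xs, xt, xss, xst, xtt at a point.  B_ij is the second fundamental form
   in the sphere (normal part, w.r.t. the sphere, of x_ij); H = (1/2)
   g^ij B_ij; K is given by the Gauss equation for S^(N-1):
   K = 1 + (<B11,B22> - |B12|^2)/det g. *)
Definition willmore_density (N : nat) (x xs xt xss xst xtt : nat -> R) : R :=
  let g11 := dot N xs xs in
  let g12 := dot N xs xt in
  let g22 := dot N xt xt in
  let det := g11 * g22 - g12 * g12 in
  let perp := fun v : nat -> R =>
    let p1 := dot N v xs in
    let p2 := dot N v xt in
    let a := (g22 * p1 - g12 * p2) / det in
    let b := (g11 * p2 - g12 * p1) / det in
    let c := dot N v x in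
    fun i => v i - c * x i - a * xs i - b * xt i in
  let B11 := perp xss in
  let B12 := perp xst in
  let B22 := perp xtt in
  let H := fun i => (g22 * B11 i - 2 * g12 * B12 i + g11 * B22 i) / (2 * det) in
  let K := 1 + (dot N B11 B22 - dot N B12 B12) / det in
  (dot N H H - K + 1) * sqrt det.

Definition riemann_sum2 (f : R -> R -> R) (L Lh : R) (k : nat) : R :=
  sumN k (fun i => sumN k (fun j =>
     f (INR i * L / INR k) (INR j * Lh / INR k))) * (L / INR k) * (Lh / INR k).

Definition is_integral2 (f : R -> R -> R) (L Lh I : R) : Prop :=
  Un_cv (fun k => riemann_sum2 f L Lh (S k)) I.

(* w = W(x) for the doubly periodic surface x : R^2 -> S^(N-1),
   regarded on the torus R^2 / (L Z x Lh Z). *)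
Definition is_willmore_value (N : nat) (x : R -> R -> nat -> R) (L Lh w : R) : Prop :=
  exists xs xt xss xst xtt : R -> R -> nat -> R,
    (forall s u i, (i < N)%nat ->
       derivable_pt_lim (fun s' => x s' u i) s (xs s u i) /\
       derivable_pt_lim (fun u' => x s u' i) u (xt s u i) /\
       derivable_pt_lim (fun s' => xs s' u i) s (xss s u i) /\
       derivable_pt_lim (fun u' => xs s u' i) u (xst s u i) /\
       derivable_pt_lim (fun u' => xt s u' i) u (xtt s u i)) /\
    is_integral2
      (fun s u => willmore_density N (x s u) (xs s u) (xt s u)
                                     (xss s u) (xst s u) (xtt s u)) L Lh w.

Definition willmore_surface (N : nat) (x : R -> R -> nat -> R) (L Lh : R) : Prop :=
  forall F : R -> R -> R -> nat -> R,
    (forall i, (i < N)%nat -> smooth3 (fun t s u => F t s u i)) ->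
    (forall s u i, (i < N)%nat -> F 0 s u i = x s u i) ->
    (forall t s u, dot N (F t s u) (F t s u) = 1) ->
    (forall t s u i, (i < N)%nat ->
        F t (s + L) u i = F t s u i /\ F t s (u + Lh) i = F t s u i) ->
    forall w : R -> R,
      (exists delta, delta > 0 /\
         forall t, Rabs t < delta -> is_willmore_value N (F t) L Lh (w t)) ->
      derivable_pt_lim w 0 0.

Definition ejiri (s u : R) : nat -> R :=
  fun k =>
    match k with
    | 0%nat => cos u * cos (sqrt 3 * s) / sqrt 3
    | 1%nat => sin u * cos (sqrt 3 * s) / sqrt 3
    | 2%nat => cos u * sin (sqrt 3 * s) / sqrt 3
    | 3%nat => sin u * sin (sqrt 3 * s) / sqrt 3
    | 4%nat => sqrt 2 * cos u / sqrt 3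
    | 5%nat => sqrt 2 * sin u / sqrt 3
    | _ => 0
    end.

Definition in_lattice (P Q a b : R) : Prop :=
  exists p q : Z, a = IZR p * P /\ b = IZR q * Q.

(* y : R^2/(L Z x Lh Z) -> S^(N-1) coincides, up to an isometry O of the
   ambient sphere (an orthogonal N x N matrix) and a reparametrization
   (a diffeomorphism of tori R^2/(LZ x LhZ) -> R^2/((2pi/sqrt3)Z x 2piZ),
   given by a lift phi with inverse psi), with the Ejiri torus E, placed in
   the totally geodesic S^5 spanned by the first 6 coordinates. *)
Definition congruent_to_ejiri (N : nat) (y : R -> R -> nat -> R) (L Lh : R) : Prop :=
  (6 <= N)%nat /\
  exists (O : nat -> nat -> R) (phi1 phi2 psi1 psi2 : R -> R -> R),
    (forall i j, (i < N)%nat -> (j < N)%nat ->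
        sumN N (fun k => O k i * O k j) = if Nat.eqb i j then 1 else 0) /\
    smooth2 phi1 /\ smooth2 phi2 /\ smooth2 psi1 /\ smooth2 psi2 /\
    (forall s u, psi1 (phi1 s u) (phi2 s u) = s /\ psi2 (phi1 s u) (phi2 s u) = u) /\
    (forall s u, phi1 (psi1 s u) (psi2 s u) = s /\ phi2 (psi1 s u) (psi2 s u) = u) /\
    (forall s u s' u',
        in_lattice L Lh (s - s') (u - u') <->
        in_lattice (2 * PI / sqrt 3) (2 * PI)
                   (phi1 s u - phi1 s' u') (phi2 s u - phi2 s' u')) /\
    (forall s u i, (i < N)%nat ->
        y s u i = sumN N (fun j => O i j * ejiri (phi1 s u) (phi2 s u) j)).

(* Main.v *)
Require Import Defs.
From Stdlib Require Import Reals Lra Lia ZArith Arith ClassicalEpsilon.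
From Coquelicot Require Import Coquelicot.
Open Scope R_scope.

(** Write [N = gamma'' + gamma] and [Nh = gammah'' + gammah] for the curvature vectors and
    [k^2 = |N|^2], [kh^2 = |Nh|^2].  The induced metric is flat and the Willmore density is
    [1 + (k^2 + kh^2)/4].  Varying [y] in the normal direction [N (x) Nh] leaves the metric
    unchanged to first order and changes the density at rate [k^2 kh^2]; hence
    [(int k^2)(int kh^2) = 0] and one factor is a great circle, of length [2 pi].
    If [L] is the length of the other factor, then
    [W = (pi/2)(3 L + int |gamma''|^2)], and Wirtinger's inequality for the mean-zero closed
    curve [gamma'] gives [int |gamma''|^2 >= 4 pi^2 / L], whence
    [W >= (pi/2)(3 L + 4 pi^2 / L) >= 2 sqrt 3 pi^2].
    Equality forces [L = 2 pi / sqrt 3] and [gamma''' = - 3 gamma'], a circle of radius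
    [1 / sqrt 3].  Conversely, a congruence with the Ejiri torus is a local isometry of flat
    planes, hence affine, so it preserves the covolume of the period lattice and
    [|Laplacian y|^2]. *)

(** * Finite sums, inner products and orthonormal systems *)

(** Criticality can be used only through an explicit competitor: a family smooth in all three
    variables, on the sphere, periodic, and with a Willmore value for each small t. One competitor
    suffices, because its first variation is a product of two integrals of squares. The vector N =
    k_1 beta_1 is smooth even where the curvature vanishes and the Frenet frame breaks down, which
    is why the field is N (x) Nh and not a product of frame vectors. At t = 0 the second fundamental
    form is B11 = N (x) gammah, B22 = gamma (x) Nh, B12 = gamma' (x) gammah'. The relations <N'',
    gamma> = k^2 and <N', gamma'> = - k^2 make |H|^2 vary at the rate k^2 kh^2, while the changes of
    <B11, B22> and |B12|^2 cancel in K. The competitor is written in a small expression language, so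
    that smoothness of every order and the t-derivative of the long density formula come from
    inductions on syntax. A congruence with the Ejiri torus may use any diffeomorphism of tori, not
    only a product of reparametrizations of the factors; hence the detour through affinity and
    invariants. *)

Lemma sumN_ext N f g :
  (forall i, (i < N)%nat -> f i = g i) -> sumN N f = sumN N g.
Proof.
  induction N as [|N IH]; intros H; simpl; [reflexivity|].
  rewrite IH, H; [reflexivity|lia|intros; apply H; lia].
Qed.

Lemma sumN_plus N f g : sumN N (fun i => f i + g i) = sumN N f + sumN N g.
Proof. induction N; simpl; lra. Qed.

Lemma sumN_scal N c f : sumN N (fun i => c * f i) = c * sumN N f.
Proof. induction N as [|N IH]; simpl; [ring|rewrite IH; ring]. Qed.

Lemma sumN_const N c : sumN N (fun _ => c) = INR N * c.
Proof. induction N as [|N IH]; [simpl; ring|rewrite S_INR; simpl; rewrite IH; ring]. Qed.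

Lemma sumN_le N f g :
  (forall i, (i < N)%nat -> f i <= g i) -> sumN N f <= sumN N g.
Proof.
  induction N as [|N IH]; intros H; simpl; [lra|].
  apply Rplus_le_compat; [apply IH; intros; apply H|apply H]; lia.
Qed.

Lemma sumN_nonneg N f : (forall i, (i < N)%nat -> 0 <= f i) -> 0 <= sumN N f.
Proof.
  intros H. apply Rle_trans with (sumN N (fun _ => 0)).
  - rewrite sumN_const; lra.
  - apply sumN_le, H.
Qed.

Lemma sumN_nonneg_eq0 N f :
  (forall i, (i < N)%nat -> 0 <= f i) -> sumN N f = 0 ->
  forall i, (i < N)%nat -> f i = 0.
Proof.
  induction N as [|N IH]; intros H H0 i Hi; [lia|]; simpl in H0.
  assert (0 <= sumN N f) by (apply sumN_nonneg; intros; apply H; lia).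
  assert (0 <= f N) by (apply H; lia).
  destruct (Nat.eq_dec i N) as [->|]; [lra|].
  apply IH; [intros; apply H; lia|lra|lia].
Qed.

Lemma sumN_abs_le N f : Rabs (sumN N f) <= sumN N (fun i => Rabs (f i)).
Proof.
  induction N as [|N IH]; simpl; [rewrite Rabs_R0; lra|].
  eapply Rle_trans; [apply Rabs_triang|lra].
Qed.

Lemma sumN_exchange N M f :
  sumN N (fun i => sumN M (fun j => f i j)) = sumN M (fun j => sumN N (fun i => f i j)).
Proof.
  induction N as [|N IH]; simpl.
  - rewrite sumN_const; ring.
  - rewrite IH, <- sumN_plus; reflexivity.
Qed.

Lemma sumN_app a b f : sumN (a + b) f = sumN a f + sumN b (fun j => f (a + j)%nat).
Proof.
  induction b as [|b IH]; simpl.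
  - rewrite Nat.add_0_r; ring.
  - rewrite Nat.add_succ_r; simpl; rewrite IH; ring.
Qed.

Lemma sumN_mul a b f :
  sumN (a * b) f = sumN a (fun i => sumN b (fun j => f (i * b + j)%nat)).
Proof.
  induction a as [|a IH]; simpl; [reflexivity|].
  rewrite Nat.add_comm, sumN_app, IH; reflexivity.
Qed.

Lemma sumN_delta N i f :
  (i < N)%nat -> sumN N (fun k => (if Nat.eqb k i then 1 else 0) * f k) = f i.
Proof.
  induction N as [|N IH]; intros Hi; [lia|]; simpl.
  destruct (Nat.eq_dec i N) as [->|Hn].
  - rewrite Nat.eqb_refl, (sumN_ext N _ (fun _ => 0)), sumN_const; [ring|].
    intros k Hk. destruct (Nat.eqb_spec k N); [lia|ring].
  - rewrite IH by lia. destruct (Nat.eqb_spec N i); [lia|ring].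
Qed.

Lemma dot_ext N u u' v v' :
  (forall i, (i < N)%nat -> u i = u' i) -> (forall i, (i < N)%nat -> v i = v' i) ->
  dot N u v = dot N u' v'.
Proof. intros H H'; apply sumN_ext; intros; rewrite H, H'; trivial. Qed.

Lemma dot_comm N u v : dot N u v = dot N v u.
Proof. apply sumN_ext; intros; ring. Qed.

Lemma dot_plus_l N u v z : dot N (fun i => u i + v i) z = dot N u z + dot N v z.
Proof. unfold dot; rewrite <- sumN_plus; apply sumN_ext; intros; ring. Qed.

Lemma dot_scal_l N c u z : dot N (fun i => c * u i) z = c * dot N u z.
Proof. unfold dot; rewrite <- sumN_scal; apply sumN_ext; intros; ring. Qed.

Lemma dot_plus_r N u v z : dot N z (fun i => u i + v i) = dot N z u + dot N z v.
Proof. rewrite dot_comm, dot_plus_l, !(dot_comm N _ z); reflexivity. Qed.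

Lemma dot_scal_r N c u z : dot N z (fun i => c * u i) = c * dot N z u.
Proof. rewrite dot_comm, dot_scal_l, dot_comm; reflexivity. Qed.

Lemma dot_self_nonneg N u : 0 <= dot N u u.
Proof. apply sumN_nonneg; intros; nra. Qed.

Lemma dot_self_eq0 N u : dot N u u = 0 -> forall i, (i < N)%nat -> u i = 0.
Proof.
  intros H i Hi.
  assert (u i * u i = 0) by
    (apply (sumN_nonneg_eq0 N (fun i => u i * u i)); trivial; intros; nra).
  nra.
Qed.

Lemma tensor_index m i j f g :
  (j < S m)%nat -> tensor m f g (i * S m + j) = f i * g j.
Proof.
  intros Hj; unfold tensor. f_equal; f_equal.
  - rewrite Nat.div_add_l, Nat.div_small; lia.
  - rewrite Nat.add_comm, Nat.Div0.mod_add, Nat.mod_small; lia.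
Qed.

Lemma tensor_div n m i : (i < S n * S m)%nat -> (i / S m < S n)%nat.
Proof. intros; apply Nat.Div0.div_lt_upper_bound; lia. Qed.

Lemma tensor_mod m i : (i mod S m < S m)%nat.
Proof. apply Nat.mod_upper_bound; lia. Qed.

Lemma dot_tensor n m a b c d :
  dot (S n * S m) (tensor m a b) (tensor m c d) = dot (S n) a c * dot (S m) b d.
Proof.
  unfold dot at 1; rewrite sumN_mul.
  transitivity (sumN (S n) (fun i => (a i * c i) * dot (S m) b d)).
  - apply sumN_ext; intros i _. unfold dot; rewrite <- sumN_scal.
    apply sumN_ext; intros j Hj. rewrite !tensor_index by assumption. ring.
  - unfold dot at 2; rewrite (Rmult_comm (sumN _ _)), <- sumN_scal.
    apply sumN_ext; intros; ring.
Qed.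

Definition orthonormal (N k : nat) (v : nat -> nat -> R) : Prop :=
  forall a b, (a < k)%nat -> (b < k)%nat ->
    dot N (v a) (v b) = if Nat.eqb a b then 1 else 0.

Definition basis_vec (i : nat) : nat -> R := fun j => if Nat.eqb j i then 1 else 0.

Definition residual (N k : nat) (v : nat -> nat -> R) (x : nat -> R) : nat -> R :=
  fun i => x i - sumN k (fun a => dot N x (v a) * v a i).

Lemma dot_sumN_l N k c (v : nat -> nat -> R) z :
  dot N (fun i => sumN k (fun a => c a * v a i)) z = sumN k (fun a => c a * dot N (v a) z).
Proof.
  unfold dot.
  rewrite (sumN_ext N _ (fun i => sumN k (fun a => c a * (v a i * z i)))).
  - rewrite sumN_exchange. apply sumN_ext; intros; apply sumN_scal.
  - intros i _. rewrite Rmult_comm, <- sumN_scal. apply sumN_ext; intros; ring.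
Qed.

Lemma residual_dot N k v x z :
  dot N (residual N k v x) z = dot N x z - sumN k (fun a => dot N x (v a) * dot N (v a) z).
Proof.
  unfold residual.
  rewrite <- (dot_sumN_l N k (fun a => dot N x (v a)) v z).
  rewrite (dot_ext N _ (fun i => x i + (-1) * sumN k (fun a => dot N x (v a) * v a i)) z z);
    [|intros; ring|trivial].
  rewrite dot_plus_l, dot_scal_l. ring.
Qed.

Lemma residual_orth N k v x b :
  orthonormal N k v -> (b < k)%nat -> dot N (residual N k v x) (v b) = 0.
Proof.
  intros Hv Hb. rewrite residual_dot.
  rewrite (sumN_ext k _ (fun a => (if Nat.eqb a b then 1 else 0) * dot N x (v a))).
  - rewrite sumN_delta by assumption. ring.
  - intros a Ha. rewrite Hv by assumption. ring.
Qed.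

Lemma residual_norm N k v x :
  orthonormal N k v ->
  dot N (residual N k v x) (residual N k v x) = dot N x x - sumN k (fun a => (dot N x (v a))^2).
Proof.
  intros Hv. rewrite residual_dot.
  rewrite (dot_comm N x), residual_dot.
  rewrite (sumN_ext k (fun a => dot N x (v a) * dot N (v a) (residual N k v x)) (fun _ => 0)).
  - rewrite sumN_const, Rmult_0_r, Rminus_0_r. f_equal.
    apply sumN_ext; intros. rewrite (dot_comm N (v i)). ring.
  - intros a Ha. rewrite (dot_comm N (v a)), residual_orth by assumption. ring.
Qed.

(* The trace of the projection onto the orthogonal complement. *)
Lemma residual_basis_sum N k v :
  orthonormal N k v ->
  sumN N (fun i => dot N (residual N k v (basis_vec i)) (residual N k v (basis_vec i)))
  = INR N - INR k.
Proof.
  intros Hv.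
  rewrite (sumN_ext N _ (fun i => 1 + (-1) * sumN k (fun a => v a i * v a i))).
  - rewrite sumN_plus, sumN_const, sumN_scal, sumN_exchange.
    rewrite (sumN_ext k _ (fun _ => 1)), sumN_const; [ring|].
    intros a Ha. change (dot N (v a) (v a) = 1). rewrite Hv by assumption.
    rewrite Nat.eqb_refl; reflexivity.
  - intros i Hi. rewrite residual_norm by assumption.
    assert (Hd : forall x, dot N (basis_vec i) x = x i)
      by (intros x; apply (sumN_delta N i x Hi)).
    rewrite Hd. unfold basis_vec at 1. rewrite Nat.eqb_refl.
    rewrite (sumN_ext k _ (fun a => v a i * v a i)); [ring|].
    intros a _; rewrite Hd; ring.
Qed.

(** The number N - k is a trace, hence a sum of squared norms. This is the source of [6 <= N] once
    six orthonormal vectors are at hand. *)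
Lemma orthonormal_card N k v : orthonormal N k v -> (k <= N)%nat.
Proof.
  intros Hv. apply INR_le.
  assert (H := residual_basis_sum N k v Hv).
  assert (0 <= INR N - INR k); [|lra].
  rewrite <- H. apply sumN_nonneg; intros; apply dot_self_nonneg.
Qed.

(** The squared residuals of the standard basis add up to N - k > 0, so one of them is nonzero; it
    is normalized and appended. *)
Lemma orthonormal_extend N k v :
  orthonormal N k v -> (k < N)%nat ->
  exists v', (forall a, (a < k)%nat -> v' a = v a) /\ orthonormal N (S k) v'.
Proof.
  intros Hv Hk.
  assert (Hi : exists i, (i < N)%nat /\
    dot N (residual N k v (basis_vec i)) (residual N k v (basis_vec i)) <> 0).
  { apply NNPP; intros H.
    assert (Hs := residual_basis_sum N k v Hv).
    rewrite (sumN_ext N _ (fun _ => 0)), sumN_const in Hs.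
    - apply lt_INR in Hk. lra.
    - intros i Hi. apply NNPP; intros Hn. apply H. exists i; auto. }
  destruct Hi as [i [Hi Hn]].
  set (r := residual N k v (basis_vec i)) in *.
  set (c := / sqrt (dot N r r)).
  assert (Hr : 0 < dot N r r) by (assert (H := dot_self_nonneg N r); lra).
  assert (Hu : dot N (fun j => c * r j) (fun j => c * r j) = 1).
  { rewrite dot_scal_l, dot_scal_r.
    assert (Hs := sqrt_sqrt (dot N r r) (Rlt_le _ _ Hr)).
    assert (0 < sqrt (dot N r r)) by (apply sqrt_lt_R0; assumption).
    unfold c. rewrite <- Hs at 3. field. lra. }
  assert (Ho : forall a, (a < k)%nat -> dot N (fun j => c * r j) (v a) = 0).
  { intros a Ha. rewrite dot_scal_l. unfold r. rewrite residual_orth by assumption. ring. }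
  exists (fun a => if Nat.eqb a k then (fun j => c * r j) else v a). split.
  - intros a Ha. destruct (Nat.eqb_spec a k); [lia|reflexivity].
  - intros a b Ha Hb.
    destruct (Nat.eqb_spec a k) as [->|Hak]; destruct (Nat.eqb_spec b k) as [->|Hbk].
    + rewrite Nat.eqb_refl. exact Hu.
    + rewrite Ho by lia. destruct (Nat.eqb_spec k b); [lia|reflexivity].
    + rewrite dot_comm, Ho by lia. destruct (Nat.eqb_spec a k); [lia|reflexivity].
    + apply Hv; lia.
Qed.

Lemma orthonormal_complete N k v :
  orthonormal N k v ->
  exists v', (forall a, (a < k)%nat -> v' a = v a) /\ orthonormal N N v'.
Proof.
  intros Hv. assert (Hk := orthonormal_card N k v Hv).
  remember (N - k)%nat as d eqn:Hd. revert k v Hv Hk Hd.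
  induction d as [|d IH]; intros k v Hv Hk Hd.
  - replace k with N in * by lia. exists v; auto.
  - destruct (orthonormal_extend N k v Hv) as [v1 [H1 H1']]; [lia|].
    destruct (IH (S k) v1 H1') as [v2 [H2 H2']]; [lia|lia|].
    exists v2; split; [|assumption].
    intros a Ha. rewrite H2, H1 by lia. reflexivity.
Qed.

(** * Derivatives of spherical curves *)

(** A smooth function carried together with all its derivatives, so that differentiation is a shift
    of the index. *)
Definition chain (f : nat -> R -> R) : Prop :=
  forall k s, derivable_pt_lim (f k) s (f (S k) s).

Lemma derivable_pt_lim_ext f g x l :
  (forall y, f y = g y) -> derivable_pt_lim f x l -> derivable_pt_lim g x l.
Proof.
  intros H Hf. apply is_derive_Reals. apply (is_derive_ext f g _ _ H).
  apply is_derive_Reals; exact Hf.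
Qed.

Lemma derivable_pt_lim_eq f x l l' :
  l = l' -> derivable_pt_lim f x l -> derivable_pt_lim f x l'.
Proof. intros ->; trivial. Qed.

Lemma dot_derive N (u v : R -> nat -> R) u' v' t :
  (forall i, (i < N)%nat -> derivable_pt_lim (fun t => u t i) t (u' i)) ->
  (forall i, (i < N)%nat -> derivable_pt_lim (fun t => v t i) t (v' i)) ->
  derivable_pt_lim (fun t => dot N (u t) (v t)) t (dot N u' (v t) + dot N (u t) v').
Proof.
  intros Hu Hv. unfold dot. rewrite <- sumN_plus.
  assert (H : forall M, (M <= N)%nat ->
    derivable_pt_lim (fun t => sumN M (fun i => u t i * v t i)) t
      (sumN M (fun i => u' i * v t i + u t i * v' i))).
  { induction M as [|M IH]; intros HM; simpl.
    - apply derivable_pt_lim_const.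
    - apply (derivable_pt_lim_plus (fun t => sumN M (fun i => u t i * v t i))
               (fun t => u t M * v t M)); [apply IH; lia|].
      apply (derivable_pt_lim_mult (fun t => u t M) (fun t => v t M));
        [apply Hu|apply Hv]; lia. }
  apply H; lia.
Qed.

(** [G i k s] stands for the k-th derivative of the i-th coordinate. Chain and periodicity
    conditions run over all [i] to avoid index bounds; coordinates beyond n are filled with zeros in
    [sphere_curve_jets]. *)
Record jets (n : nat) (G : nat -> nat -> R -> R) (L : R) : Prop := {
  jets_chain : forall i, chain (G i);
  jets_periodic : forall i k s, G i k (s + L) = G i k s;
  jets_pos : 0 < L;
  jets_unit : forall s, dot (S n) (fun i => G i 0%nat s) (fun i => G i 0%nat s) = 1;
  jets_speed : forall s, dot (S n) (fun i => G i 1%nat s) (fun i => G i 1%nat s) = 1 }.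

Definition jdot (n : nat) (G : nat -> nat -> R -> R) (a b : nat) (s : R) : R :=
  dot (S n) (fun i => G i a s) (fun i => G i b s).

(** The squared geodesic curvature: gamma'' = k_1 beta_1 - gamma gives |gamma''|^2 = k_1^2 + 1. *)
Definition curv2 n G s := jdot n G 2 2 s - 1.

Lemma sphere_curve_jets n gamma L :
  sphere_curve n gamma L ->
  exists G, jets n G L /\ forall i s, (i < S n)%nat -> G i 0%nat s = gamma s i.
Proof.
  intros (Hsm & Hu & Hsp & HL & Hper & _).
  assert (HG : forall i, exists D : nat -> R -> R,
    chain D /\ (forall s, D O (s + L) = D O s) /\
    ((i < S n)%nat -> forall s, D O s = gamma s i)).
  { intros i. destruct (lt_dec i (S n)) as [Hi|Hi].
    - destruct (Hsm i Hi) as [D [HD0 HD]]. exists D. rewrite HD0. auto.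
    - exists (fun _ _ => 0). split; [|split; [reflexivity|intros; lia]].
      intros k s. apply derivable_pt_lim_const. }
  set (G := fun i => proj1_sig (constructive_indefinite_description _ (HG i))).
  assert (HG' : forall i, chain (G i) /\ (forall s, G i O (s + L) = G i O s) /\
    ((i < S n)%nat -> forall s, G i O s = gamma s i))
    by (intros i; exact (proj2_sig (constructive_indefinite_description _ (HG i)))).
  exists G. split; [split|].
  - apply HG'.
  (* Periodicity passes to derivatives by differentiating f(s + L) = f(s) and using uniqueness of
     the derivative. *)
  - intros i k. destruct (HG' i) as (Hc & Hp & _).
    induction k as [|k IH]; intros s; [apply Hp|].
    apply (uniqueness_limite (G i k) s); [|apply Hc].
    apply (derivable_pt_lim_ext (fun s => G i k (s + L))); [exact IH|].
    apply (derivable_pt_lim_eq _ _ (G i (S k) (s + L) * (1 + 0))); [ring|].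
    apply (derivable_pt_lim_comp (fun s => s + L) (G i k)); [|apply Hc].
    apply (derivable_pt_lim_plus id (fun _ => L));
      [apply derivable_pt_lim_id|apply derivable_pt_lim_const].
  - lra.
  - intros s. rewrite <- (Hu s). apply dot_ext; intros i Hi; apply HG'; trivial.
  - intros s. destruct (Hsp s) as [dg [Hdg H1]]. rewrite <- H1.
    assert (Heq : forall i, (i < S n)%nat -> G i 1%nat s = dg i).
    { intros i Hi. apply (uniqueness_limite (G i O) s); [apply HG'|].
      apply (derivable_pt_lim_ext (fun s => gamma s i)); [|auto].
      intros; symmetry; apply HG'; trivial. }
    apply dot_ext; exact Heq.
  - intros i s Hi. apply HG'; trivial.
Qed.

Section Jets.
Context {n : nat} {G : nat -> nat -> R -> R} {L : R} (HG : jets n G L).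

Lemma jdot_comm a b s : jdot n G a b s = jdot n G b a s.
Proof. apply dot_comm. Qed.

Lemma jdot_derive a b s :
  derivable_pt_lim (jdot n G a b) s (jdot n G (S a) b s + jdot n G a (S b) s).
Proof.
  apply (dot_derive (S n) (fun s i => G i a s) (fun s i => G i b s)
           (fun i => G i (S a) s) (fun i => G i (S b) s));
    intros; apply (jets_chain _ _ _ HG).
Qed.

(** Starting from |gamma| = |gamma'| = 1, repeated use of this rule produces the table of inner
    products of derivatives, up to total order four, on which all later computations rest. *)
Lemma jdot_derive_const a b c :
  (forall s, jdot n G a b s = c) -> forall s, jdot n G (S a) b s + jdot n G a (S b) s = 0.
Proof.
  intros H s. apply (uniqueness_limite (jdot n G a b) s); [apply jdot_derive|].
  apply (derivable_pt_lim_ext (fun _ => c)); [auto|apply derivable_pt_lim_const].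
Qed.

Lemma jdot00 s : jdot n G 0 0 s = 1.
Proof. apply (jets_unit _ _ _ HG). Qed.
Lemma jdot11 s : jdot n G 1 1 s = 1.
Proof. apply (jets_speed _ _ _ HG). Qed.
Lemma jdot01 s : jdot n G 0 1 s = 0.
Proof. generalize (jdot_derive_const 0 0 1 jdot00 s). rewrite (jdot_comm 1 0). lra. Qed.
Lemma jdot02 s : jdot n G 0 2 s = -1.
Proof. generalize (jdot_derive_const 0 1 0 jdot01 s). rewrite jdot11. lra. Qed.
Lemma jdot12 s : jdot n G 1 2 s = 0.
Proof. generalize (jdot_derive_const 1 1 1 jdot11 s). rewrite (jdot_comm 2 1). lra. Qed.
Lemma jdot03 s : jdot n G 0 3 s = 0.
Proof. generalize (jdot_derive_const 0 2 _ jdot02 s). rewrite jdot12. lra. Qed.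
Lemma jdot13 s : jdot n G 1 3 s = - jdot n G 2 2 s.
Proof. generalize (jdot_derive_const 1 2 _ jdot12 s). lra. Qed.
Lemma jdot04 s : jdot n G 0 4 s = jdot n G 2 2 s.
Proof. generalize (jdot_derive_const 0 3 _ jdot03 s). rewrite jdot13. lra. Qed.

Lemma curv2_norm s :
  dot (S n) (fun i => G i 2%nat s + G i 0%nat s) (fun i => G i 2%nat s + G i 0%nat s)
  = curv2 n G s.
Proof.
  rewrite dot_plus_l, !dot_plus_r.
  change (jdot n G 2 2 s + jdot n G 2 0 s + (jdot n G 0 2 s + jdot n G 0 0 s) = curv2 n G s).
  rewrite (jdot_comm 2 0), jdot02, jdot00. unfold curv2. ring.
Qed.

Lemma curv2_nonneg s : 0 <= curv2 n G s.
Proof. rewrite <- curv2_norm. apply dot_self_nonneg. Qed.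

Lemma curv2_eq0 s :
  curv2 n G s = 0 -> forall i, (i < S n)%nat -> G i 2%nat s = - G i 0%nat s.
Proof.
  intros H i Hi. rewrite <- curv2_norm in H.
  assert (H0 := dot_self_eq0 _ _ H i Hi). simpl in H0. lra.
Qed.

Lemma curv2_periodic s : curv2 n G (s + L) = curv2 n G s.
Proof.
  unfold curv2. f_equal. apply dot_ext; intros; apply (jets_periodic _ _ _ HG).
Qed.

End Jets.

Lemma chain_ex_derive f k x : chain f -> ex_derive (f k) x.
Proof. intros H. exists (f (S k) x). apply is_derive_Reals, H. Qed.

Lemma chain_Derive f k x : chain f -> Derive (f k) x = f (S k) x.
Proof. intros H. apply is_derive_unique, is_derive_Reals, H. Qed.

Lemma chain_continuous f k x : chain f -> continuous (f k) x.
Proof. intros H. apply (ex_derive_continuous (V := R_NormedModule)), chain_ex_derive, H. Qed.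

Lemma jdot_ex_derive n G L a b s : jets n G L -> ex_derive (jdot n G a b) s.
Proof. intros H. eexists. apply is_derive_Reals. apply (jdot_derive H). Qed.

Lemma curv2_continuous n G L s : jets n G L -> continuous (curv2 n G) s.
Proof.
  intros H. apply (ex_derive_continuous (V := R_NormedModule)).
  unfold curv2. auto_derive. apply (jdot_ex_derive _ _ _ _ _ _ H).
Qed.

(** * Reduction to one period and vanishing of nonnegative integrands *)

Lemma periodic_reduce L (f : R -> R) :
  0 < L -> (forall s, f (s + L) = f s) -> forall s, exists x, 0 <= x < L /\ f x = f s.
Proof.
  intros HL Hf s.
  assert (Hn : forall (k : nat) x, f (x + INR k * L) = f x).
  { induction k as [|k IH]; intros x.
    - simpl. f_equal; ring.
    - rewrite S_INR. replace (x + (INR k + 1) * L) with (x + INR k * L + L) by ring.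
      rewrite Hf; apply IH. }
  assert (Hz : forall (z : Z) x, f (x + IZR z * L) = f x).
  { intros [|p|p] x.
    - f_equal; ring.
    - rewrite <- (positive_nat_Z p), <- INR_IZR_INZ. apply Hn.
    - change (IZR (Z.neg p)) with (- IZR (Z.pos p)).
      rewrite <- (positive_nat_Z p), <- INR_IZR_INZ, <- (Hn (Pos.to_nat p)).
      f_equal; ring. }
  destruct (archimed (s / L)) as [H1 H2].
  set (z := up (s / L)) in *.
  (* [up r] lies in (r, r + 1], so s / L lies in [z - 1, z). *)
  exists (s + IZR (1 - z) * L). split; [|apply Hz].
  rewrite minus_IZR. assert (Hs : s = s / L * L) by (field; lra).
  split; [|rewrite Hs]; nra.
Qed.

Lemma RInt_nonneg_eq0 (f : R -> R) (a b : R) :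
  a < b -> (forall x, a <= x <= b -> continuous f x) ->
  (forall x, a <= x <= b -> 0 <= f x) ->
  RInt f a b = 0 -> forall x, a <= x <= b -> f x = 0.
Proof.
  intros Hab Hc Hp H0 x Hx.
  destruct (Rle_lt_or_eq_dec 0 (f x) (Hp x Hx)) as [Hpos|]; [exfalso|lra].
  assert (Hcx := Hc x Hx).
  assert (Hl : locally x (fun y => f x / 2 < f y)).
  { apply (Hcx (fun z => f x / 2 < z)).
    apply (locally_open _ (fun z => f x / 2 < z) (open_gt (f x / 2)) (fun _ h => h)). lra. }
  destruct Hl as [[d Hd] Hl].
  (* The interval of radius d/2 about x, cut down to [a, b], keeps positive length even when x is an
     endpoint. *)
  set (c := Rmax a (x - d / 2)). set (e := Rmin b (x + d / 2)).
  assert (Hce : a <= c /\ c < e /\ e <= b).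
  { unfold c, e, Rmax, Rmin. destruct (Rle_dec a _), (Rle_dec b _); lra. }
  assert (Hin : forall y, c <= y <= e -> f x / 2 < f y).
  { intros y Hy. apply Hl. change (Rabs (y - x) < d).
    unfold c, e, Rmax, Rmin in Hy. apply Rabs_def1;
      destruct (Rle_dec a _), (Rle_dec b _); lra. }
  assert (Hex : forall p q, a <= p -> p <= q -> q <= b -> ex_RInt f p q).
  { intros p q H1 H2 H3. apply (ex_RInt_continuous (V := R_CompleteNormedModule)).
    intros z. rewrite Rmin_left, Rmax_right by lra. intros; apply Hc; lra. }
  assert (Hge : forall p q, a <= p -> p <= q -> q <= b -> 0 <= RInt f p q).
  { intros p q H1 H2 H3. apply RInt_ge_0; [lra|apply Hex; lra|intros; apply Hp; lra]. }
  assert (Hm : (e - c) * (f x / 2) <= RInt f c e).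
  { apply Rle_trans with (RInt (fun _ => f x / 2) c e).
    { apply Req_le; symmetry; apply (RInt_const (V := R_CompleteNormedModule)). }
    apply RInt_le; [lra|apply ex_RInt_const|apply Hex; lra|].
    intros; apply Rlt_le, Hin; lra. }
  assert (H1 := RInt_Chasles f a c b (Hex a c ltac:(lra) ltac:(lra) ltac:(lra))
                  (Hex c b ltac:(lra) ltac:(lra) ltac:(lra))).
  assert (H2 := RInt_Chasles f c e b (Hex c e ltac:(lra) ltac:(lra) ltac:(lra))
                  (Hex e b ltac:(lra) ltac:(lra) ltac:(lra))).
  unfold plus in H1, H2; simpl in H1, H2.
  assert (A1 := Hge a c ltac:(lra) ltac:(lra) ltac:(lra)).
  assert (A2 := Hge e b ltac:(lra) ltac:(lra) ltac:(lra)).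
  nra.
Qed.

(** * Wirtinger's inequality *)

(* Equations between [RInt]s are typed in the carrier of [R_CompleteNormedModule],
   which [ring] does not recognise as [R]. *)
Ltac Req := match goal with |- @eq _ ?a ?b => change (@eq R a b) end.
Ltac Rring := Req; ring.

Definition cts (f : R -> R) : Prop := forall x, continuous f x.

Lemma cts_const c : cts (fun _ => c).
Proof. intros x. apply continuous_const. Qed.

Lemma cts_plus f g : cts f -> cts g -> cts (fun x => f x + g x).
Proof. intros Hf Hg x. apply (continuous_plus (V := R_NormedModule) f g); auto. Qed.

Lemma cts_mult f g : cts f -> cts g -> cts (fun x => f x * g x).
Proof. intros Hf Hg x. apply (continuous_mult (K := R_AbsRing) f g); auto. Qed.

Lemma cts_chain f k : chain f -> cts (f k).
Proof. intros H x. apply chain_continuous, H. Qed.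

Lemma cts_sumN N (f : nat -> R -> R) :
  (forall i, (i < N)%nat -> cts (f i)) -> cts (fun x => sumN N (fun i => f i x)).
Proof.
  induction N as [|N IH]; intros H; simpl; [apply cts_const|].
  apply cts_plus; [apply IH; intros; apply H; lia|apply H; lia].
Qed.

Lemma cts_ex_RInt f a b : cts f -> ex_RInt f a b.
Proof. intros H. apply (ex_RInt_continuous (V := R_CompleteNormedModule)); intros; apply H. Qed.

Lemma RInt_cplus f g a b :
  cts f -> cts g -> RInt (fun x => f x + g x) a b = RInt f a b + RInt g a b.
Proof.
  intros Hf Hg. apply (RInt_plus (V := R_CompleteNormedModule) f g); apply cts_ex_RInt; assumption.
Qed.

Lemma RInt_cscal c f a b : cts f -> RInt (fun x => c * f x) a b = c * RInt f a b.
Proof.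
  intros Hf. apply (RInt_scal (V := R_CompleteNormedModule) f); apply cts_ex_RInt; assumption.
Qed.

Lemma RInt_rconst c a b : RInt (fun _ => c) a b = (b - a) * c.
Proof. apply (RInt_const (V := R_CompleteNormedModule)). Qed.

Lemma RInt_cChasles f a b c : cts f -> RInt f a b + RInt f b c = RInt f a c.
Proof.
  intros Hf. apply (RInt_Chasles (V := R_CompleteNormedModule)); apply cts_ex_RInt; assumption.
Qed.

Lemma RInt_csumN N (f : nat -> R -> R) a b :
  (forall i, (i < N)%nat -> cts (f i)) ->
  RInt (fun x => sumN N (fun i => f i x)) a b = sumN N (fun i => RInt (f i) a b).
Proof.
  induction N as [|N IH]; intros H; simpl; [rewrite RInt_rconst; ring|].
  rewrite RInt_cplus, IH; [reflexivity| | |].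
  - intros; apply H; lia.
  - apply cts_sumN; intros; apply H; lia.
  - apply H; lia.
Qed.

Lemma RInt_deriv (F f : R -> R) a b :
  (forall x, derivable_pt_lim F x (f x)) -> cts f -> RInt f a b = F b - F a.
Proof.
  intros HF Hf. apply is_RInt_unique.
  apply (is_RInt_derive (V := R_CompleteNormedModule) F f); intros; [|apply Hf].
  apply is_derive_Reals, HF.
Qed.

Lemma RInt_periodic f L a :
  cts f -> (forall x, f (x + L) = f x) -> RInt f a (a + L) = RInt f 0 L.
Proof.
  intros Hf Hp.
  assert (H : RInt f L (a + L) = RInt f 0 a).
  { assert (H := RInt_comp_lin (V := R_CompleteNormedModule) f 1 L 0 a
                  (cts_ex_RInt _ _ _ Hf)).
    replace (1 * 0 + L) with L in H by ring.
    replace (1 * a + L) with (a + L) in H by ring.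
    rewrite <- H. apply RInt_ext. intros x _.
    unfold scal; simpl; unfold mult; simpl.
    rewrite Rmult_1_l, Rmult_1_l, Hp. reflexivity. }
  generalize (RInt_cChasles f 0 a (a + L) Hf) (RInt_cChasles f 0 L (a + L) Hf).
  rewrite H. lra.
Qed.

(* For mu < pi/(b-a) the integrand h'^2 - mu^2 h^2 + (mu h^2 tan)' is the square
   (h' + mu h tan)^2, the tangent being centred at the midpoint so that it is finite on [a,b]. *)
Lemma dirichlet_poincare_lt h a b mu :
  chain h -> a < b -> h O a = 0 -> h O b = 0 -> 0 < mu -> mu * (b - a) < PI ->
  mu^2 * RInt (fun x => h O x * h O x) a b <= RInt (fun x => h 1%nat x * h 1%nat x) a b.
Proof.
  intros Hh Hab Ha Hb Hmu Hpi.
  set (m := (a + b) / 2).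
  set (tn := fun x => sin (mu * (x - m)) / cos (mu * (x - m))).
  set (F := fun x => h O x * h O x * mu * tn x).
  set (dF := fun x => 2 * h O x * h 1%nat x * mu * tn x
                      + h O x * h O x * mu^2 * (1 + tn x ^ 2)).
  assert (Hcos : forall x, a <= x <= b -> 0 < cos (mu * (x - m))).
  { intros x Hx. apply cos_gt_0; unfold m; nra. }
  assert (HF : is_RInt dF a b (minus (F b) (F a))).
  { apply (is_RInt_derive (V := R_CompleteNormedModule)); intros x;
      rewrite Rmin_left, Rmax_right by lra; intros Hx; specialize (Hcos x Hx).
    - unfold F, dF, tn. auto_derive.
      + repeat split; try (apply chain_ex_derive, Hh). unfold Rminus in Hcos. lra.
      + rewrite !chain_Derive by exact Hh.
        change (x + - m) with (x - m) in *.
        assert (Hsc := sin2_cos2 (mu * (x - m))). unfold Rsqr in Hsc.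
        field_simplify_eq; [|lra].
        replace (sin (mu * (x - m)) ^ 2) with (1 - cos (mu * (x - m)) ^ 2) by lra.
        ring_simplify. ring.
    - apply (ex_derive_continuous (V := R_NormedModule)).
      unfold dF, tn. auto_derive.
      repeat split; try (apply chain_ex_derive, Hh); unfold Rminus in Hcos; lra. }
  assert (HF0 : RInt dF a b = 0).
  { rewrite (is_RInt_unique _ _ _ _ HF). unfold F. rewrite Ha, Hb.
    unfold minus, plus, opp; simpl. ring. }
  assert (Hex : ex_RInt dF a b) by (eexists; exact HF).
  assert (Hc0 : cts (fun x => h O x * h O x)) by (apply cts_mult; apply cts_chain, Hh).
  assert (Hc1 : cts (fun x => h 1%nat x * h 1%nat x)) by (apply cts_mult; apply cts_chain, Hh).
  assert (Hc2 : cts (fun x => mu^2 * (h O x * h O x)))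
    by (apply cts_mult; [apply cts_const|exact Hc0]).
  rewrite <- RInt_cscal by exact Hc0.
  assert (Hm : RInt (fun x => mu^2 * (h O x * h O x) - dF x) a b
               = RInt (fun x => mu^2 * (h O x * h O x)) a b - RInt dF a b).
  { apply (RInt_minus (V := R_CompleteNormedModule)); [apply cts_ex_RInt, Hc2|exact Hex]. }
  rewrite HF0 in Hm. rewrite Rminus_0_r in Hm. rewrite <- Hm.
  apply RInt_le; [lra| |apply cts_ex_RInt, Hc1|].
  - apply (ex_RInt_minus (V := R_CompleteNormedModule)); [apply cts_ex_RInt, Hc2|exact Hex].
  - intros x Hx. unfold dF.
    assert (0 <= (h 1%nat x + mu * h O x * tn x)^2) by apply pow2_ge_0. nra.
Qed.

(** At the critical value mu = pi/(b - a) the tangent blows up at both ends, so this case is reached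
    from below, with mu = om - e. *)
Lemma dirichlet_poincare h a b :
  chain h -> a < b -> h O a = 0 -> h O b = 0 ->
  (PI / (b - a))^2 * RInt (fun x => h O x * h O x) a b
  <= RInt (fun x => h 1%nat x * h 1%nat x) a b.
Proof.
  intros Hh Hab Ha Hb.
  assert (Hpi := PI_RGT_0).
  set (om := PI / (b - a)). set (S0 := RInt (fun x => h O x * h O x) a b).
  set (D0 := RInt (fun x => h 1%nat x * h 1%nat x) a b).
  assert (Hom : 0 < om) by (apply Rdiv_lt_0_compat; lra).
  assert (HS : 0 <= S0).
  { apply RInt_ge_0; [lra| |intros; nra].
    apply cts_ex_RInt, cts_mult; apply cts_chain, Hh. }
  destruct (Rle_lt_dec (om^2 * S0) D0) as [|Hlt]; [assumption|exfalso].
  assert (Hl : forall e, 0 < e < om -> (om - e)^2 * S0 <= D0).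
  { intros e He. apply dirichlet_poincare_lt; try assumption; [lra|].
    replace PI with (om * (b - a)) by (unfold om; field; lra). nra. }
  assert (HS0 : 0 < S0).
  { assert (H := Hl (om / 2) ltac:(lra)). nra. }
  (* The second entry makes the loss 2 om e S0 at most half of the gap om^2 S0 - D0; the first keeps
     om - e positive. *)
  set (e := Rmin (om / 2) ((om^2 * S0 - D0) / (4 * om * S0))).
  assert (He : 0 < e <= om / 2).
  { split; [apply Rmin_pos; [lra|]|apply Rmin_l].
    apply Rdiv_lt_0_compat; [lra|]. apply Rmult_lt_0_compat; lra. }
  assert (He2 : e * (4 * om * S0) <= om^2 * S0 - D0).
  { apply Rle_trans with ((om^2 * S0 - D0) / (4 * om * S0) * (4 * om * S0)).
    - apply Rmult_le_compat_r; [nra|apply Rmin_r].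
    - apply Req_le. field. lra. }
  assert (H := Hl e ltac:(lra)). nra.
Qed.

Section Wirtinger.
Variable L : R.
Hypothesis HL : 0 < L.
Let om := 2 * PI / L.

Definition wirtinger_form (f : nat -> R -> R) : R :=
  RInt (fun x => f 1%nat x * f 1%nat x) 0 L - om^2 * RInt (fun x => f O x * f O x) 0 L.

(* A zero x0 of f(x + L/2) - f(x) gives c = f(x0) = f(x0 + L/2), so f - c
   satisfies Dirichlet conditions on both halves of a period. *)
Lemma wirtinger f :
  chain f -> (forall k x, f k (x + L) = f k x) -> RInt (f O) 0 L = 0 ->
  0 <= wirtinger_form f.
Proof.
  intros Hf Hp H0.
  assert (Hcf : forall k, cts (f k)) by (intros; apply cts_chain, Hf).
  assert (Hx0 : exists x0, f O (x0 + L / 2) = f O x0).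
  (* By periodicity the difference takes opposite values at 0 and L/2, so the intermediate value
     theorem applies. *)
  { destruct (IVT_gen (fun x => f O (x + L / 2) - f O x) 0 (L / 2) 0) as [x0 [_ Hx0]].
    - intros x. apply derivable_continuous_pt.
      exists (f 1%nat (x + L / 2) - f 1%nat x). apply is_derive_Reals. auto_derive.
      + repeat split; apply chain_ex_derive, Hf.
      + rewrite !chain_Derive by exact Hf. ring.
    - replace (L / 2 + L / 2) with (0 + L) by field. rewrite Hp, Rplus_0_l.
      unfold Rmin, Rmax. destruct (Rle_dec _ _); lra.
    - exists x0. lra. }
  destruct Hx0 as [x0 Hx0]. set (c := f O x0) in *.
  set (h := fun k x => match k with O => f O x - c | _ => f k x end).
  assert (Hh : chain h).
  { intros [|k] x; simpl; [|apply Hf].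
    apply (derivable_pt_lim_eq _ _ (f 1%nat x - 0)); [ring|].
    apply (derivable_pt_lim_minus (f O) (fun _ => c)); [apply Hf|apply derivable_pt_lim_const]. }
  assert (Hch : forall k, cts (h k)) by (intros; apply cts_chain, Hh).
  assert (A1 := dirichlet_poincare h x0 (x0 + L / 2) Hh ltac:(lra)).
  assert (A2 := dirichlet_poincare h (x0 + L / 2) (x0 + L) Hh ltac:(lra)).
  replace (PI / (x0 + L / 2 - x0)) with om in A1 by (unfold om; field; lra).
  replace (PI / (x0 + L - (x0 + L / 2))) with om in A2 by (unfold om; field; lra).
  simpl in A1, A2. fold c in A1. rewrite Hp, Hx0 in A2. fold c in A2. rewrite Hx0 in A1.
  specialize (A1 ltac:(ring) ltac:(ring)). specialize (A2 ltac:(ring) ltac:(ring)).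
  set (h2 := fun x => (f O x - c) * (f O x - c)) in *.
  set (d2 := fun x => f 1%nat x * f 1%nat x) in *.
  assert (Hch2 : cts h2) by (apply (cts_mult (h O) (h O)); apply Hch).
  assert (Hcd2 : cts d2) by (apply cts_mult; apply Hcf).
  assert (B1 := RInt_cChasles h2 x0 (x0 + L / 2) (x0 + L) Hch2).
  assert (B2 := RInt_cChasles d2 x0 (x0 + L / 2) (x0 + L) Hcd2).
  rewrite (RInt_periodic h2 L) in B1; [|exact Hch2|intros; unfold h2; rewrite Hp; reflexivity].
  rewrite (RInt_periodic d2 L) in B2; [|exact Hcd2|intros; unfold d2; rewrite Hp; reflexivity].
  (* Because f has mean zero, subtracting c can only increase the integral of the square, so the
     bound for f - c implies the one for f. *)
  assert (B3 : RInt h2 0 L = RInt (fun x => f O x * f O x) 0 L + c^2 * L).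
  { rewrite (RInt_ext h2 (fun x => f O x * f O x + ((-2 * c) * f O x + c^2)))
      by (intros; unfold h2; simpl; ring).
    assert (cts (fun x => f O x * f O x)) by (apply cts_mult; apply Hcf).
    assert (cts (fun x => -2 * c * f O x)) by (apply cts_mult; [apply cts_const|apply Hcf]).
    rewrite RInt_cplus, RInt_cplus, RInt_cscal, H0, RInt_rconst;
      auto using cts_const, cts_plus. Rring. }
  unfold wirtinger_form. fold d2.
  assert (0 <= om^2) by apply pow2_ge_0. assert (0 <= c^2) by apply pow2_ge_0.
  assert (0 <= om^2 * (c^2 * L)) by (apply Rmult_le_pos; [|apply Rmult_le_pos]; lra).
  simpl in *. nra.
Qed.

(* In the equality case perturb f by g = f'' + om^2 f: the first-order term is -2 int g^2. *)
Lemma wirtinger_eq f :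
  chain f -> (forall k x, f k (x + L) = f k x) -> RInt (f O) 0 L = 0 ->
  wirtinger_form f = 0 -> forall x, f 2%nat x = - om^2 * f O x.
Proof.
  intros Hf Hp H0 HW.
  assert (Hcf : forall k, cts (f k)) by (intros; apply cts_chain, Hf).
  set (g := fun k x => f (S (S k)) x + om^2 * f k x).
  assert (Hg : chain g).
  { intros k x. unfold g.
    apply (derivable_pt_lim_plus (f (S (S k))) (fun x => om^2 * f k x)); [apply Hf|].
    apply (derivable_pt_lim_scal (f k)). apply Hf. }
  assert (Hcg : forall k, cts (g k)) by (intros; apply cts_chain, Hg).
  assert (Hgp : forall k x, g k (x + L) = g k x) by (intros; unfold g; rewrite !Hp; ring).
  assert (Hg0 : RInt (g O) 0 L = 0).
  { unfold g. rewrite RInt_cplus, RInt_cscal, H0;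
      [|auto|auto|apply cts_mult; [apply cts_const|auto]].
    rewrite (RInt_deriv (f 1%nat)); [|intros; apply Hf|auto].
    rewrite <- (Hp 1%nat 0), Rplus_0_l. Rring. }
  set (I := RInt (fun x => g O x * g O x) 0 L).
  assert (Hcgg : cts (fun x => g O x * g O x)) by (apply cts_mult; auto).
  assert (HB : RInt (fun x => f 1%nat x * g 1%nat x) 0 L
               - om^2 * RInt (fun x => f O x * g O x) 0 L = - I).
  { assert (C1 : cts (fun x => f 1%nat x * g 1%nat x)) by (apply cts_mult; auto).
    assert (C2 : cts (fun x => f O x * g O x)) by (apply cts_mult; auto).
    assert (C3 : cts (fun x => - om^2 * (f O x * g O x)))
      by (apply cts_mult; [apply cts_const|auto]).
    (* Since g - om^2 f = f'', the integrand is (f' g)', whose integral over a period vanishes. *)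
    assert (E : RInt (fun x => (f 1%nat x * g 1%nat x + (- om^2 * (f O x * g O x)))
                               + g O x * g O x) 0 L = 0).
    { rewrite (RInt_ext _ (fun x => f 2%nat x * g O x + f 1%nat x * g 1%nat x))
        by (intros; unfold g; simpl; ring).
      rewrite (RInt_deriv (fun x => f 1%nat x * g O x)).
      - rewrite <- (Hp 1%nat 0), <- (Hgp O 0), Rplus_0_l. Rring.
      - intros x. apply (derivable_pt_lim_mult (f 1%nat) (g O)); [apply Hf|apply Hg].
      - apply cts_plus; apply cts_mult; auto. }
    rewrite RInt_cplus, RInt_cplus, RInt_cscal in E; auto using cts_plus.
    fold I in E. lra. }
  (* This is Wirtinger's inequality for f + e g. The constant term is the form of f, which is zero,
     so a nonzero linear coefficient would violate it for small e. *)
  assert (Hq : forall e, 0 <= - 2 * e * I + e^2 * wirtinger_form g).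
  { intros e. set (fe := fun k x => f k x + e * g k x).
    assert (Hfe : chain fe).
    { intros k x. apply (derivable_pt_lim_plus (f k) (fun x => e * g k x)); [apply Hf|].
      apply (derivable_pt_lim_scal (g k)), Hg. }
    assert (Hexp : forall k, RInt (fun x => fe k x * fe k x) 0 L =
      RInt (fun x => f k x * f k x) 0 L + 2 * e * RInt (fun x => f k x * g k x) 0 L
      + e^2 * RInt (fun x => g k x * g k x) 0 L).
    { intros k.
      rewrite (RInt_ext _ (fun x => (f k x * f k x + 2 * e * (f k x * g k x))
                                    + e^2 * (g k x * g k x)))
        by (intros; unfold fe; simpl; ring).
      rewrite RInt_cplus, RInt_cplus, !RInt_cscal;
        auto 6 using cts_plus, cts_mult, cts_const. }
    assert (H := wirtinger fe Hfe).
    unfold wirtinger_form in *. rewrite !Hexp in H.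
    assert (H' := H ltac:(intros; unfold fe; rewrite Hp, Hgp; reflexivity)).
    unfold fe in H'. rewrite RInt_cplus, RInt_cscal, H0, Hg0 in H';
      auto using cts_mult, cts_const.
    specialize (H' ltac:(Rring)). nra. }
  assert (HI : I = 0).
  { assert (0 <= I) by (apply RInt_ge_0; [lra|apply cts_ex_RInt, Hcgg|intros; nra]).
    destruct (Req_dec I 0) as [|Hn]; [assumption|exfalso].
    set (W := wirtinger_form g) in *.
    assert (HW0 : 0 <= W) by (apply wirtinger; assumption).
    (* At this e the quadratic equals - e^2 (W + 2), negative unless I = 0. *)
    assert (H1 := Hq (I / (W + 1))).
    assert (E : -2 * (I / (W + 1)) * I + (I / (W + 1))^2 * W
                = - (I / (W + 1))^2 * (W + 2)) by (field; lra).
    rewrite E in H1.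
    assert (0 < I / (W + 1)) by (apply Rdiv_lt_0_compat; lra). nra. }
  intros x. destruct (periodic_reduce L (g O) HL (Hgp O) x) as [y [Hy Ey]].
  assert (Hz : g O y * g O y = 0).
  { apply (RInt_nonneg_eq0 (fun x => g O x * g O x) 0 L); try assumption; try lra.
    - intros; apply Hcgg.
    - intros; nra. }
  assert (g O y = 0) by nra. rewrite Ey in H. unfold g in H. lra.
Qed.

End Wirtinger.

(** * Two-dimensional Riemann sums *)

Definition riemann_sum1 (f : R -> R) (L : R) (k : nat) : R :=
  sumN k (fun i => f (INR i * L / INR k)) * (L / INR k).

Lemma INR_S_pos k : 0 < INR (S k).
Proof. apply lt_0_INR; lia. Qed.

(** Induction on the number of cells: each cell of width h adds an error of at most eps h. *)
Lemma riemann_sum1_error f L k eps :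
  0 < L -> cts f ->
  (forall x y, Rabs (x - y) <= L / INR (S k) -> Rabs (f x - f y) <= eps) ->
  Rabs (riemann_sum1 f L (S k) - RInt f 0 L) <= eps * L.
Proof.
  intros HL Hf Heps. assert (Hk := INR_S_pos k).
  set (h := L / INR (S k)) in *.
  assert (Hh : 0 < h) by (apply Rdiv_lt_0_compat; lra).
  assert (Hx : forall i, INR i * L / INR (S k) = INR i * h) by (intros; unfold h; field; lra).
  assert (H : forall j, Rabs (sumN j (fun i => f (INR i * h)) * h - RInt f 0 (INR j * h))
                        <= eps * (INR j * h)).
  { induction j as [|j IH].
    - simpl. rewrite !Rmult_0_l, RInt_point. unfold zero; simpl.
      rewrite Rmult_0_r, Rminus_0_r, Rabs_R0. lra.
    - rewrite S_INR. simpl sumN.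
      rewrite <- (RInt_cChasles f 0 (INR j * h) _ Hf).
      replace ((sumN j (fun i => f (INR i * h)) + f (INR j * h)) * h -
        (RInt f 0 (INR j * h) + RInt f (INR j * h) ((INR j + 1) * h)))
      with ((sumN j (fun i => f (INR i * h)) * h - RInt f 0 (INR j * h)) +
        (f (INR j * h) * h - RInt f (INR j * h) ((INR j + 1) * h))) by ring.
      eapply Rle_trans; [apply Rabs_triang|].
      assert (H1 : Rabs (f (INR j * h) * h - RInt f (INR j * h) ((INR j + 1) * h)) <= h * eps).
      { replace (f (INR j * h) * h - RInt f (INR j * h) ((INR j + 1) * h))
          with (RInt (fun x => f (INR j * h) + (-1) * f x) (INR j * h) ((INR j + 1) * h)).
        - eapply Rle_trans; [apply (abs_RInt_le_const _ _ _ eps)|apply Req_le; ring].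
          + nra.
          + apply cts_ex_RInt, cts_plus; [apply cts_const|apply cts_mult; [apply cts_const|exact Hf]].
          + intros x Hxx. replace (f (INR j * h) + -1 * f x) with (f (INR j * h) - f x) by ring.
            apply Heps. apply Rabs_le. nra.
        - rewrite RInt_cplus, RInt_cscal, RInt_rconst;
            [Rring|exact Hf|apply cts_const|apply cts_mult; [apply cts_const|exact Hf]]. }
      nra. }
  specialize (H (S k)). unfold riemann_sum1. fold h.
  replace (INR (S k) * h) with L in H by (unfold h; field; lra).
  rewrite (sumN_ext _ _ (fun i => f (INR i * h))); [exact H|intros; rewrite Hx; reflexivity].
Qed.

Lemma mesh_small L d : 0 < d -> exists K, forall k, (k >= K)%nat -> L / INR (S k) < d.
Proof.
  intros Hd. destruct (archimed_cor1 (d / (Rabs L + 1))) as [K [HK HK0]].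
  { apply Rdiv_lt_0_compat; [lra|]. assert (H := Rabs_pos L); lra. }
  exists K. intros k Hk. assert (H := Rabs_pos L). assert (H' := Rle_abs L).
  assert (H1 : / INR (S k) <= / INR K).
  { apply Rinv_le_contravar; [apply lt_0_INR; lia|apply le_INR; lia]. }
  assert (H2 : 0 < / INR (S k)) by apply Rinv_0_lt_compat, INR_S_pos.
  assert (E : (Rabs L + 1) * (d / (Rabs L + 1)) = d) by (field; lra).
  unfold Rdiv in *. nra.
Qed.

(** A 1-Lipschitz retraction onto [0, L]. Composing with it turns continuity on the closed rectangle
    into uniform continuity on the plane and leaves Riemann sums unchanged, as their nodes lie in
    the rectangle. *)
Definition clamp (L x : R) : R := Rmax 0 (Rmin x L).

Lemma clamp_bounds L x : 0 < L -> 0 <= clamp L x <= L.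
Proof. intros; unfold clamp, Rmax, Rmin. repeat destruct (Rle_dec _ _); lra. Qed.

Lemma clamp_id L x : 0 <= x <= L -> clamp L x = x.
Proof. intros; unfold clamp, Rmax, Rmin. repeat destruct (Rle_dec _ _); lra. Qed.

Lemma clamp_lip L x y : 0 < L -> Rabs (clamp L x - clamp L y) <= Rabs (x - y).
Proof.
  intros; unfold clamp, Rmax, Rmin, Rabs.
  repeat destruct (Rle_dec _ _); repeat destruct (Rcase_abs _); lra.
Qed.

Lemma unif_cts (f : R -> R) :
  (forall eps, 0 < eps -> exists d, 0 < d /\
     forall x y, Rabs (x - y) < d -> Rabs (f x - f y) <= eps) -> cts f.
Proof.
  intros H x. apply continuity_pt_filterlim. intros eps He.
  destruct (H (eps / 2)) as [d [Hd Hf]]; [lra|].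
  exists d. split; [exact Hd|]. intros y [_ Hy]. simpl in *. unfold R_dist in *.
  specialize (Hf y x Hy). lra.
Qed.

Definition unif2 (f : R -> R -> R) : Prop :=
  forall eps, 0 < eps -> exists d, 0 < d /\ forall x y x' y',
    Rabs (x - x') < d -> Rabs (y - y') < d -> Rabs (f x y - f x' y') <= eps.

Lemma unif2_integral f L Lh :
  0 < L -> 0 < Lh -> unif2 f ->
  is_integral2 f L Lh (RInt (fun s => RInt (f s) 0 Lh) 0 L).
Proof.
  intros HL HLh Hf.
  assert (Hfu : forall s, cts (f s)).
  { intros s. apply unif_cts. intros eps He. destruct (Hf eps He) as [d [Hd H]].
    exists d; split; [exact Hd|]. intros; apply H; [|assumption].
    rewrite Rminus_diag, Rabs_R0; exact Hd. }
  set (G := fun s => RInt (f s) 0 Lh).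
  assert (HGu : forall eps, 0 < eps -> exists d, 0 < d /\
     forall x y, Rabs (x - y) < d -> Rabs (G x - G y) <= eps).
  { intros eps He. destruct (Hf (eps / Lh)) as [d [Hd H]]; [apply Rdiv_lt_0_compat; lra|].
    exists d; split; [exact Hd|]. intros x y Hxy. unfold G.
    replace (RInt (f x) 0 Lh - RInt (f y) 0 Lh)
      with (RInt (fun u => f x u + (-1) * f y u) 0 Lh).
    - eapply Rle_trans; [apply (abs_RInt_le_const _ _ _ (eps / Lh))|].
      + lra.
      + apply cts_ex_RInt, cts_plus; [apply Hfu|apply cts_mult; [apply cts_const|apply Hfu]].
      + intros u _. replace (f x u + -1 * f y u) with (f x u - f y u) by ring.
        apply H; [exact Hxy|]. rewrite Rminus_diag, Rabs_R0; exact Hd.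
      + apply Req_le. field. lra.
    - rewrite RInt_cplus, RInt_cscal; [Rring|apply Hfu|apply Hfu|].
      apply cts_mult; [apply cts_const|apply Hfu]. }
  assert (HG : cts G) by (apply unif_cts, HGu).
  intros eps He. fold G.
  (* [e] bounds the error of the inner sums and [e'] that of the outer sum; after multiplication by
     the lengths each contributes eps/4. *)
  set (e := eps / (4 * L * Lh)). set (e' := eps / (4 * L)).
  assert (He0 : 0 < e) by (apply Rdiv_lt_0_compat; [lra|]; nra).
  assert (He0' : 0 < e') by (apply Rdiv_lt_0_compat; lra).
  destruct (Hf e He0) as [d [Hd H]]. destruct (HGu e' He0') as [d' [Hd' H']].
  destruct (mesh_small L d' Hd') as [K1 HK1]. destruct (mesh_small Lh d Hd) as [K2 HK2].
  exists (max K1 K2). intros k Hk. unfold R_dist.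
  specialize (HK1 k ltac:(lia)). specialize (HK2 k ltac:(lia)).
  assert (Hkp := INR_S_pos k).
  assert (E1 : Rabs (riemann_sum1 G L (S k) - RInt G 0 L) <= e' * L).
  { apply riemann_sum1_error; [exact HL|exact HG|]. intros x y Hxy. apply H'. lra. }
  assert (E2 : Rabs (riemann_sum2 f L Lh (S k) - riemann_sum1 G L (S k)) <= e * Lh * L).
  { replace (riemann_sum2 f L Lh (S k)) with
      (sumN (S k) (fun i => riemann_sum1 (f (INR i * L / INR (S k))) Lh (S k)) * (L / INR (S k))).
    - unfold riemann_sum1 at 2. rewrite <- Rmult_minus_distr_r.
      rewrite Rabs_mult, (Rabs_pos_eq (L / INR (S k)));
        [|apply Rlt_le, Rdiv_lt_0_compat; lra].
      replace (e * Lh * L) with ((INR (S k) * (e * Lh)) * (L / INR (S k))) by (field; lra).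
      apply Rmult_le_compat_r; [apply Rlt_le, Rdiv_lt_0_compat; lra|].
      rewrite <- sumN_const.
      replace (sumN (S k) (fun i => riemann_sum1 (f (INR i * L / INR (S k))) Lh (S k)) -
               sumN (S k) (fun i => G (INR i * L / INR (S k))))
        with (sumN (S k) (fun i => riemann_sum1 (f (INR i * L / INR (S k))) Lh (S k)
                                   + (-1) * G (INR i * L / INR (S k))))
        by (rewrite sumN_plus, sumN_scal; ring).
      eapply Rle_trans; [apply sumN_abs_le|]. apply sumN_le. intros i _.
      replace (_ + -1 * _) with (riemann_sum1 (f (INR i * L / INR (S k))) Lh (S k)
                - RInt (f (INR i * L / INR (S k))) 0 Lh) by (unfold G; ring).
      apply riemann_sum1_error; [exact HLh|apply Hfu|]. intros x y Hxy. apply H; [|lra].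
      rewrite Rminus_diag, Rabs_R0; exact Hd.
    - unfold riemann_sum2. unfold riemann_sum1.
      rewrite (Rmult_comm (sumN (S k) (fun i => sumN _ _)) (L / INR (S k))), Rmult_assoc.
      rewrite (Rmult_comm (L / INR (S k))). f_equal.
      rewrite (Rmult_comm (sumN (S k) _) (Lh / INR (S k))), <- sumN_scal.
      apply sumN_ext; intros; ring. }
  replace (riemann_sum2 f L Lh (S k) - RInt G 0 L) with
    ((riemann_sum2 f L Lh (S k) - riemann_sum1 G L (S k)) +
     (riemann_sum1 G L (S k) - RInt G 0 L)) by ring.
  eapply Rle_lt_trans; [apply Rabs_triang|].
  replace (e * Lh * L) with (eps / 4) in E2 by (unfold e; field; lra).
  replace (e' * L) with (eps / 4) in E1 by (unfold e'; field; lra).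
  lra.
Qed.

Lemma grid_point L k i :
  0 < L -> (i < S k)%nat -> 0 <= INR i * L / INR (S k) <= L.
Proof.
  intros HL Hi. assert (Hk := INR_S_pos k). assert (H := pos_INR i).
  assert (H' : INR i <= INR (S k)) by (apply le_INR; lia).
  split.
  - apply Rdiv_le_0_compat; nra.
  - apply Rmult_le_reg_r with (INR (S k)); [exact Hk|].
    replace (INR i * L / INR (S k) * INR (S k)) with (INR i * L) by (field; lra). nra.
Qed.

Lemma riemann_sum2_ext f g L Lh k :
  0 < L -> 0 < Lh ->
  (forall s u, 0 <= s <= L -> 0 <= u <= Lh -> f s u = g s u) ->
  riemann_sum2 f L Lh (S k) = riemann_sum2 g L Lh (S k).
Proof.
  intros HL HLh H. unfold riemann_sum2. f_equal. f_equal.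
  apply sumN_ext; intros i Hi. apply sumN_ext; intros j Hj.
  apply H; apply grid_point; assumption.
Qed.

Lemma Un_cv_ext u v l : (forall k, u k = v k) -> Un_cv u l -> Un_cv v l.
Proof.
  intros H Hu eps He. destruct (Hu eps He) as [K HK]. exists K. intros k Hk.
  rewrite <- H. auto.
Qed.

Lemma is_integral2_ext f g L Lh I :
  0 < L -> 0 < Lh ->
  (forall s u, 0 <= s <= L -> 0 <= u <= Lh -> f s u = g s u) ->
  is_integral2 f L Lh I -> is_integral2 g L Lh I.
Proof.
  intros HL HLh H. apply Un_cv_ext. intros k. apply riemann_sum2_ext; assumption.
Qed.

(** Criticality speaks only of families that possess Willmore values; this supplies those values for
    the competitor. *)
Lemma is_integral2_exists f L Lh :
  0 < L -> 0 < Lh ->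
  (forall s u, 0 <= s <= L -> 0 <= u <= Lh -> continuity_2d_pt f s u) ->
  exists I, is_integral2 f L Lh I.
Proof.
  intros HL HLh Hf.
  set (g := fun s u => f (clamp L s) (clamp Lh u)).
  assert (Hg : unif2 g).
  { intros eps He.
    destruct (uniform_continuity_2d f 0 L 0 Lh Hf (mkposreal eps He)) as [[d Hd] H].
    exists d; split; [exact Hd|]. intros x y x' y' Hx Hy. apply Rlt_le.
    apply H; try apply clamp_bounds; try assumption; simpl.
    - eapply Rle_lt_trans; [apply clamp_lip|]; assumption.
    - eapply Rle_lt_trans; [apply clamp_lip|]; assumption. }
  eexists. eapply is_integral2_ext; [exact HL|exact HLh| |apply unif2_integral; eassumption].
  intros s u Hs Hu. unfold g. rewrite !clamp_id by assumption. reflexivity.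
Qed.

Lemma riemann_sum2_plus f g L Lh k :
  riemann_sum2 (fun s u => f s u + g s u) L Lh k
  = riemann_sum2 f L Lh k + riemann_sum2 g L Lh k.
Proof.
  unfold riemann_sum2. rewrite <- !Rmult_plus_distr_r. f_equal. f_equal.
  rewrite <- sumN_plus. apply sumN_ext; intros. apply sumN_plus.
Qed.

(** The sums themselves factor, so the double integral of a product is obtained as a limit of
    products, without iterated integration. *)
Lemma riemann_sum2_prod p q L Lh k :
  riemann_sum2 (fun s u => p s * q u) L Lh k = riemann_sum1 p L k * riemann_sum1 q Lh k.
Proof.
  unfold riemann_sum2, riemann_sum1.
  rewrite (sumN_ext k _ (fun i => sumN k (fun j => q (INR j * Lh / INR k)) * p (INR i * L / INR k))).
  - rewrite sumN_scal. ring.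
  - intros i _. rewrite sumN_scal. ring.
Qed.

Lemma riemann_sum2_scal c f L Lh k :
  riemann_sum2 (fun s u => c * f s u) L Lh k = c * riemann_sum2 f L Lh k.
Proof.
  unfold riemann_sum2. rewrite <- !Rmult_assoc. f_equal. f_equal.
  rewrite <- sumN_scal. apply sumN_ext; intros. apply sumN_scal.
Qed.

Lemma riemann_sum2_abs_le f L Lh k e :
  0 < L -> 0 < Lh ->
  (forall s u, 0 <= s <= L -> 0 <= u <= Lh -> Rabs (f s u) <= e) ->
  Rabs (riemann_sum2 f L Lh (S k)) <= e * L * Lh.
Proof.
  intros HL HLh H. assert (Hk := INR_S_pos k). unfold riemann_sum2.
  assert (H1 : 0 < L / INR (S k)) by (apply Rdiv_lt_0_compat; lra).
  assert (H2 : 0 < Lh / INR (S k)) by (apply Rdiv_lt_0_compat; lra).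
  rewrite !Rabs_mult, (Rabs_pos_eq (L / _)), (Rabs_pos_eq (Lh / _)) by lra.
  replace (e * L * Lh) with ((INR (S k) * (INR (S k) * e)) * (L / INR (S k)) * (Lh / INR (S k)))
    by (field; lra).
  apply Rmult_le_compat_r; [lra|]. apply Rmult_le_compat_r; [lra|].
  rewrite <- !sumN_const.
  eapply Rle_trans; [apply sumN_abs_le|]. apply sumN_le; intros i Hi.
  eapply Rle_trans; [apply sumN_abs_le|]. apply sumN_le; intros j Hj.
  apply H; apply grid_point; assumption.
Qed.

Lemma riemann_sum1_cv f L :
  0 < L -> cts f -> Un_cv (fun k => riemann_sum1 f L (S k)) (RInt f 0 L).
Proof.
  intros HL Hf eps He.
  (* A dummy second variable in [0, 1] brings uniform continuity in one variable under the
     two-dimensional theorem. *)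
  assert (Hc : forall x y, 0 <= x <= L -> 0 <= y <= 1 -> continuity_2d_pt (fun x _ => f x) x y).
  { intros x y _ _. apply continuity_1d_2d_pt_comp with (f := f) (g := fun x _ => x).
    - apply continuity_pt_filterlim, Hf.
    - apply continuity_2d_pt_id1. }
  set (e := eps / (2 * L)).
  assert (He0 : 0 < e) by (apply Rdiv_lt_0_compat; lra).
  destruct (uniform_continuity_2d (fun x _ => f x) 0 L 0 1 Hc (mkposreal e He0)) as [[d Hd] H].
  destruct (mesh_small L d Hd) as [K HK]. exists K. intros k Hk. unfold R_dist.
  specialize (HK k Hk).
  set (g := fun x => f (clamp L x)).
  assert (Hg : forall x y, Rabs (x - y) < d -> Rabs (g x - g y) < e).
  { intros x y Hxy. apply (H (clamp L y) 0 (clamp L x) 0); simpl; try lra;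
      try apply clamp_bounds; try assumption.
    - eapply Rle_lt_trans; [apply clamp_lip|]; assumption.
    - rewrite Rminus_diag, Rabs_R0; exact Hd. }
  assert (Hgc : cts g).
  { intros x. unfold g. apply continuous_comp with (f := clamp L); [|apply Hf].
    apply (unif_cts (clamp L)). intros e1 He1. exists e1; split; [exact He1|].
    intros a b Hab. eapply Rle_trans; [apply clamp_lip; exact HL|lra]. }
  assert (E := riemann_sum1_error g L k e HL Hgc).
  replace (riemann_sum1 f L (S k)) with (riemann_sum1 g L (S k)).
  - replace (RInt f 0 L) with (RInt g 0 L).
    + eapply Rle_lt_trans; [apply E|unfold e; field_simplify; lra].
      intros x y Hxy. apply Rlt_le, Hg. lra.
    + apply RInt_ext. intros x. rewrite Rmin_left, Rmax_right by lra.
      intros Hx. unfold g. rewrite clamp_id by lra. reflexivity.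
  - unfold riemann_sum1. f_equal. apply sumN_ext. intros i Hi. unfold g.
    rewrite clamp_id; [reflexivity|apply grid_point; assumption].
Qed.

Lemma is_integral2_prod p q L Lh :
  0 < L -> 0 < Lh -> cts p -> cts q ->
  is_integral2 (fun s u => p s * q u) L Lh (RInt p 0 L * RInt q 0 Lh).
Proof.
  intros HL HLh Hp Hq.
  apply (Un_cv_ext (fun k => riemann_sum1 p L (S k) * riemann_sum1 q Lh (S k)));
    [intros; symmetry; apply riemann_sum2_prod|].
  apply (CV_mult (fun k => riemann_sum1 p L (S k)) (fun k => riemann_sum1 q Lh (S k)));
    apply riemann_sum1_cv; assumption.
Qed.

Lemma is_integral2_plus f g L Lh I J :
  is_integral2 f L Lh I -> is_integral2 g L Lh J ->
  is_integral2 (fun s u => f s u + g s u) L Lh (I + J).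
Proof.
  intros Hf Hg.
  apply (Un_cv_ext (fun k => riemann_sum2 f L Lh (S k) + riemann_sum2 g L Lh (S k)));
    [intros; symmetry; apply riemann_sum2_plus|].
  apply CV_plus; assumption.
Qed.

Lemma is_integral2_scal c f L Lh I :
  is_integral2 f L Lh I -> is_integral2 (fun s u => c * f s u) L Lh (c * I).
Proof.
  intros Hf.
  apply (Un_cv_ext (fun k => c * riemann_sum2 f L Lh (S k)));
    [intros; symmetry; apply riemann_sum2_scal|].
  apply (CV_mult (fun _ => c)); [|assumption].
  intros e He. exists O. intros. unfold R_dist. rewrite Rminus_diag, Rabs_R0. exact He.
Qed.

Lemma is_integral2_abs_le f L Lh I e :
  0 < L -> 0 < Lh ->
  (forall s u, 0 <= s <= L -> 0 <= u <= Lh -> Rabs (f s u) <= e) ->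
  is_integral2 f L Lh I -> Rabs I <= e * L * Lh.
Proof.
  intros HL HLh H HI.
  destruct (Rle_lt_dec (Rabs I) (e * L * Lh)) as [|Hlt]; [assumption|exfalso].
  destruct (HI (Rabs I - e * L * Lh)) as [K HK]; [lra|].
  specialize (HK K ltac:(lia)). unfold R_dist in HK.
  assert (H1 := riemann_sum2_abs_le f L Lh K e HL HLh H).
  assert (H2 := Rabs_triang_inv I (riemann_sum2 f L Lh (S K))).
  rewrite Rabs_minus_sym in HK. lra.
Qed.

(** * Smooth functions of (t,s,u) as expressions *)

Section DerivRules.
Context (f g : R -> R) (x a b : R).
Hypothesis Hf : derivable_pt_lim f x a.
Hypothesis Hg : derivable_pt_lim g x b.

Lemma deriv_plus : derivable_pt_lim (fun t => f t + g t) x (a + b).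
Proof. apply (derivable_pt_lim_plus f g); assumption. Qed.

Lemma deriv_minus : derivable_pt_lim (fun t => f t - g t) x (a - b).
Proof. apply (derivable_pt_lim_minus f g); assumption. Qed.

Lemma deriv_mult : derivable_pt_lim (fun t => f t * g t) x (a * g x + f x * b).
Proof. apply (derivable_pt_lim_mult f g); assumption. Qed.

Lemma deriv_inv : f x <> 0 -> derivable_pt_lim (fun t => / f t) x (-1 * a * (/ f x * / f x)).
Proof.
  intros H. apply is_derive_Reals.
  evar_last; [apply (is_derive_inv f x a); [apply is_derive_Reals, Hf|exact H]|].
  field. exact H.
Qed.

Lemma deriv_sqrt : 0 < f x -> derivable_pt_lim (fun t => sqrt (f t)) x (a * / (2 * sqrt (f x))).
Proof.
  intros H.
  apply (derivable_pt_lim_eq _ _ (/ (2 * sqrt (f x)) * a)); [ring|].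
  apply (derivable_pt_lim_comp f sqrt); [assumption|].
  apply derivable_pt_lim_sqrt, H.
Qed.

End DerivRules.

(* Syntax of functions of (t,s,u), closed under partial differentiation; an atom
   [SAt f k] (resp. [UAt f k]) is the k-th member of a chain of derivatives, taken at s (resp. u). *)
Inductive fexpr : Type :=
| FConst (c : R)
| Tv
| SAt (f : nat -> R -> R) (k : nat)
| UAt (f : nat -> R -> R) (k : nat)
| Add (a b : fexpr)
| Sub (a b : fexpr)
| Mul (a b : fexpr)
| Inv (a : fexpr)
| Sqt (a : fexpr)
| Sum (N : nat) (f : nat -> fexpr).

Inductive dir : Type := VT | VS | VU.

Fixpoint eval (e : fexpr) (t s u : R) : R :=
  match e with
  | FConst c => c
  | Tv => t
  | SAt f k => f k s
  | UAt f k => f k u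
  | Add a b => eval a t s u + eval b t s u
  | Sub a b => eval a t s u - eval b t s u
  | Mul a b => eval a t s u * eval b t s u
  | Inv a => / eval a t s u
  | Sqt a => sqrt (eval a t s u)
  | Sum N f => sumN N (fun i => eval (f i) t s u)
  end.

Fixpoint der (v : dir) (e : fexpr) : fexpr :=
  match e with
  | FConst _ => FConst 0
  | Tv => match v with VT => FConst 1 | _ => FConst 0 end
  | SAt f k => match v with VS => SAt f (S k) | _ => FConst 0 end
  | UAt f k => match v with VU => UAt f (S k) | _ => FConst 0 end
  | Add a b => Add (der v a) (der v b)
  | Sub a b => Sub (der v a) (der v b)
  | Mul a b => Add (Mul (der v a) b) (Mul a (der v b))
  | Inv a => Mul (Mul (FConst (-1)) (der v a)) (Mul (Inv a) (Inv a))
  | Sqt a => Mul (der v a) (Inv (Mul (FConst 2) (Sqt a)))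
  | Sum N f => Sum N (fun i => der v (f i))
  end.

(** Well-definedness at one point, under which [der] computes the derivative of [eval]. A root asks
    for a strictly positive argument because it is not differentiable at 0; the condition is
    inherited by derivatives. *)
Fixpoint wf (e : fexpr) (t s u : R) : Prop :=
  match e with
  | FConst _ | Tv => True
  | SAt f _ | UAt f _ => chain f
  | Add a b | Sub a b | Mul a b => wf a t s u /\ wf b t s u
  | Inv a => wf a t s u /\ eval a t s u <> 0
  | Sqt a => wf a t s u /\ 0 < eval a t s u
  | Sum N f => forall i, (i < N)%nat -> wf (f i) t s u
  end.

Definition coord (v : dir) (t s u : R) : R :=
  match v with VT => t | VS => s | VU => u end.

Definition slice (v : dir) (e : fexpr) (t s u x : R) : R :=
  match v with VT => eval e x s u | VS => eval e t x u | VU => eval e t s x end.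

Lemma slice_coord v e t s u : slice v e t s u (coord v t s u) = eval e t s u.
Proof. destruct v; reflexivity. Qed.

Lemma wf_der v e t s u : wf e t s u -> wf (der v e) t s u.
Proof.
  induction e; simpl; try (intuition; fail).
  - destruct v; simpl; auto.
  - destruct v; simpl; auto.
  - destruct v; simpl; auto.
  - intros [H1 H2]. assert (0 < sqrt (eval e t s u)) by (apply sqrt_lt_R0; assumption).
    repeat split; auto. lra.
Qed.

Lemma der_correct v e t s u :
  wf e t s u -> derivable_pt_lim (slice v e t s u) (coord v t s u) (eval (der v e) t s u).
Proof.
  induction e; simpl; intros Hw.
  - apply (derivable_pt_lim_ext (fun _ => c)); [destruct v; reflexivity|].
    apply derivable_pt_lim_const.
  - destruct v; simpl; [apply derivable_pt_lim_id|apply derivable_pt_lim_const..].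
  - destruct v; simpl; [apply derivable_pt_lim_const|apply Hw|apply derivable_pt_lim_const].
  - destruct v; simpl; [apply derivable_pt_lim_const..|apply Hw].
  - eapply derivable_pt_lim_ext; [|apply (deriv_plus _ _ _ _ _ (IHe1 (proj1 Hw)) (IHe2 (proj2 Hw)))].
    destruct v; reflexivity.
  - eapply derivable_pt_lim_ext; [|apply (deriv_minus _ _ _ _ _ (IHe1 (proj1 Hw)) (IHe2 (proj2 Hw)))].
    destruct v; reflexivity.
  - eapply derivable_pt_lim_eq; [|eapply derivable_pt_lim_ext;
      [|apply (deriv_mult _ _ _ _ _ (IHe1 (proj1 Hw)) (IHe2 (proj2 Hw)))]].
    + rewrite !slice_coord. reflexivity.
    + destruct v; reflexivity.
  - eapply derivable_pt_lim_eq; [|eapply derivable_pt_lim_ext;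
      [|apply (deriv_inv _ _ _ (IHe (proj1 Hw)))]].
    + rewrite !slice_coord. reflexivity.
    + destruct v; reflexivity.
    + rewrite slice_coord. apply Hw.
  - eapply derivable_pt_lim_eq; [|eapply derivable_pt_lim_ext;
      [|apply (deriv_sqrt _ _ _ (IHe (proj1 Hw)))]].
    + rewrite !slice_coord. reflexivity.
    + destruct v; reflexivity.
    + rewrite slice_coord. apply Hw.
  - apply (derivable_pt_lim_ext (fun x => sumN N (fun i => slice v (f i) t s u x)));
      [destruct v; reflexivity|].
    revert Hw. induction N as [|N IH]; intros Hw; simpl; [apply derivable_pt_lim_const|].
    apply deriv_plus; [apply IH; intros; apply Hw; lia|]. apply H, Hw. lia.
Qed.

(** Symmetry of mixed partial derivatives is an algebraic identity here, by induction on the syntax,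
    and not an analytic theorem. *)
Lemma der_comm v w e t s u : eval (der v (der w e)) t s u = eval (der w (der v e)) t s u.
Proof.
  induction e; simpl; try reflexivity.
  - destruct v, w; reflexivity.
  - destruct v, w; reflexivity.
  - destruct v, w; reflexivity.
  - rewrite IHe1, IHe2; reflexivity.
  - rewrite IHe1, IHe2; reflexivity.
  - rewrite IHe1, IHe2; ring.
  - rewrite IHe; ring.
  - rewrite IHe; ring.
  - apply sumN_ext; intros; apply H.
Qed.

Definition sem_eq (a b : fexpr) : Prop := forall t s u, eval a t s u = eval b t s u.

(** [der] acts on syntax, so different expressions of one function have different formal
    derivatives; uniqueness of limits shows that their values agree. *)
Lemma der_cong v a b :
  (forall t s u, wf a t s u) -> (forall t s u, wf b t s u) ->
  sem_eq a b -> sem_eq (der v a) (der v b).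
Proof.
  intros Ha Hb Hab t s u.
  apply (uniqueness_limite (slice v a t s u) (coord v t s u)).
  - apply der_correct, Ha.
  - apply (derivable_pt_lim_ext (slice v b t s u)); [|apply der_correct, Hb].
    intros x. destruct v; simpl; symmetry; apply Hab.
Qed.

Definition iter_der (k : nat) (v : dir) (e : fexpr) : fexpr := Nat.iter k (der v) e.

Lemma wf_iter_der k v e t s u : wf e t s u -> wf (iter_der k v e) t s u.
Proof. intros H. induction k as [|k IH]; [exact H|apply wf_der, IH]. Qed.

Lemma iter_der_cong k v a b :
  (forall t s u, wf a t s u) -> (forall t s u, wf b t s u) ->
  sem_eq a b -> sem_eq (iter_der k v a) (iter_der k v b).
Proof.
  intros Ha Hb Hab. induction k as [|k IH]; [exact Hab|].
  apply der_cong; try (intros; apply wf_iter_der; auto). exact IH.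
Qed.

Lemma iter_der_comm k v w e :
  (forall t s u, wf e t s u) -> sem_eq (der v (iter_der k w e)) (iter_der k w (der v e)).
Proof.
  intros He. induction k as [|k IH]; [intros t s u; reflexivity|].
  intros t s u. change (eval (der v (der w (iter_der k w e))) t s u
    = eval (der w (iter_der k w (der v e))) t s u).
  rewrite der_comm. apply der_cong.
  - intros; apply wf_der, wf_iter_der, He.
  - intros; apply wf_iter_der, wf_der, He.
  - exact IH.
Qed.

Definition peval (e : fexpr) (p : R * (R * R)) : R := eval e (fst p) (fst (snd p)) (snd (snd p)).

Lemma peval_continuous e t s u : wf e t s u -> continuous (peval e) (t, (s, u)).
Proof.
  induction e; simpl; intros Hw.
  - apply continuous_const.
  - apply continuous_fst.
  - apply (continuous_comp (fun p : R * (R * R) => fst (snd p)) (f k)).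
    + apply (continuous_comp (fun p : R * (R * R) => snd p) (fun q : R * R => fst q));
        [apply continuous_snd|apply continuous_fst].
    + apply chain_continuous, Hw.
  - apply (continuous_comp (fun p : R * (R * R) => snd (snd p)) (f k)).
    + apply (continuous_comp (fun p : R * (R * R) => snd p) (fun q : R * R => snd q));
        apply continuous_snd.
    + apply chain_continuous, Hw.
  - apply (continuous_plus (V := R_NormedModule) (peval e1) (peval e2)); tauto.
  - apply (continuous_minus (V := R_NormedModule) (peval e1) (peval e2)); tauto.
  - apply (continuous_mult (K := R_AbsRing) (peval e1) (peval e2)); tauto.
  - apply (continuous_comp (peval e) Rinv); [tauto|].
    apply (ex_derive_continuous (V := R_NormedModule)).
    eexists. apply is_derive_Reals.
    apply (deriv_inv id _ 1); [apply derivable_pt_lim_id|apply Hw].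
  - apply (continuous_comp (peval e) sqrt); [tauto|]. apply continuous_sqrt.
  - revert Hw. induction N as [|N IH]; intros Hw; [apply continuous_const|].
    apply (continuous_plus (V := R_NormedModule) (peval (Sum N f)) (peval (f N))).
    + apply IH; intros; apply Hw; lia.
    + apply H, Hw; lia.
Qed.

Lemma eval_cont3_at e t s u :
  wf e t s u -> forall eps, eps > 0 -> exists d, d > 0 /\
    forall t' s' u', Rabs (t' - t) < d -> Rabs (s' - s) < d -> Rabs (u' - u) < d ->
      Rabs (eval e t' s' u' - eval e t s u) < eps.
Proof.
  intros Hw eps He.
  destruct (peval_continuous e t s u Hw (ball (peval e (t, (s, u))) eps)) as [[d Hd] H].
  { exists (mkposreal eps He). auto. }
  exists d. split; [exact Hd|]. intros t' s' u' Ht Hs Hu.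
  apply (H (t', (s', u'))). repeat split; assumption.
Qed.

Lemma eval_smooth3 e : (forall t s u, wf e t s u) -> smooth3 (eval e).
Proof.
  intros He.
  (* Derivatives are stored in a fixed order, those in t outermost and those in u innermost. The
     clauses for s and u therefore require commuting the new derivative inwards. *)
  exists (fun a k l => eval (iter_der a VT (iter_der k VS (iter_der l VU e)))).
  split; [reflexivity|]. intros a k l.
  set (X := iter_der l VU e).
  assert (HX : forall t s u, wf X t s u) by (intros; apply wf_iter_der, He).
  assert (HX' : forall t s u, wf (iter_der k VS X) t s u) by (intros; apply wf_iter_der, HX).
  assert (HX'' : forall t s u, wf (iter_der a VT (iter_der k VS X)) t s u)
    by (intros; apply wf_iter_der, HX').
  split; [intros t s u; apply eval_cont3_at, HX''|].
  intros t s u. repeat split.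
  - apply (der_correct VT _ t s u (HX'' t s u)).
  - eapply derivable_pt_lim_eq; [|apply (der_correct VS _ t s u (HX'' t s u))].
    apply (iter_der_comm a VS VT _ HX').
  - eapply derivable_pt_lim_eq; [|apply (der_correct VU _ t s u (HX'' t s u))].
    rewrite (iter_der_comm a VU VT _ HX').
    apply iter_der_cong.
    + intros; apply wf_der, HX'.
    + intros; apply wf_iter_der, wf_der, HX.
    + apply (iter_der_comm k VU VS _ HX).
Qed.

(** Well-definedness is given only on the rectangle at t = 0. Each of its points has a
    three-dimensional neighbourhood of small oscillation, and compactness yields one radius for all
    of them. *)
Lemma eval_tube e L Lh :
  (forall s u, 0 <= s <= L -> 0 <= u <= Lh -> wf e 0 s u) ->
  forall eps, 0 < eps -> exists d, 0 < d /\
    forall t s u, Rabs t < d -> 0 <= s <= L -> 0 <= u <= Lh ->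
      Rabs (eval e t s u - eval e 0 s u) < eps.
Proof.
  intros Hw eps He.
  assert (Hd : forall s u, exists d : posreal, 0 <= s <= L -> 0 <= u <= Lh ->
    forall t' s' u', Rabs (t' - 0) < d -> Rabs (s' - s) < d -> Rabs (u' - u) < d ->
      Rabs (eval e t' s' u' - eval e 0 s u) < eps / 2).
  { intros s u.
    destruct (classic (0 <= s <= L /\ 0 <= u <= Lh)) as [[Hs Hu]|Hn].
    - destruct (eval_cont3_at e 0 s u (Hw s u Hs Hu) (eps / 2)) as [d [Hd H]]; [lra|].
      exists (mkposreal d Hd). intros _ _. exact H.
    (* A dummy radius outside the rectangle, where nothing is claimed. *)
    - exists (mkposreal 1 Rlt_0_1). tauto. }
  set (delta := fun s u => proj1_sig (constructive_indefinite_description _ (Hd s u))).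
  destruct (compactness_value_2d 0 L 0 Lh delta) as [d Hc].
  exists d. split; [apply cond_pos|]. intros t s u Ht Hs Hu.
  (* [compactness_value_2d] provides the covering cell only under a double negation. *)
  apply NNPP. intros Hneg. apply (Hc s u Hs Hu). intros (s0 & u0 & Hs0 & Hu0 & H1 & H2 & H3).
  apply Hneg.
  assert (H := proj2_sig (constructive_indefinite_description _ (Hd s0 u0)) Hs0 Hu0).
  fold (delta s0 u0) in H.
  assert (A := H t s u). assert (B := H 0 s u). rewrite Rminus_0_r in A, B.
  rewrite Rabs_R0 in B.
  assert (Hp := cond_pos (delta s0 u0)).
  specialize (A (Rlt_le_trans _ _ _ Ht H3) H1 H2). specialize (B Hp H1 H2).
  replace (eval e t s u - eval e 0 s u) with
    ((eval e t s u - eval e 0 s0 u0) - (eval e 0 s u - eval e 0 s0 u0)) by ring.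
  eapply Rle_lt_trans; [apply Rabs_triang|]. rewrite Rabs_Ropp. lra.
Qed.

(* The mean value theorem and [eval_tube] bound the error of the integrand uniformly on the
   rectangle, so the Riemann sums can be compared directly. *)
Lemma integral_deriv e L Lh (w : R -> R) d0 J :
  0 < L -> 0 < Lh -> 0 < d0 ->
  (forall t s u, Rabs t < d0 -> 0 <= s <= L -> 0 <= u <= Lh -> wf e t s u) ->
  (forall t, Rabs t < d0 -> is_integral2 (eval e t) L Lh (w t)) ->
  is_integral2 (eval (der VT e) 0) L Lh J ->
  derivable_pt_lim w 0 J.
Proof.
  intros HL HLh Hd0 Hwf Hw HJ eps He.
  set (e0 := eps / (2 * L * Lh)).
  assert (He0 : 0 < e0) by (apply Rdiv_lt_0_compat; [lra|nra]).
  assert (H0 : Rabs 0 < d0) by (rewrite Rabs_R0; exact Hd0).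
  destruct (eval_tube (der VT e) L Lh) with (eps := e0) as [d [Hd Ht]];
    [intros; apply wf_der, Hwf; assumption|exact He0|].
  assert (Hm : 0 < Rmin d d0) by (apply Rmin_pos; assumption).
  exists (mkposreal _ Hm). simpl. intros h Hh Hhd. rewrite Rplus_0_l.
  assert (Hhd1 : Rabs h < d) by (eapply Rlt_le_trans; [exact Hhd|apply Rmin_l]).
  assert (Hhd2 : Rabs h < d0) by (eapply Rlt_le_trans; [exact Hhd|apply Rmin_r]).
  (* The integrand is the first-order Taylor remainder in t; by linearity its integral is w h - w 0
     - h J. *)
  assert (HI : is_integral2 (fun s u => eval e h s u + (-1 * eval e 0 s u
                 + - h * eval (der VT e) 0 s u)) L Lh (w h + (-1 * w 0 + - h * J))).
  { apply is_integral2_plus; [apply Hw, Hhd2|].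
    apply is_integral2_plus; apply is_integral2_scal; [apply Hw, H0|exact HJ]. }
  assert (Hle : Rabs (w h + (-1 * w 0 + - h * J)) <= Rabs h * e0 * L * Lh).
  { eapply is_integral2_abs_le; [exact HL|exact HLh| |exact HI]. intros s u Hs Hu.
    assert (Hin : forall x, Rmin 0 h <= x <= Rmax 0 h -> Rabs x <= Rabs h).
    { intros x. unfold Rmin, Rmax, Rabs. destruct (Rle_dec 0 h);
        repeat destruct (Rcase_abs _); lra. }
    destruct (MVT_gen (fun t => eval e t s u) 0 h (fun t => eval (der VT e) t s u))
      as [c [Hc Hmvt]].
    - intros x Hx. apply is_derive_Reals. apply (der_correct VT e x s u).
      apply Hwf; try assumption. eapply Rle_lt_trans; [apply Hin; lra|assumption].
    - intros x Hx. apply derivable_continuous_pt. exists (eval (der VT e) x s u).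
      apply (der_correct VT e x s u).
      apply Hwf; try assumption. eapply Rle_lt_trans; [apply Hin; lra|assumption].
    - rewrite Rminus_0_r in Hmvt.
      replace (eval e h s u + (-1 * eval e 0 s u + - h * eval (der VT e) 0 s u))
        with (h * (eval (der VT e) c s u - eval (der VT e) 0 s u)) by lra.
      rewrite Rabs_mult. apply Rmult_le_compat_l; [apply Rabs_pos|].
      apply Rlt_le, Ht; try assumption. eapply Rle_lt_trans; [apply Hin; lra|assumption]. }
  replace ((w h - w 0) / h - J) with ((w h + (-1 * w 0 + - h * J)) / h) by (field; assumption).
  assert (Hh0 : 0 < Rabs h) by (apply Rabs_pos_lt; assumption).
  unfold Rdiv. rewrite Rabs_mult, Rabs_inv.
  apply Rmult_lt_reg_r with (Rabs h); [exact Hh0|].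
  rewrite Rmult_assoc, Rinv_l, Rmult_1_r by lra.
  replace (Rabs h * e0 * L * Lh) with (eps / 2 * Rabs h) in Hle by (unfold e0; field; lra).
  nra.
Qed.

(** * First variation of the Willmore density *)

Definition gdet N (xs xt : nat -> R) : R :=
  dot N xs xs * dot N xt xt - dot N xs xt * dot N xs xt.

Definition perp N (x xs xt v : nat -> R) : nat -> R := fun i =>
  v i - dot N v x * x i
  - (dot N xt xt * dot N v xs - dot N xs xt * dot N v xt) / gdet N xs xt * xs i
  - (dot N xs xs * dot N v xt - dot N xs xt * dot N v xs) / gdet N xs xt * xt i.

Definition mean_curv N (x xs xt xss xst xtt : nat -> R) : nat -> R := fun i =>
  (dot N xt xt * perp N x xs xt xss i - 2 * dot N xs xt * perp N x xs xt xst i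
   + dot N xs xs * perp N x xs xt xtt i) / (2 * gdet N xs xt).

Lemma willmore_density_perp N x xs xt xss xst xtt :
  willmore_density N x xs xt xss xst xtt =
  (dot N (mean_curv N x xs xt xss xst xtt) (mean_curv N x xs xt xss xst xtt)
   - (1 + (dot N (perp N x xs xt xss) (perp N x xs xt xtt)
           - dot N (perp N x xs xt xst) (perp N x xs xt xst)) / gdet N xs xt) + 1)
  * sqrt (gdet N xs xt).
Proof. reflexivity. Qed.

Lemma perp_ext N x xs xt v x' xs' xt' v' :
  (forall i, (i < N)%nat -> x i = x' i) -> (forall i, (i < N)%nat -> xs i = xs' i) ->
  (forall i, (i < N)%nat -> xt i = xt' i) -> (forall i, (i < N)%nat -> v i = v' i) ->
  forall i, (i < N)%nat -> perp N x xs xt v i = perp N x' xs' xt' v' i.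
Proof.
  intros Hx Hxs Hxt Hv i Hi. unfold perp, gdet.
  rewrite (dot_ext N v v' x x'), (dot_ext N v v' xs xs'), (dot_ext N v v' xt xt'),
    (dot_ext N xs xs' xs xs'), (dot_ext N xs xs' xt xt'), (dot_ext N xt xt' xt xt') by assumption.
  rewrite Hx, Hxs, Hxt, Hv by assumption. reflexivity.
Qed.

Lemma willmore_density_ext N x xs xt xss xst xtt x' xs' xt' xss' xst' xtt' :
  (forall i, (i < N)%nat -> x i = x' i) -> (forall i, (i < N)%nat -> xs i = xs' i) ->
  (forall i, (i < N)%nat -> xt i = xt' i) -> (forall i, (i < N)%nat -> xss i = xss' i) ->
  (forall i, (i < N)%nat -> xst i = xst' i) -> (forall i, (i < N)%nat -> xtt i = xtt' i) ->
  willmore_density N x xs xt xss xst xtt = willmore_density N x' xs' xt' xss' xst' xtt'.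
Proof.
  intros Hx Hxs Hxt Hxss Hxst Hxtt.
  assert (P1 := perp_ext N x xs xt xss x' xs' xt' xss' Hx Hxs Hxt Hxss).
  assert (P2 := perp_ext N x xs xt xst x' xs' xt' xst' Hx Hxs Hxt Hxst).
  assert (P3 := perp_ext N x xs xt xtt x' xs' xt' xtt' Hx Hxs Hxt Hxtt).
  assert (Hd : gdet N xs xt = gdet N xs' xt').
  { unfold gdet. rewrite (dot_ext N xs xs' xs xs'), (dot_ext N xs xs' xt xt'),
      (dot_ext N xt xt' xt xt') by assumption. reflexivity. }
  assert (PH : forall i, (i < N)%nat ->
    mean_curv N x xs xt xss xst xtt i = mean_curv N x' xs' xt' xss' xst' xtt' i).
  { intros i Hi. unfold mean_curv.
    rewrite Hd, P1, P2, P3, (dot_ext N xs xs' xs xs'), (dot_ext N xs xs' xt xt'),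
      (dot_ext N xt xt' xt xt') by assumption. reflexivity. }
  rewrite !willmore_density_perp, Hd.
  rewrite (dot_ext N _ _ _ _ PH PH), (dot_ext N _ _ _ _ P1 P3), (dot_ext N _ _ _ _ P2 P2).
  reflexivity.
Qed.

(** * The Willmore density as an expression *)

Definition dotE N (u v : nat -> fexpr) : fexpr := Sum N (fun i => Mul (u i) (v i)).

Definition gdetE N (xs xt : nat -> fexpr) : fexpr :=
  Sub (Mul (dotE N xs xs) (dotE N xt xt)) (Mul (dotE N xs xt) (dotE N xs xt)).

Definition perpE N (x xs xt v : nat -> fexpr) : nat -> fexpr := fun i =>
  Sub (Sub (Sub (v i) (Mul (dotE N v x) (x i)))
    (Mul (Mul (Sub (Mul (dotE N xt xt) (dotE N v xs)) (Mul (dotE N xs xt) (dotE N v xt)))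
              (Inv (gdetE N xs xt))) (xs i)))
    (Mul (Mul (Sub (Mul (dotE N xs xs) (dotE N v xt)) (Mul (dotE N xs xt) (dotE N v xs)))
              (Inv (gdetE N xs xt))) (xt i)).

Definition mean_curvE N (x xs xt xss xst xtt : nat -> fexpr) : nat -> fexpr := fun i =>
  Mul (Add (Sub (Mul (dotE N xt xt) (perpE N x xs xt xss i))
                (Mul (Mul (FConst 2) (dotE N xs xt)) (perpE N x xs xt xst i)))
           (Mul (dotE N xs xs) (perpE N x xs xt xtt i)))
      (Inv (Mul (FConst 2) (gdetE N xs xt))).

(** Divisions are products with [Inv], in the shape to which [Rdiv] unfolds, so the evaluation is
    convertible to [willmore_density] of the evaluated vectors. *)
Definition densE N (x xs xt xss xst xtt : nat -> fexpr) : fexpr :=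
  let H := mean_curvE N x xs xt xss xst xtt in
  Mul (Add (Sub (dotE N H H)
    (Add (FConst 1) (Mul (Sub (dotE N (perpE N x xs xt xss) (perpE N x xs xt xtt))
                          (dotE N (perpE N x xs xt xst) (perpE N x xs xt xst)))
                     (Inv (gdetE N xs xt))))) (FConst 1))
    (Sqt (gdetE N xs xt)).

Ltac split_conj := repeat match goal with |- _ /\ _ => split end.

Definition wfv N (x : nat -> fexpr) t s u : Prop := forall i, (i < N)%nat -> wf (x i) t s u.

Lemma wf_dotE N a b t s u : wfv N a t s u -> wfv N b t s u -> wf (dotE N a b) t s u.
Proof. intros Ha Hb i Hi; split; auto. Qed.

Lemma wf_gdetE N a b t s u : wfv N a t s u -> wfv N b t s u -> wf (gdetE N a b) t s u.
Proof.
  intros Ha Hb; unfold gdetE; cbn [wf]; split_conj; apply wf_dotE; assumption.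
Qed.

Lemma wf_perpE N x xs xt v t s u :
  wfv N x t s u -> wfv N xs t s u -> wfv N xt t s u -> wfv N v t s u ->
  0 < eval (gdetE N xs xt) t s u -> wfv N (perpE N x xs xt v) t s u.
Proof.
  intros Hx Hxs Hxt Hv Hd i Hi. assert (Hg := wf_gdetE _ _ _ _ _ _ Hxs Hxt).
  assert (Hd' : eval (gdetE N xs xt) t s u <> 0) by lra.
  unfold perpE. cbn [wf].
  split_conj; first [apply wf_dotE; assumption|auto].
Qed.

Lemma wf_densE N x xs xt xss xst xtt t s u :
  wfv N x t s u -> wfv N xs t s u -> wfv N xt t s u ->
  wfv N xss t s u -> wfv N xst t s u -> wfv N xtt t s u ->
  0 < eval (gdetE N xs xt) t s u -> wf (densE N x xs xt xss xst xtt) t s u.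
Proof.
  intros Hx Hxs Hxt Hxss Hxst Hxtt Hd. assert (Hg := wf_gdetE _ _ _ _ _ _ Hxs Hxt).
  assert (Hd' : eval (gdetE N xs xt) t s u <> 0) by lra.
  assert (Hd2 : 2 * eval (gdetE N xs xt) t s u <> 0) by lra.
  assert (P1 := wf_perpE _ _ _ _ _ _ _ _ Hx Hxs Hxt Hxss Hd).
  assert (P2 := wf_perpE _ _ _ _ _ _ _ _ Hx Hxs Hxt Hxst Hd).
  assert (P3 := wf_perpE _ _ _ _ _ _ _ _ Hx Hxs Hxt Hxtt Hd).
  assert (PH : wfv N (mean_curvE N x xs xt xss xst xtt) t s u).
  { intros i Hi. unfold mean_curvE. cbn [wf].
    split_conj; first [apply wf_dotE; assumption|auto]. }
  unfold densE. cbn [wf]. split_conj; first [apply wf_dotE; assumption|auto].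
Qed.

Lemma deriv_div f g x a b :
  derivable_pt_lim f x a -> derivable_pt_lim g x b -> g x <> 0 ->
  derivable_pt_lim (fun t => f t / g t) x ((a * g x - f x * b) / (g x * g x)).
Proof.
  intros Hf Hg H.
  eapply derivable_pt_lim_eq; [|apply (deriv_mult f (fun t => / g t) _ _ _ Hf (deriv_inv _ _ _ Hg H))].
  field. exact H.
Qed.

Lemma deriv_scal c f x a :
  derivable_pt_lim f x a -> derivable_pt_lim (fun t => c * f t) x (c * a).
Proof. apply derivable_pt_lim_scal. Qed.

(** The vector has the shape that [perp_deriv] finds for the derivative of a normal part. Against a
    z normal to x, xs and xt only the terms in v and y survive. *)
Lemma dot_perp_form N (v x y xs xt z : nat -> R) c k a b :
  dot N (fun i => v i - (c * x i + k * y i) - a * xs i - b * xt i) z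
  = dot N v z - (c * dot N x z + k * dot N y z) - a * dot N xs z - b * dot N xt z.
Proof.
  rewrite (dot_ext N _ (fun i => v i + (- c * x i + (- k * y i + (- a * xs i + - b * xt i)))) z z);
    [|intros; ring|trivial].
  rewrite !dot_plus_l, !dot_scal_l. ring.
Qed.

Section FirstVariation.
Context (N : nat) (x xs xt xss xst xtt : R -> nat -> R) (x' xs' xt' xss' xst' xtt' : nat -> R).
Definition vec_deriv (v : R -> nat -> R) (v' : nat -> R) : Prop :=
  forall i, (i < N)%nat -> derivable_pt_lim (fun t => v t i) 0 (v' i).
Hypothesis Dx : vec_deriv x x'.
Hypothesis Dxs : vec_deriv xs xs'.
Hypothesis Dxt : vec_deriv xt xt'.
Hypothesis Dxss : vec_deriv xss xss'.
Hypothesis Dxst : vec_deriv xst xst'.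
Hypothesis Dxtt : vec_deriv xtt xtt'.
Hypothesis g00 : dot N (x 0) (x 0) = 1.
Hypothesis g01 : dot N (x 0) (xs 0) = 0.
Hypothesis g02 : dot N (x 0) (xt 0) = 0.
Hypothesis g11 : dot N (xs 0) (xs 0) = 1.
Hypothesis g12 : dot N (xs 0) (xt 0) = 0.
Hypothesis g22 : dot N (xt 0) (xt 0) = 1.
Hypothesis g11' : dot N xs' (xs 0) = 0.
Hypothesis g12' : dot N xs' (xt 0) + dot N (xs 0) xt' = 0.
Hypothesis g22' : dot N xt' (xt 0) = 0.

Lemma metric_deriv :
  derivable_pt_lim (fun t => dot N (xs t) (xs t)) 0 0 /\
  derivable_pt_lim (fun t => dot N (xs t) (xt t)) 0 0 /\
  derivable_pt_lim (fun t => dot N (xt t) (xt t)) 0 0 /\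
  derivable_pt_lim (fun t => gdet N (xs t) (xt t)) 0 0.
Proof.
  assert (H1 : derivable_pt_lim (fun t => dot N (xs t) (xs t)) 0 0).
  { eapply derivable_pt_lim_eq; [|apply (dot_derive N xs xs xs' xs'); assumption].
    rewrite (dot_comm N (xs 0)), g11'. ring. }
  assert (H2 : derivable_pt_lim (fun t => dot N (xs t) (xt t)) 0 0).
  { eapply derivable_pt_lim_eq; [|apply (dot_derive N xs xt xs' xt'); assumption]. exact g12'. }
  assert (H3 : derivable_pt_lim (fun t => dot N (xt t) (xt t)) 0 0).
  { eapply derivable_pt_lim_eq; [|apply (dot_derive N xt xt xt' xt'); assumption].
    rewrite (dot_comm N (xt 0)), g22'. ring. }
  repeat split; try assumption.
  unfold gdet.
  eapply derivable_pt_lim_eq; [|apply deriv_minus; apply deriv_mult; eassumption]. ring.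
Qed.

Lemma gdet_0 : gdet N (xs 0) (xt 0) = 1.
Proof. unfold gdet. rewrite g11, g12, g22. ring. Qed.

(** The coefficients along x, xs and xt stay existential: they disappear on pairing with normal
    vectors. The multiple of x' remains because the point itself moves, and it must be known
    exactly. *)
Lemma perp_deriv v v' :
  vec_deriv v v' -> dot N (v 0) (xs 0) = 0 -> dot N (v 0) (xt 0) = 0 ->
  exists c a b, vec_deriv (fun t => perp N (x t) (xs t) (xt t) (v t))
    (fun i => v' i - (c * x 0 i + dot N (v 0) (x 0) * x' i) - a * xs 0 i - b * xt 0 i).
Proof.
  intros Dv h1 h2. destruct metric_deriv as (M1 & M2 & M3 & M4).
  assert (Hd := gdet_0).
  assert (Hd0 : gdet N (xs 0) (xt 0) <> 0) by lra.
  assert (C := dot_derive N v x v' x' 0 Dv Dx).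
  assert (P1 := dot_derive N v xs v' xs' 0 Dv Dxs).
  assert (P2 := dot_derive N v xt v' xt' 0 Dv Dxt).
  set (c' := dot N v' (x 0) + dot N (v 0) x') in C.
  set (p1 := dot N v' (xs 0) + dot N (v 0) xs') in P1.
  set (p2 := dot N v' (xt 0) + dot N (v 0) xt') in P2.
  assert (A := deriv_div _ _ _ _ _
    (deriv_minus _ _ _ _ _ (deriv_mult _ _ _ _ _ M3 P1) (deriv_mult _ _ _ _ _ M2 P2)) M4 Hd0).
  assert (B := deriv_div _ _ _ _ _
    (deriv_minus _ _ _ _ _ (deriv_mult _ _ _ _ _ M1 P2) (deriv_mult _ _ _ _ _ M2 P1)) M4 Hd0).
  cbv beta in A, B. rewrite Hd, g22, g12, h1, h2 in A. rewrite Hd, g11, g12, h1, h2 in B.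
  match type of A with derivable_pt_lim _ _ ?l => set (a' := l) in A end.
  match type of B with derivable_pt_lim _ _ ?l => set (b' := l) in B end.
  exists c', a', b'. intros i Hi. unfold perp.
  eapply derivable_pt_lim_eq; [|apply deriv_minus;
    [apply deriv_minus; [apply deriv_minus;
      [apply Dv, Hi|apply (deriv_mult _ _ _ _ _ C (Dx i Hi))]
      |apply (deriv_mult _ _ _ _ _ A (Dxs i Hi))]
    |apply (deriv_mult _ _ _ _ _ B (Dxt i Hi))]].
  cbv beta. rewrite Hd, g11, g22, g12, h1, h2. field.
Qed.

Context (Q : R).
Hypothesis s0 : dot N (xss 0) (x 0) = -1.
Hypothesis s1 : dot N (xss 0) (xs 0) = 0.
Hypothesis s2 : dot N (xss 0) (xt 0) = 0.
Hypothesis m0 : dot N (xst 0) (x 0) = 0.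
Hypothesis m1 : dot N (xst 0) (xs 0) = 0.
Hypothesis m2 : dot N (xst 0) (xt 0) = 0.
Hypothesis t0 : dot N (xtt 0) (x 0) = -1.
Hypothesis t1 : dot N (xtt 0) (xs 0) = 0.
Hypothesis t2 : dot N (xtt 0) (xt 0) = 0.
Let b11 := fun i => xss 0 i + x 0 i.
Let b22 := fun i => xtt 0 i + x 0 i.
Hypothesis h1 : dot N xss' b11 + dot N x' b11 = 0.
Hypothesis h2 : dot N xss' b22 + dot N x' b22 = Q.
Hypothesis h3 : dot N xtt' b11 + dot N x' b11 = Q.
Hypothesis h4 : dot N xtt' b22 + dot N x' b22 = 0.
Hypothesis h5 : dot N xst' (xst 0) = Q.

Lemma perp_at_0 v c i :
  dot N (v 0) (x 0) = c -> dot N (v 0) (xs 0) = 0 -> dot N (v 0) (xt 0) = 0 ->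
  perp N (x 0) (xs 0) (xt 0) (v 0) i = v 0 i - c * x 0 i.
Proof.
  intros H0 H1 H2. unfold perp. rewrite gdet_0, H0, H1, H2, g11, g12, g22. field.
Qed.

(** The metric is Euclidean and stationary at t = 0, so only the normal components of the second
    derivatives matter. By [h1] to [h4], |H|^2 varies at the rate (0 + Q + Q + 0)/2 = Q. Both <B11,
    B22> and |B12|^2 vary at 2 Q, so K is stationary, as is the area element. *)
Lemma willmore_density_deriv :
  derivable_pt_lim (fun t => willmore_density N (x t) (xs t) (xt t) (xss t) (xst t) (xtt t)) 0 Q.
Proof.
  destruct metric_deriv as (M1 & M2 & M3 & M4).
  assert (Hd := gdet_0).
  destruct (perp_deriv xss xss' Dxss s1 s2) as (c1 & a1 & e1 & D11).
  destruct (perp_deriv xst xst' Dxst m1 m2) as (c2 & a2 & e2 & D12).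
  destruct (perp_deriv xtt xtt' Dxtt t1 t2) as (c3 & a3 & e3 & D22).
  rewrite s0 in D11. rewrite m0 in D12. rewrite t0 in D22.
  assert (V11 : forall i, perp N (x 0) (xs 0) (xt 0) (xss 0) i = b11 i).
  { intros i. rewrite (perp_at_0 xss (-1)) by assumption. unfold b11. ring. }
  assert (V12 : forall i, perp N (x 0) (xs 0) (xt 0) (xst 0) i = xst 0 i).
  { intros i. rewrite (perp_at_0 xst 0) by assumption. ring. }
  assert (V22 : forall i, perp N (x 0) (xs 0) (xt 0) (xtt 0) i = b22 i).
  { intros i. rewrite (perp_at_0 xtt (-1)) by assumption. unfold b22. ring. }
  match type of D11 with vec_deriv _ ?f => set (d11 := f) in D11 end.
  match type of D12 with vec_deriv _ ?f => set (d12 := f) in D12 end.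
  match type of D22 with vec_deriv _ ?f => set (d22 := f) in D22 end.
  assert (VH : forall i, mean_curv N (x 0) (xs 0) (xt 0) (xss 0) (xst 0) (xtt 0) i
                         = / 2 * b11 i + / 2 * b22 i).
  { intros i. unfold mean_curv. rewrite V11, V12, V22, Hd, g11, g12, g22. field. }
  assert (DH : vec_deriv
    (fun t => mean_curv N (x t) (xs t) (xt t) (xss t) (xst t) (xtt t))
    (fun i => / 2 * d11 i + / 2 * d22 i)).
  { intros i Hi. unfold mean_curv.
    eapply derivable_pt_lim_eq; [|exact (deriv_div _ _ _ _ _
      (deriv_plus _ _ _ _ _
        (deriv_minus _ _ _ _ _ (deriv_mult _ _ _ _ _ M3 (D11 i Hi))
          (deriv_mult _ _ _ _ _ (deriv_scal 2 _ _ _ M2) (D12 i Hi)))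
        (deriv_mult _ _ _ _ _ M1 (D22 i Hi)))
      (deriv_scal 2 _ _ _ M4) ltac:(cbv beta; rewrite Hd; lra))].
    cbv beta. rewrite Hd, g11, g12, g22. field. }
  assert (E1 := dot_derive N _ _ _ _ 0 DH DH).
  assert (E2 := dot_derive N _ _ _ _ 0 D11 D22).
  assert (E3 := dot_derive N _ _ _ _ 0 D12 D12).
  cbv beta in E1, E2, E3.
  assert (Ox : forall z, dot N (x 0) z = 0 -> dot N (xs 0) z = 0 -> dot N (xt 0) z = 0 ->
    dot N d11 z = dot N xss' z + dot N x' z /\ dot N d12 z = dot N xst' z /\
    dot N d22 z = dot N xtt' z + dot N x' z).
  { intros z Z0 Z1 Z2. unfold d11, d12, d22. rewrite !dot_perp_form, Z0, Z1, Z2.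
    repeat split; ring. }
  destruct (Ox b11) as (A1 & _ & A3);
    [unfold b11; rewrite dot_plus_r, (dot_comm N _ (xss 0)),
       ?(dot_comm N (xs 0) (x 0)), ?(dot_comm N (xt 0) (x 0)); lra..|].
  destruct (Ox b22) as (B1 & _ & B3);
    [unfold b22; rewrite dot_plus_r, (dot_comm N _ (xtt 0)),
       ?(dot_comm N (xs 0) (x 0)), ?(dot_comm N (xt 0) (x 0)); lra..|].
  destruct (Ox (xst 0)) as (_ & C2 & _); [rewrite dot_comm; assumption..|].
  assert (F1 : derivable_pt_lim (fun t =>
    dot N (mean_curv N (x t) (xs t) (xt t) (xss t) (xst t) (xtt t))
          (mean_curv N (x t) (xs t) (xt t) (xss t) (xst t) (xtt t))) 0 Q).
  { eapply derivable_pt_lim_eq; [|exact E1].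
    rewrite (dot_comm N (mean_curv _ _ _ _ _ _ _)).
    rewrite (dot_ext N _ (fun i => / 2 * d11 i + / 2 * d22 i) _
               (fun i => / 2 * b11 i + / 2 * b22 i)) by (intros; auto).
    rewrite dot_plus_l, !dot_scal_l, !dot_plus_r, !dot_scal_r, A1, A3, B1, B3, h1, h2, h3, h4.
    field. }
  assert (F2 : derivable_pt_lim (fun t =>
    dot N (perp N (x t) (xs t) (xt t) (xss t)) (perp N (x t) (xs t) (xt t) (xtt t))) 0 (2 * Q)).
  { eapply derivable_pt_lim_eq; [|exact E2].
    rewrite (dot_comm N (perp _ _ _ _ _) d22).
    rewrite (dot_ext N d11 d11 _ b22), (dot_ext N d22 d22 _ b11) by (intros; auto).
    rewrite B1, A3, h2, h3. ring. }
  assert (F3 : derivable_pt_lim (fun t =>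
    dot N (perp N (x t) (xs t) (xt t) (xst t)) (perp N (x t) (xs t) (xt t) (xst t))) 0 (2 * Q)).
  { eapply derivable_pt_lim_eq; [|exact E3].
    rewrite (dot_comm N (perp _ _ _ _ _) d12).
    rewrite (dot_ext N d12 d12 _ (xst 0)) by (intros; auto).
    rewrite C2, h5. ring. }
  assert (Hs : derivable_pt_lim (fun t => sqrt (gdet N (xs t) (xt t))) 0 0).
  { eapply derivable_pt_lim_eq; [|apply (deriv_sqrt _ _ _ M4); rewrite Hd; lra]. ring. }
  assert (F4 := deriv_div _ _ _ _ _ (deriv_minus _ _ _ _ _ F2 F3) M4
                  ltac:(cbv beta; rewrite Hd; lra)).
  assert (F5 := deriv_plus _ _ _ _ _ (derivable_pt_lim_const 1 0) F4).
  assert (F6 := deriv_plus _ _ _ _ _ (deriv_minus _ _ _ _ _ F1 F5) (derivable_pt_lim_const 1 0)).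
  assert (F7 := deriv_mult _ _ _ _ _ F6 Hs).
  eapply derivable_pt_lim_eq; [|exact F7].
  cbv beta. rewrite Hd, sqrt_1. field.
Qed.

End FirstVariation.

(** * The variation of a tensor product along N (x) Nh *)

(** The quadratic term serves to keep the family on the sphere. It drops out of the values and first
    t-derivatives at t = 0, so the complicated Z never has to be differentiated there. *)
Definition ray (Y V Z : fexpr) : fexpr :=
  Add (Add Y (Mul Tv V)) (Mul (Mul Tv Tv) Z).

Lemma ray_0 Y V Z s u :
  eval (ray Y V Z) 0 s u = eval Y 0 s u /\
  eval (der VT (ray Y V Z)) 0 s u = eval (der VT Y) 0 s u + eval V 0 s u.
Proof. unfold ray; cbn [eval der]; split; ring. Qed.

Lemma ray_1 Y V Z v s u : v <> VT ->
  eval (der v (ray Y V Z)) 0 s u = eval (der v Y) 0 s u /\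
  eval (der VT (der v (ray Y V Z))) 0 s u =
    eval (der VT (der v Y)) 0 s u + eval (der v V) 0 s u.
Proof. intros Hv; destruct v; [easy|..]; unfold ray; cbn [eval der]; split; ring. Qed.

Lemma ray_2 Y V Z v v' s u : v <> VT -> v' <> VT ->
  eval (der v' (der v (ray Y V Z))) 0 s u = eval (der v' (der v Y)) 0 s u /\
  eval (der VT (der v' (der v (ray Y V Z)))) 0 s u =
    eval (der VT (der v' (der v Y))) 0 s u + eval (der v' (der v V)) 0 s u.
Proof.
  intros Hv Hv'; destruct v, v'; try easy; unfold ray; cbn [eval der]; split; ring.
Qed.

Section TensorVariation.
Context (n m : nat) (G Gh : nat -> nat -> R -> R) (L Lh : R).
Hypothesis HG : jets n G L.
Hypothesis HGh : jets m Gh Lh.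

Definition tens (a b : nat) (s u : R) : nat -> R :=
  tensor m (fun i => G i a s) (fun j => Gh j b u).

(** The a-th derivative of the curvature vector gamma'' + gamma = k_1 beta_1. *)
Definition nvec (F : nat -> nat -> R -> R) (a : nat) (s : R) : nat -> R :=
  fun i => F i (S (S a)) s + F i a s.

Definition ntens (a b : nat) (s u : R) : nat -> R := tensor m (nvec G a s) (nvec Gh b u).

Lemma tens_deriv_s a b s u i :
  derivable_pt_lim (fun s' => tens a b s' u i) s (tens (S a) b s u i).
Proof.
  unfold tens, tensor. eapply derivable_pt_lim_eq; [|apply deriv_mult;
    [apply (jets_chain _ _ _ HG)|apply derivable_pt_lim_const]]. cbv beta; ring.
Qed.

Lemma tens_deriv_u a b s u i :
  derivable_pt_lim (fun u' => tens a b s u' i) u (tens a (S b) s u i).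
Proof.
  unfold tens, tensor. eapply derivable_pt_lim_eq; [|apply deriv_mult;
    [apply derivable_pt_lim_const|apply (jets_chain _ _ _ HGh)]]. cbv beta; ring.
Qed.

Lemma dot_tens a b c d s u :
  dot (S n * S m) (tens a b s u) (tens c d s u) = jdot n G a c s * jdot m Gh b d u.
Proof. apply dot_tensor. Qed.

Lemma dot_nvec k F a b s :
  dot (S k) (nvec F a s) (fun i => F i b s) = jdot k F (S (S a)) b s + jdot k F a b s.
Proof. apply dot_plus_l. Qed.

Lemma dot_ntens a b c d s u :
  dot (S n * S m) (ntens a b s u) (tens c d s u) =
  (jdot n G (S (S a)) c s + jdot n G a c s) * (jdot m Gh (S (S b)) d u + jdot m Gh b d u).
Proof. unfold ntens, tens. rewrite dot_tensor, !dot_nvec. reflexivity. Qed.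

Ltac jdots :=
  rewrite ?(jdot_comm 1 0), ?(jdot_comm 2 0), ?(jdot_comm 2 1), ?(jdot_comm 3 0),
    ?(jdot_comm 3 1), ?(jdot_comm 4 0),
    ?(jdot00 HG), ?(jdot01 HG), ?(jdot11 HG), ?(jdot02 HG), ?(jdot12 HG),
    ?(jdot03 HG), ?(jdot13 HG), ?(jdot04 HG),
    ?(jdot00 HGh), ?(jdot01 HGh), ?(jdot11 HGh), ?(jdot02 HGh), ?(jdot12 HGh),
    ?(jdot03 HGh), ?(jdot13 HGh), ?(jdot04 HGh).

(** The vectors B11 = N (x) gammah and B22 = gamma (x) Nh are orthogonal and B12 is a unit vector,
    so K = 0 and |H|^2 = (k^2 + kh^2)/4. *)
Lemma tensor_density s u :
  willmore_density (S n * S m) (tens 0 0 s u) (tens 1 0 s u) (tens 0 1 s u)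
    (tens 2 0 s u) (tens 1 1 s u) (tens 0 2 s u)
  = 1 + (curv2 n G s + curv2 m Gh u) / 4.
Proof.
  set (N := (S n * S m)%nat).
  rewrite willmore_density_perp.
  assert (Hd : gdet N (tens 1 0 s u) (tens 0 1 s u) = 1).
  { unfold gdet, N. rewrite !dot_tens. jdots. ring. }
  assert (V11 : forall i, perp N (tens 0 0 s u) (tens 1 0 s u) (tens 0 1 s u) (tens 2 0 s u) i
                = tens 2 0 s u i + tens 0 0 s u i).
  { intros i. unfold perp. rewrite Hd. unfold N. rewrite !dot_tens. jdots. field. }
  assert (V12 : forall i, perp N (tens 0 0 s u) (tens 1 0 s u) (tens 0 1 s u) (tens 1 1 s u) i
                = tens 1 1 s u i).
  { intros i. unfold perp. rewrite Hd. unfold N. rewrite !dot_tens. jdots. field. }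
  assert (V22 : forall i, perp N (tens 0 0 s u) (tens 1 0 s u) (tens 0 1 s u) (tens 0 2 s u) i
                = tens 0 2 s u i + tens 0 0 s u i).
  { intros i. unfold perp. rewrite Hd. unfold N. rewrite !dot_tens. jdots. field. }
  assert (VH : forall i, mean_curv N (tens 0 0 s u) (tens 1 0 s u) (tens 0 1 s u)
      (tens 2 0 s u) (tens 1 1 s u) (tens 0 2 s u) i
      = / 2 * ((tens 2 0 s u i + tens 0 0 s u i) + (tens 0 2 s u i + tens 0 0 s u i))).
  { intros i. unfold mean_curv. rewrite V11, V12, V22, Hd. unfold N. rewrite !dot_tens.
    jdots. field. }
  rewrite Hd, sqrt_1.
  rewrite (dot_ext N _ _ _ _ (fun i _ => VH i) (fun i _ => VH i)),
    (dot_ext N _ _ _ _ (fun i _ => V11 i) (fun i _ => V22 i)),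
    (dot_ext N _ _ _ _ (fun i _ => V12 i) (fun i _ => V12 i)).
  rewrite dot_scal_l, dot_scal_r, !dot_plus_l, !dot_plus_r. unfold N. rewrite !dot_tens.
  jdots. unfold curv2. field.
Qed.

(** The derivatives inside [is_willmore_value] are arbitrary witnesses; uniqueness of derivatives
    identifies them with the tensors [tens]. *)
Lemma tensor_is_willmore_value (gamma gammah : R -> nat -> R) w :
  (forall i s, (i < S n)%nat -> G i 0%nat s = gamma s i) ->
  (forall j u, (j < S m)%nat -> Gh j 0%nat u = gammah u j) ->
  is_willmore_value (S n * S m) (fun s u => tensor m (gamma s) (gammah u)) L Lh w ->
  w = L * Lh + (Lh * RInt (curv2 n G) 0 L + L * RInt (curv2 m Gh) 0 Lh) / 4.
Proof.
  intros Hg Hgh (xs & xt & xss & xst & xtt & Hd & Hi).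
  assert (HL := jets_pos _ _ _ HG). assert (HLh := jets_pos _ _ _ HGh).
  assert (Ds := tens_deriv_s). assert (Du := tens_deriv_u).
  assert (H0 : forall s u i, (i < S n * S m)%nat ->
    tensor m (gamma s) (gammah u) i = tens 0 0 s u i).
  { intros s u i Hi'. unfold tens, tensor.
    rewrite Hg, Hgh; [reflexivity|apply tensor_mod|apply tensor_div, Hi']. }
  assert (H1 : forall s u i, (i < S n * S m)%nat -> xs s u i = tens 1 0 s u i).
  { intros s u i Hi'. eapply uniqueness_limite; [apply (Hd s u i Hi')|].
    eapply derivable_pt_lim_ext; [|apply (Ds 0%nat)]. intros; symmetry; apply H0, Hi'. }
  assert (H2 : forall s u i, (i < S n * S m)%nat -> xt s u i = tens 0 1 s u i).
  { intros s u i Hi'. eapply uniqueness_limite; [apply (Hd s u i Hi')|].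
    eapply derivable_pt_lim_ext; [|apply (Du 0%nat 0%nat)]. intros; symmetry; apply H0, Hi'. }
  assert (H3 : forall s u i, (i < S n * S m)%nat -> xss s u i = tens 2 0 s u i).
  { intros s u i Hi'. eapply uniqueness_limite; [apply (Hd s u i Hi')|].
    eapply derivable_pt_lim_ext; [|apply (Ds 1%nat)]. intros; symmetry; apply H1, Hi'. }
  assert (H4 : forall s u i, (i < S n * S m)%nat -> xst s u i = tens 1 1 s u i).
  { intros s u i Hi'. eapply uniqueness_limite; [apply (Hd s u i Hi')|].
    eapply derivable_pt_lim_ext; [|apply (Du 1%nat 0%nat)]. intros; symmetry; apply H1, Hi'. }
  assert (H5 : forall s u i, (i < S n * S m)%nat -> xtt s u i = tens 0 2 s u i).
  { intros s u i Hi'. eapply uniqueness_limite; [apply (Hd s u i Hi')|].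
    eapply derivable_pt_lim_ext; [|apply (Du 0%nat 1%nat)]. intros; symmetry; apply H2, Hi'. }
  (* The density is split into three terms, each a function of s times a function of u. *)
  assert (Hi2 : is_integral2 (fun s u => 1 * 1 + ((/ 4 * curv2 n G s) * 1
                 + (/ 4) * curv2 m Gh u)) L Lh w).
  { eapply is_integral2_ext; [exact HL|exact HLh| |exact Hi].
    intros s u _ _. cbv beta.
    rewrite (willmore_density_ext _ _ _ _ _ _ _ _ _ _ _ _ _
      (H0 s u) (H1 s u) (H2 s u) (H3 s u) (H4 s u) (H5 s u)).
    rewrite tensor_density. field. }
  assert (C1 : cts (curv2 n G)) by (intros s; apply (curv2_continuous _ _ _ _ HG)).
  assert (C2 : cts (curv2 m Gh)) by (intros s; apply (curv2_continuous _ _ _ _ HGh)).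
  assert (C1' : cts (fun s => / 4 * curv2 n G s)) by (apply cts_mult; [apply cts_const|exact C1]).
  assert (Hi3 := is_integral2_plus _ _ L Lh _ _
    (is_integral2_prod (fun _ => 1) (fun _ => 1) L Lh HL HLh (cts_const 1) (cts_const 1))
    (is_integral2_plus _ _ L Lh _ _
       (is_integral2_prod _ (fun _ => 1) L Lh HL HLh C1' (cts_const 1))
       (is_integral2_prod (fun _ => / 4) _ L Lh HL HLh (cts_const _) C2))).
  rewrite (UL_sequence _ _ _ Hi2 Hi3), RInt_cscal, !RInt_rconst by exact C1. field.
Qed.

Definition tensE (i : nat) : fexpr :=
  Mul (SAt (G (i / S m)) 0) (UAt (Gh (i mod S m)) 0).

Definition nE (F : nat -> nat -> R -> R) (At : (nat -> R -> R) -> nat -> fexpr)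
  (i : nat) : fexpr :=
  Add (At (F i) 2%nat) (At (F i) 0%nat).

Definition velE (i : nat) : fexpr := Mul (nE G SAt (i / S m)) (nE Gh UAt (i mod S m)).

Definition speedE : fexpr :=
  Mul (dotE (S n) (nE G SAt) (nE G SAt)) (dotE (S m) (nE Gh UAt) (nE Gh UAt)).

Definition corrE (i : nat) : fexpr :=
  Mul (Mul (FConst (- / 4)) speedE)
      (Mul (Add (Mul (FConst 2) (tensE i)) (Mul Tv (velE i)))
           (Inv (Add (FConst 1) (Mul (Mul Tv Tv) (Mul (FConst (/ 4)) speedE))))).

(* Inverse stereographic lift of y + tV: with a = t^2 |V|^2 / 4 this is
   ((1 - a) y + t V) / (1 + a), written as y + t V + t^2 (...). *)
Definition varE (i : nat) : fexpr := ray (tensE i) (velE i) (corrE i).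

Lemma eval_speedE t s u : eval speedE t s u = curv2 n G s * curv2 m Gh u.
Proof. rewrite <- (curv2_norm HG), <- (curv2_norm HGh). reflexivity. Qed.

(** The denominator 1 + a of the stereographic formula is at least 1, so the family is smooth for
    every t, as the definition of a variation demands. *)
Lemma var_den_pos t s u : 0 < 1 + t * t * (/ 4 * (curv2 n G s * curv2 m Gh u)).
Proof.
  assert (H1 := curv2_nonneg HG s). assert (H2 := curv2_nonneg HGh u).
  assert (0 <= curv2 n G s * curv2 m Gh u) by (apply Rmult_le_pos; assumption).
  assert (0 <= t * t) by nra. nra.
Qed.

Lemma eval_varE i t s u :
  eval (varE i) t s u = tens 0 0 s u i + t * ntens 0 0 s u i +
    t * t * (- / 4 * (curv2 n G s * curv2 m Gh u) *
      ((2 * tens 0 0 s u i + t * ntens 0 0 s u i) *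
       / (1 + t * t * (/ 4 * (curv2 n G s * curv2 m Gh u))))).
Proof. rewrite <- (eval_speedE t). reflexivity. Qed.

Lemma wf_varE i t s u : wf (varE i) t s u.
Proof.
  assert (Hc := jets_chain _ _ _ HG). assert (Hch := jets_chain _ _ _ HGh).
  assert (Hs : wf speedE t s u).
  { split; apply wf_dotE; intros k Hk; split; first [apply Hc|apply Hch]. }
  assert (Hy : wf (tensE i) t s u) by (split; [apply Hc|apply Hch]).
  assert (Hv : wf (velE i) t s u) by (repeat split; first [apply Hc|apply Hch]).
  assert (Hp := var_den_pos t s u).
  unfold varE, ray, corrE. cbn [wf eval]. rewrite eval_speedE.
  split_conj; auto. lra.
Qed.

(** As V is orthogonal to y and t^2 |V|^2 = 4 a, the squared norm is ((1 - a)^2 + 4 a) / (1 + a)^2 =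
    1. *)
Lemma varE_unit t s u :
  dot (S n * S m) (fun i => eval (varE i) t s u) (fun i => eval (varE i) t s u) = 1.
Proof.
  assert (Hp := var_den_pos t s u).
  set (q := curv2 n G s * curv2 m Gh u) in *.
  set (c1 := (1 - t * t * (/ 4 * q)) / (1 + t * t * (/ 4 * q))).
  set (c2 := t / (1 + t * t * (/ 4 * q))).
  assert (E : forall i, (i < S n * S m)%nat ->
    eval (varE i) t s u = c1 * tens 0 0 s u i + c2 * ntens 0 0 s u i).
  { intros i _. rewrite eval_varE. fold q. unfold c1, c2. field. lra. }
  rewrite (dot_ext _ _ _ _ _ E E), dot_plus_l, !dot_plus_r, !dot_scal_l, !dot_scal_r.
  rewrite (dot_comm _ (tens 0 0 s u) (ntens 0 0 s u)), dot_ntens, dot_tens.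
  unfold ntens. rewrite dot_tensor.
  change (dot (S n) (nvec G 0 s) (nvec G 0 s)) with
    (dot (S n) (fun i => G i 2%nat s + G i 0%nat s) (fun i => G i 2%nat s + G i 0%nat s)).
  change (dot (S m) (nvec Gh 0 u) (nvec Gh 0 u)) with
    (dot (S m) (fun i => Gh i 2%nat u + Gh i 0%nat u) (fun i => Gh i 2%nat u + Gh i 0%nat u)).
  rewrite (curv2_norm HG), (curv2_norm HGh). fold q. jdots.
  unfold c1, c2. field. lra.
Qed.

Lemma varE_periodic i t s u :
  eval (varE i) t (s + L) u = eval (varE i) t s u /\
  eval (varE i) t s (u + Lh) = eval (varE i) t s u.
Proof.
  rewrite !eval_varE, (curv2_periodic HG), (curv2_periodic HGh).
  unfold tens, ntens, nvec, tensor.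
  rewrite !(jets_periodic _ _ _ HG), !(jets_periodic _ _ _ HGh). split; reflexivity.
Qed.

Definition var_densE : fexpr :=
  densE (S n * S m) varE (fun i => der VS (varE i)) (fun i => der VU (varE i))
    (fun i => der VS (der VS (varE i))) (fun i => der VU (der VS (varE i)))
    (fun i => der VU (der VU (varE i))).

Lemma wf_var_densE t s u :
  0 < eval (gdetE (S n * S m) (fun i => der VS (varE i)) (fun i => der VU (varE i))) t s u ->
  wf var_densE t s u.
Proof.
  intros H. apply wf_densE; try exact H; intros i _; repeat apply wf_der; apply wf_varE.
Qed.

(** Q is k^2 kh^2 for three reasons: <N'' (x) Nh, gamma (x) Nh> = k^2 kh^2, the symmetric identity
    with the factors exchanged, and <N', gamma'> <Nh', gammah'> = (- k^2)(- kh^2). The metric is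
    stationary because N is orthogonal to gamma and gamma'. *)
Lemma var_densE_deriv s u :
  0 < eval (gdetE (S n * S m) (fun i => der VS (varE i)) (fun i => der VU (varE i))) 0 s u ->
  eval (der VT var_densE) 0 s u = curv2 n G s * curv2 m Gh u.
Proof.
  intros Hpos.
  assert (S1 : VS <> VT) by discriminate. assert (U1 : VU <> VT) by discriminate.
  assert (E00 : forall i, eval (varE i) 0 s u = tens 0 0 s u i /\
                          eval (der VT (varE i)) 0 s u = ntens 0 0 s u i).
  { intros i. unfold varE. split; [rewrite (proj1 (ray_0 _ _ _ _ _))|
      rewrite (proj2 (ray_0 _ _ _ _ _))];
      unfold tensE, velE, nE, tens, ntens, nvec, tensor; cbn [eval der]; ring. }
  assert (E10 : forall i, eval (der VS (varE i)) 0 s u = tens 1 0 s u i /\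
                          eval (der VT (der VS (varE i))) 0 s u = ntens 1 0 s u i).
  { intros i. unfold varE. split; [rewrite (proj1 (ray_1 _ _ _ _ _ _ S1))|
      rewrite (proj2 (ray_1 _ _ _ _ _ _ S1))];
      unfold tensE, velE, nE, tens, ntens, nvec, tensor; cbn [eval der]; ring. }
  assert (E01 : forall i, eval (der VU (varE i)) 0 s u = tens 0 1 s u i /\
                          eval (der VT (der VU (varE i))) 0 s u = ntens 0 1 s u i).
  { intros i. unfold varE. split; [rewrite (proj1 (ray_1 _ _ _ _ _ _ U1))|
      rewrite (proj2 (ray_1 _ _ _ _ _ _ U1))];
      unfold tensE, velE, nE, tens, ntens, nvec, tensor; cbn [eval der]; ring. }
  assert (E20 : forall i, eval (der VS (der VS (varE i))) 0 s u = tens 2 0 s u i /\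
                          eval (der VT (der VS (der VS (varE i)))) 0 s u = ntens 2 0 s u i).
  { intros i. unfold varE. split; [rewrite (proj1 (ray_2 _ _ _ _ _ _ _ S1 S1))|
      rewrite (proj2 (ray_2 _ _ _ _ _ _ _ S1 S1))];
      unfold tensE, velE, nE, tens, ntens, nvec, tensor; cbn [eval der]; ring. }
  assert (E11 : forall i, eval (der VU (der VS (varE i))) 0 s u = tens 1 1 s u i /\
                          eval (der VT (der VU (der VS (varE i)))) 0 s u = ntens 1 1 s u i).
  { intros i. unfold varE. split; [rewrite (proj1 (ray_2 _ _ _ _ _ _ _ S1 U1))|
      rewrite (proj2 (ray_2 _ _ _ _ _ _ _ S1 U1))];
      unfold tensE, velE, nE, tens, ntens, nvec, tensor; cbn [eval der]; ring. }
  assert (E02 : forall i, eval (der VU (der VU (varE i))) 0 s u = tens 0 2 s u i /\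
                          eval (der VT (der VU (der VU (varE i)))) 0 s u = ntens 0 2 s u i).
  { intros i. unfold varE. split; [rewrite (proj1 (ray_2 _ _ _ _ _ _ _ U1 U1))|
      rewrite (proj2 (ray_2 _ _ _ _ _ _ _ U1 U1))];
      unfold tensE, velE, nE, tens, ntens, nvec, tensor; cbn [eval der]; ring. }
  assert (DV : forall (X : nat -> fexpr) v',
    (forall i, wf (X i) 0 s u) -> (forall i, eval (der VT (X i)) 0 s u = v' i) ->
    vec_deriv (S n * S m) (fun t i => eval (X i) t s u) v').
  { intros X v' HX HX' i _. rewrite <- HX'. apply (der_correct VT (X i) 0 s u), HX. }
  assert (W : forall i, wf (varE i) 0 s u) by (intros; apply wf_varE).
  eapply uniqueness_limite.
  { apply (der_correct VT var_densE 0 s u). apply wf_var_densE, Hpos. }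
  assert (X00 := fun i (_ : (i < S n * S m)%nat) => proj1 (E00 i)).
  assert (X10 := fun i (_ : (i < S n * S m)%nat) => proj1 (E10 i)).
  assert (X01 := fun i (_ : (i < S n * S m)%nat) => proj1 (E01 i)).
  assert (X20 := fun i (_ : (i < S n * S m)%nat) => proj1 (E20 i)).
  assert (X11 := fun i (_ : (i < S n * S m)%nat) => proj1 (E11 i)).
  assert (X02 := fun i (_ : (i < S n * S m)%nat) => proj1 (E02 i)).
  assert (B11 : forall i, (i < S n * S m)%nat ->
    eval (der VS (der VS (varE i))) 0 s u + eval (varE i) 0 s u = tens 2 0 s u i + tens 0 0 s u i)
    by (intros i Hi; rewrite X20, X00 by exact Hi; reflexivity).
  assert (B22 : forall i, (i < S n * S m)%nat ->
    eval (der VU (der VU (varE i))) 0 s u + eval (varE i) 0 s u = tens 0 2 s u i + tens 0 0 s u i)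
    by (intros i Hi; rewrite X02, X00 by exact Hi; reflexivity).
  assert (R0 : forall v : nat -> R, forall i, (i < S n * S m)%nat -> v i = v i) by reflexivity.
  apply (willmore_density_deriv (S n * S m)
    (fun t i => eval (varE i) t s u) (fun t i => eval (der VS (varE i)) t s u)
    (fun t i => eval (der VU (varE i)) t s u) (fun t i => eval (der VS (der VS (varE i))) t s u)
    (fun t i => eval (der VU (der VS (varE i))) t s u)
    (fun t i => eval (der VU (der VU (varE i))) t s u)
    (ntens 0 0 s u) (ntens 1 0 s u) (ntens 0 1 s u)
    (ntens 2 0 s u) (ntens 1 1 s u) (ntens 0 2 s u)).
  1-6: apply DV; [intros i; repeat apply wf_der; apply W|first
    [apply E00|apply E10|apply E01|apply E20|apply E11|apply E02]].
  (* Every factor evaluated at t = 0 is replaced by its tensor, after which the hypotheses reduce to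
     products of entries of the [jdot] table. *)
  all: repeat match goal with
    | |- context [dot ?N ?a ?b] =>
        first [ rewrite (dot_ext N a _ b _ X00 X00) | rewrite (dot_ext N a _ b _ X00 X10)
              | rewrite (dot_ext N a _ b _ X00 X01) | rewrite (dot_ext N a _ b _ X10 X10)
              | rewrite (dot_ext N a _ b _ X10 X01) | rewrite (dot_ext N a _ b _ X01 X01)
              | rewrite (dot_ext N a _ b _ X20 X00) | rewrite (dot_ext N a _ b _ X20 X10)
              | rewrite (dot_ext N a _ b _ X20 X01) | rewrite (dot_ext N a _ b _ X11 X00)
              | rewrite (dot_ext N a _ b _ X11 X10) | rewrite (dot_ext N a _ b _ X11 X01)
              | rewrite (dot_ext N a _ b _ X02 X00) | rewrite (dot_ext N a _ b _ X02 X10)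
              | rewrite (dot_ext N a _ b _ X02 X01)
              | progress rewrite (dot_ext N a a b _ (R0 a) B11)
              | progress rewrite (dot_ext N a a b _ (R0 a) B22)
              | progress rewrite (dot_ext N a a b _ (R0 a) X10)
              | progress rewrite (dot_ext N a a b _ (R0 a) X01)
              | progress rewrite (dot_ext N a a b _ (R0 a) X11)
              | progress rewrite (dot_ext N a _ b b X10 (R0 b)) ]
    end.
  all: rewrite ?(dot_comm _ (tens 1 0 s u) (ntens 0 1 s u)), ?dot_plus_r, ?dot_tens, ?dot_ntens.
  all: jdots; unfold curv2; ring.
Qed.

(** The determinant is 1 at t = 0, and [eval_tube] keeps it positive on the whole rectangle for
    small t, so these surfaces are immersed. *)
Lemma var_det_pos : exists d, 0 < d /\ forall t s u,
  Rabs t < d -> 0 <= s <= L -> 0 <= u <= Lh ->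
  0 < eval (gdetE (S n * S m) (fun i => der VS (varE i)) (fun i => der VU (varE i))) t s u.
Proof.
  set (e := gdetE (S n * S m) (fun i => der VS (varE i)) (fun i => der VU (varE i))).
  destruct (eval_tube e L Lh) with (eps := 1) as [d [Hd H]].
  - intros s u _ _. apply wf_gdetE; intros i _; apply wf_der, wf_varE.
  - lra.
  - exists d. split; [exact Hd|]. intros t s u Ht Hs Hu. specialize (H t s u Ht Hs Hu).
    assert (E : eval e 0 s u = 1).
    { change (gdet (S n * S m) (fun i => eval (der VS (varE i)) 0 s u)
                (fun i => eval (der VU (varE i)) 0 s u) = 1).
      assert (X : forall v i, v <> VT -> eval (der v (varE i)) 0 s u = eval (der v (tensE i)) 0 s u)
        by (intros v i Hv; apply ray_1, Hv).
      assert (X1 : forall i, (i < S n * S m)%nat -> eval (der VS (varE i)) 0 s u = tens 1 0 s u i).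
      { intros i _. rewrite X by discriminate. unfold tensE, tens, tensor; cbn [eval der]; ring. }
      assert (X2 : forall i, (i < S n * S m)%nat -> eval (der VU (varE i)) 0 s u = tens 0 1 s u i).
      { intros i _. rewrite X by discriminate. unfold tensE, tens, tensor; cbn [eval der]; ring. }
      unfold gdet. rewrite (dot_ext _ _ _ _ _ X1 X1), (dot_ext _ _ _ _ _ X1 X2),
        (dot_ext _ _ _ _ _ X2 X2), !dot_tens. jdots. ring. }
    rewrite E in H. apply Rabs_def2 in H. lra.
Qed.

(** The function w has derivative 0 by criticality, and the product of the total squared curvatures
    by differentiation under the integral; the two must agree. *)
Lemma willmore_tensor_curvature (gamma gammah : R -> nat -> R) :
  (forall i s, (i < S n)%nat -> G i 0%nat s = gamma s i) ->
  (forall j u, (j < S m)%nat -> Gh j 0%nat u = gammah u j) ->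
  willmore_surface (S n * S m) (fun s u => tensor m (gamma s) (gammah u)) L Lh ->
  RInt (curv2 n G) 0 L * RInt (curv2 m Gh) 0 Lh = 0.
Proof.
  intros Hg Hgh HW.
  assert (HL := jets_pos _ _ _ HG). assert (HLh := jets_pos _ _ _ HGh).
  assert (C1 : cts (curv2 n G)) by (intros s; apply (curv2_continuous _ _ _ _ HG)).
  assert (C2 : cts (curv2 m Gh)) by (intros s; apply (curv2_continuous _ _ _ _ HGh)).
  destruct var_det_pos as [d [Hd Hdet]].
  assert (Hwf : forall t s u, Rabs t < d -> 0 <= s <= L -> 0 <= u <= Lh -> wf var_densE t s u)
    by (intros; apply wf_var_densE, Hdet; assumption).
  (* Where no integral exists [epsilon] returns an arbitrary number; only |t| < d matters. *)
  set (w := fun t => epsilon (inhabits 0) (fun I => is_integral2 (eval var_densE t) L Lh I)).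
  assert (Hw : forall t, Rabs t < d -> is_integral2 (eval var_densE t) L Lh (w t)).
  { intros t Ht. apply epsilon_spec. apply is_integral2_exists; try assumption.
    intros s u Hs Hu eps.
    destruct (eval_cont3_at var_densE t s u (Hwf t s u Ht Hs Hu) eps (cond_pos eps))
      as [r [Hr H]].
    exists (mkposreal r Hr). intros s' u' Hs' Hu'. apply H; try assumption.
    rewrite Rminus_diag, Rabs_R0. exact Hr. }
  assert (D0 : derivable_pt_lim w 0 0).
  { apply (HW (fun t s u i => eval (varE i) t s u)).
    - intros i _. apply eval_smooth3. apply wf_varE.
    - intros s u i Hi. rewrite eval_varE. unfold tens, tensor.
      rewrite <- Hg, <- Hgh; [ring|apply tensor_mod|apply tensor_div, Hi].
    - intros; apply varE_unit.
    - intros; apply varE_periodic.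
    - exists d. split; [exact Hd|]. intros t Ht.
      exists (fun s u i => eval (der VS (varE i)) t s u),
        (fun s u i => eval (der VU (varE i)) t s u),
        (fun s u i => eval (der VS (der VS (varE i))) t s u),
        (fun s u i => eval (der VU (der VS (varE i))) t s u),
        (fun s u i => eval (der VU (der VU (varE i))) t s u).
      split; [|exact (Hw t Ht)].
      intros s u i _. assert (W := wf_varE i t s u).
      repeat split.
      + apply (der_correct VS (varE i) t s u), W.
      + apply (der_correct VU (varE i) t s u), W.
      + apply (der_correct VS (der VS (varE i)) t s u), wf_der, W.
      + apply (der_correct VU (der VS (varE i)) t s u), wf_der, W.
      + apply (der_correct VU (der VU (varE i)) t s u), wf_der, W. }
  assert (DJ : derivable_pt_lim w 0 (RInt (curv2 n G) 0 L * RInt (curv2 m Gh) 0 Lh)).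
  { apply (integral_deriv var_densE L Lh w d); try assumption.
    eapply is_integral2_ext; [exact HL|exact HLh| |apply is_integral2_prod; assumption].
    intros s u Hs Hu. cbv beta. symmetry. apply var_densE_deriv, Hdet; try assumption.
    rewrite Rabs_R0. exact Hd. }
  apply (uniqueness_limite w 0); assumption.
Qed.

End TensorVariation.

Lemma curv2_RInt_eq0 n G L :
  jets n G L -> RInt (curv2 n G) 0 L = 0 -> forall s, curv2 n G s = 0.
Proof.
  intros HG H s.
  destruct (periodic_reduce L (curv2 n G) (jets_pos _ _ _ HG) (curv2_periodic HG) s)
    as [x [Hx <-]].
  apply (RInt_nonneg_eq0 (curv2 n G) 0 L); try assumption.
  - apply (jets_pos _ _ _ HG).
  - intros; apply (curv2_continuous _ _ _ _ HG).
  - intros; apply (curv2_nonneg HG).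
  - lra.
Qed.

(** * Great circles and the equality case *)

Lemma deriv_zero_const (f : R -> R) :
  (forall x, derivable_pt_lim f x 0) -> forall x y, f x = f y.
Proof.
  intros H x y.
  destruct (MVT_gen f x y (fun _ => 0)) as [c [_ Hc]].
  - intros; apply is_derive_Reals, H.
  - intros z _. apply derivable_continuous_pt. exists 0. apply H.
  - lra.
Qed.

(** Rotating the pair (f, f'/om) back through the angle om x gives two constants; inverting the
    rotation recovers f. *)
Lemma harmonic_solution (f : nat -> R -> R) om :
  chain f -> om <> 0 -> (forall x, f 2%nat x = - om^2 * f O x) ->
  forall x, f O x = cos (om * x) * f O 0 + sin (om * x) * (f 1%nat 0 / om).
Proof.
  intros Hf Ho H2 x.
  assert (H1 : forall x y, (fun x => f O x * cos (om * x) - f 1%nat x / om * sin (om * x)) x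
    = (fun x => f O x * cos (om * x) - f 1%nat x / om * sin (om * x)) y).
  { apply deriv_zero_const. intros z. apply is_derive_Reals. auto_derive.
    - repeat split; apply chain_ex_derive, Hf.
    - rewrite !chain_Derive by exact Hf. rewrite H2. field. exact Ho. }
  assert (H3 : forall x y, (fun x => f O x * sin (om * x) + f 1%nat x / om * cos (om * x)) x
    = (fun x => f O x * sin (om * x) + f 1%nat x / om * cos (om * x)) y).
  { apply deriv_zero_const. intros z. apply is_derive_Reals. auto_derive.
    - repeat split; apply chain_ex_derive, Hf.
    - rewrite !chain_Derive by exact Hf. rewrite H2. field. exact Ho. }
  specialize (H1 x 0). specialize (H3 x 0). cbv beta in H1, H3.
  rewrite Rmult_0_r, cos_0, sin_0 in H1, H3.
  assert (Hs := sin2_cos2 (om * x)). unfold Rsqr in Hs.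
  transitivity (f O x * (sin (om * x) * sin (om * x) + cos (om * x) * cos (om * x))).
  { rewrite Hs; ring. }
  replace (f O 0) with (f O x * cos (om * x) - f 1%nat x / om * sin (om * x)) by lra.
  replace (f 1%nat 0 / om) with (f O x * sin (om * x) + f 1%nat x / om * cos (om * x)) by lra.
  ring.
Qed.

Definition orth2 (k : nat) (E1 E2 : nat -> R) : Prop :=
  dot k E1 E1 = 1 /\ dot k E2 E2 = 1 /\ dot k E1 E2 = 0.

Definition orth3 (k : nat) (P Q C : nat -> R) : Prop :=
  orth2 k P Q /\ dot k C C = 1 /\ dot k P C = 0 /\ dot k Q C = 0.

(** Vanishing curvature gives gamma'' = - gamma and hence the period 2 pi. Minimality of L bounds it
    by 2 pi, and closing up excludes anything shorter. *)
Lemma great_circle n G L :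
  jets n G L ->
  (forall T, 0 < T < L -> exists s i, (i < S n)%nat /\ G i 0%nat (s + T) <> G i 0%nat s) ->
  (forall s, curv2 n G s = 0) ->
  L = 2 * PI /\ exists E1 E2, orth2 (S n) E1 E2 /\
    forall i s, (i < S n)%nat -> G i 0%nat s = cos s * E1 i + sin s * E2 i.
Proof.
  intros HG Hmin Hk. assert (Hpi := PI_RGT_0). assert (HL := jets_pos _ _ _ HG).
  assert (Hf : forall i s, (i < S n)%nat ->
    G i 0%nat s = cos s * G i 0%nat 0 + sin s * G i 1%nat 0).
  { intros i s Hi.
    rewrite (harmonic_solution (G i) 1 (jets_chain _ _ _ HG i)) with (x := s).
    - rewrite Rmult_1_l. field.
    - lra.
    - intros x. rewrite (curv2_eq0 HG x (Hk x) i Hi). ring. }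
  assert (H00 := jdot00 HG 0). assert (H11 := jdot11 HG 0). assert (H01 := jdot01 HG 0).
  unfold jdot in H00, H11, H01.
  split.
  - assert (Hle : L <= 2 * PI).
    { apply Rnot_lt_le. intros Hlt.
      destruct (Hmin (2 * PI)) as (s & i & Hi & Hne); [lra|].
      apply Hne. rewrite (Hf i (s + 2 * PI) Hi), (Hf i s Hi), cos_plus, sin_plus, cos_2PI, sin_2PI.
      ring. }
    (* Pairing gamma(L) = gamma(0) with gamma(0) leaves cos L = 1, which for 0 < L < 2 pi
       contradicts cos L = 1 - 2 sin(L/2)^2. *)
    assert (Hcos : cos L = 1).
    { rewrite <- H00 at 1.
      transitivity (dot (S n) (fun i => cos L * G i 0%nat 0 + sin L * G i 1%nat 0)
                              (fun i => G i 0%nat 0)).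
      - rewrite dot_plus_l, !dot_scal_l, (dot_comm _ (fun i => G i 1%nat 0)), H00, H01. ring.
      - apply dot_ext; [|reflexivity]. intros i Hi. rewrite <- Hf by exact Hi.
        rewrite <- (Rplus_0_l L). apply (jets_periodic _ _ _ HG). }
    destruct (Rle_lt_or_eq_dec _ _ Hle) as [Hlt|]; [exfalso|assumption].
    assert (Hs : 0 < sin (L / 2)) by (apply sin_gt_0; lra).
    replace L with (2 * (L / 2)) in Hcos by field. rewrite cos_2a_sin in Hcos. nra.
  - exists (fun i => G i 0%nat 0), (fun i => G i 1%nat 0). split; [|exact Hf].
    repeat split; assumption.
Qed.

Section CurvatureBound.
Context (n : nat) (G : nat -> nat -> R -> R) (L : R) (HG : jets n G L).

(** Wirtinger is applied to gamma' because closedness makes its mean vanish, whereas gamma may have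
    nonzero mean, as on a small circle. *)
Lemma velocity_form i :
  0 <= wirtinger_form L (fun k => G i (S k)) /\
  (wirtinger_form L (fun k => G i (S k)) = 0 ->
   forall s, G i 3%nat s = - (2 * PI / L)^2 * G i 1%nat s).
Proof.
  assert (Hc := jets_chain _ _ _ HG i). assert (HL := jets_pos _ _ _ HG).
  assert (Hf : chain (fun k => G i (S k))) by (intros k s; apply Hc).
  assert (Hp : forall k x, (fun k => G i (S k)) k (x + L) = (fun k => G i (S k)) k x)
    by (intros; apply (jets_periodic _ _ _ HG)).
  assert (H0 : RInt (G i 1%nat) 0 L = 0).
  { rewrite (RInt_deriv (G i 0%nat)); [|intros; apply Hc|apply cts_chain, Hc].
    rewrite <- (Rplus_0_l L) at 1. rewrite (jets_periodic _ _ _ HG). Rring. }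
  split.
  - apply wirtinger; assumption.
  - intros HW. apply (wirtinger_eq L HL (fun k => G i (S k))); assumption.
Qed.

Lemma velocity_form_sum :
  sumN (S n) (fun i => wirtinger_form L (fun k => G i (S k)))
  = RInt (curv2 n G) 0 L + L - 4 * PI^2 / L.
Proof.
  assert (HL := jets_pos _ _ _ HG).
  assert (Hc : forall i k, cts (G i k)) by (intros; apply cts_chain, (jets_chain _ _ _ HG)).
  unfold wirtinger_form.
  rewrite (sumN_ext _ _ (fun i => RInt (fun x => G i 2%nat x * G i 2%nat x) 0 L
    + (- (2 * PI / L)^2) * RInt (fun x => G i 1%nat x * G i 1%nat x) 0 L)) by (intros; ring).
  rewrite sumN_plus, sumN_scal.
  rewrite <- (RInt_csumN (S n) (fun i x => G i 2%nat x * G i 2%nat x)),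
    <- (RInt_csumN (S n) (fun i x => G i 1%nat x * G i 1%nat x))
    by (intros; apply cts_mult; apply Hc).
  rewrite (RInt_ext (fun x => sumN (S n) (fun i => G i 1%nat x * G i 1%nat x)) (fun _ => 1))
    by (intros; apply (jdot11 HG)).
  rewrite (RInt_ext (fun x => sumN (S n) (fun i => G i 2%nat x * G i 2%nat x))
             (fun x => curv2 n G x + 1))
    by (intros; unfold curv2, jdot, dot; Rring).
  rewrite RInt_cplus, !RInt_rconst.
  - Req. field. lra.
  - intros s; apply (curv2_continuous _ _ _ _ HG).
  - apply cts_const.
Qed.

Lemma curvature_bound : 4 * PI^2 / L - L <= RInt (curv2 n G) 0 L.
Proof.
  assert (H := velocity_form_sum).
  assert (0 <= sumN (S n) (fun i => wirtinger_form L (fun k => G i (S k))))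
    by (apply sumN_nonneg; intros; apply velocity_form).
  lra.
Qed.

(** The defect in the bound is a sum of nonnegative defects of the coordinates, so equality holds in
    each of them. *)
Lemma curvature_bound_eq :
  L = 2 * PI / sqrt 3 -> RInt (curv2 n G) 0 L = 4 * PI^2 / L - L ->
  exists P Q C, orth3 (S n) P Q C /\ forall i s, (i < S n)%nat ->
    G i 0%nat s = cos (sqrt 3 * s) / sqrt 3 * P i + sin (sqrt 3 * s) / sqrt 3 * Q i
                  + sqrt 2 / sqrt 3 * C i.
Proof.
  intros EL EI. assert (Hpi := PI_RGT_0).
  assert (H3 : 0 < sqrt 3) by (apply sqrt_lt_R0; lra).
  assert (H2 : 0 < sqrt 2) by (apply sqrt_lt_R0; lra).
  assert (S3 : sqrt 3 * sqrt 3 = 3) by (apply sqrt_sqrt; lra).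
  assert (S2 : sqrt 2 * sqrt 2 = 2) by (apply sqrt_sqrt; lra).
  assert (HS := velocity_form_sum). rewrite EI in HS.
  assert (Hd3 : forall i s, (i < S n)%nat -> G i 3%nat s = -3 * G i 1%nat s).
  { intros i s Hi.
    rewrite (proj2 (velocity_form i)).
    - replace (2 * PI / L) with (sqrt 3) by (rewrite EL; field; lra).
      replace (sqrt 3 ^ 2) with 3 by (simpl; lra). ring.
    - apply (sumN_nonneg_eq0 (S n) (fun i => wirtinger_form L (fun k => G i (S k))));
        [intros; apply velocity_form|rewrite HS; ring|exact Hi]. }
  (* The centre of the circle: gamma''' = - 3 gamma' makes gamma + gamma''/3 constant. *)
  set (c := fun i => G i 0%nat 0 + G i 2%nat 0 / 3).
  assert (Hc2 : forall i s, (i < S n)%nat -> G i 2%nat s = -3 * (G i 0%nat s - c i)).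
  { intros i s Hi.
    assert (E := deriv_zero_const (fun s => G i 2%nat s + 3 * G i 0%nat s)).
    assert (E' : G i 2%nat s + 3 * G i 0%nat s = G i 2%nat 0 + 3 * G i 0%nat 0).
    { apply E. intros x. eapply derivable_pt_lim_eq; [|apply deriv_plus;
        [|apply deriv_scal]; apply (jets_chain _ _ _ HG)]. rewrite Hd3 by exact Hi. ring. }
    unfold c. lra. }
  assert (Hform : forall i s, (i < S n)%nat ->
    G i 0%nat s = c i + cos (sqrt 3 * s) * (- G i 2%nat 0 / 3)
                  + sin (sqrt 3 * s) * (G i 1%nat 0 / sqrt 3)).
  { intros i s Hi.
    set (f := fun k x => match k with O => G i O x - c i | _ => G i k x end).
    assert (Hf : chain f).
    { intros [|k] x; simpl; [|apply (jets_chain _ _ _ HG)].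
      eapply derivable_pt_lim_eq; [|apply deriv_minus;
        [apply (jets_chain _ _ _ HG)|apply derivable_pt_lim_const]]. ring. }
    assert (E := harmonic_solution f (sqrt 3) Hf ltac:(lra)).
    assert (E' := E ltac:(intros x; unfold f; rewrite Hc2 by exact Hi;
      replace (sqrt 3 ^ 2) with 3 by (simpl; lra); ring) s).
    unfold f in E'. replace (G i 0%nat 0 - c i) with (- G i 2%nat 0 / 3) in E'
      by (unfold c; field). lra. }
  assert (J00 := jdot00 HG 0). assert (J11 := jdot11 HG 0). assert (J01 := jdot01 HG 0).
  assert (J02 := jdot02 HG 0). assert (J12 := jdot12 HG 0).
  (* Compare <gamma', gamma'''> = - |gamma''|^2 with gamma''' = - 3 gamma'. *)
  assert (J22 : jdot n G 2 2 0 = 3).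
  { assert (E := jdot13 HG 0).
    assert (E' : jdot n G 1 3 0 = -3 * jdot n G 1 1 0).
    { unfold jdot. rewrite <- dot_scal_r. apply dot_ext; [reflexivity|]. intros; apply Hd3; assumption. }
    lra. }
  unfold jdot in *.
  (* Unit vectors along the radius gamma(0) - c = - gamma''(0)/3, the velocity, and the centre,
     whose squared length is 1 - 2/3 + 3/9 = 2/3. *)
  exists (fun i => - / sqrt 3 * G i 2%nat 0), (fun i => G i 1%nat 0),
    (fun i => sqrt 3 / sqrt 2 * (G i 0%nat 0 + / 3 * G i 2%nat 0)).
  split; [split; [split; [|split]|split; [|split]]|].
  - rewrite dot_scal_l, dot_scal_r, J22.
    replace (- / sqrt 3 * (- / sqrt 3 * 3)) with (3 / (sqrt 3 * sqrt 3)) by (field; lra).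
    rewrite S3. field.
  - exact J11.
  - rewrite dot_scal_l, dot_comm, J12. ring.
  - rewrite dot_scal_l, dot_scal_r, dot_plus_l, !dot_plus_r, !dot_scal_l, !dot_scal_r.
    rewrite (dot_comm _ (fun i => G i 2%nat 0) (fun i => G i 0%nat 0)), J00, J02, J22.
    transitivity ((sqrt 3 * sqrt 3) / (sqrt 2 * sqrt 2) * (2 / 3)); [field; lra|].
    rewrite S3, S2. field.
  - rewrite dot_scal_l, dot_scal_r, dot_plus_r, dot_scal_r.
    rewrite (dot_comm _ (fun i => G i 2%nat 0) (fun i => G i 0%nat 0)), J02, J22. field. lra.
  - rewrite dot_scal_r, dot_plus_r, dot_scal_r.
    rewrite (dot_comm _ (fun i => G i 1%nat 0) (fun i => G i 0%nat 0)), J01, J12. ring.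
  - intros i s Hi. rewrite (Hform i s Hi). unfold c.
    replace (cos (sqrt 3 * s) / sqrt 3 * (- / sqrt 3 * G i 2%nat 0)) with
      (cos (sqrt 3 * s) * (- G i 2%nat 0 / (sqrt 3 * sqrt 3))) by (field; lra).
    rewrite S3. field. lra.
Qed.

(* w is the Willmore energy when the other factor is a great circle (length 2 pi, curvature 0). *)
Lemma great_circle_energy w :
  w = 2 * PI * L + (2 * PI * RInt (curv2 n G) 0 L) / 4 ->
  2 * PI^2 * sqrt 3 <= w /\
  (w = 2 * PI^2 * sqrt 3 ->
   L = 2 * PI / sqrt 3 /\ RInt (curv2 n G) 0 L = 4 * PI^2 / L - L).
Proof.
  intros ->. assert (HL := jets_pos _ _ _ HG). assert (Hpi := PI_RGT_0).
  assert (H3 : 0 < sqrt 3) by (apply sqrt_lt_R0; lra).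
  assert (S3 : sqrt 3 * sqrt 3 = 3) by (apply sqrt_sqrt; lra).
  assert (HB := curvature_bound).
  set (K := RInt (curv2 n G) 0 L) in *.
  (* The excess splits into the defect of the arithmetic-geometric mean inequality, a square
     vanishing at L = 2 pi / sqrt 3, and the defect of [curvature_bound]. *)
  assert (E : 2 * PI * L + 2 * PI * K / 4 - 2 * PI^2 * sqrt 3
     = PI / (2 * L) * (sqrt 3 * L - 2 * PI)^2 + PI / 2 * (K - (4 * PI^2 / L - L))).
  { replace ((sqrt 3 * L - 2 * PI)^2) with
      (sqrt 3 * sqrt 3 * L^2 - 4 * PI * sqrt 3 * L + 4 * PI^2) by ring.
    rewrite S3. field. lra. }
  assert (A : 0 < PI / (2 * L)) by (apply Rdiv_lt_0_compat; lra).
  assert (B := pow2_ge_0 (sqrt 3 * L - 2 * PI)).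
  assert (A1 : 0 <= PI / (2 * L) * (sqrt 3 * L - 2 * PI)^2) by (apply Rmult_le_pos; lra).
  assert (A2 : 0 <= PI / 2 * (K - (4 * PI^2 / L - L))) by (apply Rmult_le_pos; lra).
  split; [lra|]. intros Ew.
  assert (Z1 : (sqrt 3 * L - 2 * PI)^2 = 0).
  { destruct (Rmult_integral (PI / (2 * L)) ((sqrt 3 * L - 2 * PI)^2)); lra. }
  assert (Z2 : K - (4 * PI^2 / L - L) = 0).
  { destruct (Rmult_integral (PI / 2) (K - (4 * PI^2 / L - L))); lra. }
  split; [|lra].
  assert (Z : sqrt 3 * L = 2 * PI) by nra. rewrite <- Z. field. lra.
Qed.

End CurvatureBound.

(** Coordinate k of [ejiri] is coordinate k/2 of the small circle times coordinate k mod 2 of the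
    great circle. [tri] and [alt] select the frame vectors belonging to these two factors. *)
Definition tri (P Q C : nat -> R) (k : nat) : nat -> R :=
  match k with 0%nat | 1%nat => P | 2%nat | 3%nat => Q | _ => C end.

Definition alt (E1 E2 : nat -> R) (k : nat) : nat -> R :=
  match k with 0%nat | 2%nat | 4%nat => E1 | _ => E2 end.

Lemma dot_tri_alt N P Q C M E1 E2 a b :
  orth3 N P Q C -> orth2 M E1 E2 -> (a < 6)%nat -> (b < 6)%nat ->
  dot N (tri P Q C a) (tri P Q C b) * dot M (alt E1 E2 a) (alt E1 E2 b)
  = if Nat.eqb a b then 1 else 0.
Proof.
  intros ((p1 & p2 & p3) & p4 & p5 & p6) (e1 & e2 & e3) Ha Hb.
  assert (p3' : dot N Q P = 0) by (rewrite dot_comm; assumption).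
  assert (p5' : dot N C P = 0) by (rewrite dot_comm; assumption).
  assert (p6' : dot N C Q = 0) by (rewrite dot_comm; assumption).
  assert (e3' : dot M E2 E1 = 0) by (rewrite dot_comm; assumption).
  do 6 (destruct a as [|a]; [do 6 (destruct b as [|b]; [cbn [tri alt Nat.eqb];
    rewrite ?p1, ?p2, ?p3, ?p4, ?p5, ?p6, ?p3', ?p5', ?p6', ?e1, ?e2, ?e3, ?e3'; ring|]); lia|]).
  lia.
Qed.

Lemma smooth2_proj1 : smooth2 (fun s _ => s).
Proof.
  exists (fun k l s _ => match k, l with 0%nat, 0%nat => s | 1%nat, 0%nat => 1 | _, _ => 0 end).
  split; [reflexivity|]. intros k l. split.
  - intros s u eps He. exists eps. split; [exact He|]. intros s' u' Hs _.
    destruct k as [|[|k]], l; try exact Hs; rewrite Rminus_diag, Rabs_R0; exact He.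
  - intros s u. destruct k as [|[|k]], l; split;
      first [apply derivable_pt_lim_id|apply derivable_pt_lim_const].
Qed.

Lemma smooth2_proj2 : smooth2 (fun _ u => u).
Proof.
  exists (fun k l _ u => match k, l with 0%nat, 0%nat => u | 0%nat, 1%nat => 1 | _, _ => 0 end).
  split; [reflexivity|]. intros k l. split.
  - intros s u eps He. exists eps. split; [exact He|]. intros s' u' _ Hu.
    destruct k, l as [|[|l]]; try exact Hu; rewrite Rminus_diag, Rabs_R0; exact He.
  - intros s u. destruct k, l as [|[|l]]; split;
      first [apply derivable_pt_lim_id|apply derivable_pt_lim_const].
Qed.

(** The six vectors become the first columns of an orthogonal matrix; the added columns meet only
    coordinates of [ejiri] that vanish. *)
Lemma ejiri_complete N (v : nat -> nat -> R) :
  orthonormal N 6 v -> (6 <= N)%nat /\ exists O : nat -> nat -> R,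
    (forall i j, (i < N)%nat -> (j < N)%nat ->
        sumN N (fun k => O k i * O k j) = if Nat.eqb i j then 1 else 0) /\
    forall s u i, sumN N (fun j => O i j * ejiri s u j) = sumN 6 (fun k => v k i * ejiri s u k).
Proof.
  intros Hv. assert (H6 := orthonormal_card _ _ _ Hv). split; [exact H6|].
  destruct (orthonormal_complete _ _ _ Hv) as [v' [E Hv']].
  exists (fun i j => v' j i). split; [exact Hv'|].
  intros s u i. replace N with (6 + (N - 6))%nat by lia. rewrite sumN_app.
  rewrite (sumN_ext (N - 6) _ (fun _ => 0)), sumN_const by (intros; simpl; ring).
  rewrite Rmult_0_r, Rplus_0_r. apply sumN_ext. intros k Hk. rewrite E by exact Hk. reflexivity.
Qed.

Lemma congruent_id N y L Lh v :
  L = 2 * PI / sqrt 3 -> Lh = 2 * PI -> orthonormal N 6 v ->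
  (forall s u i, (i < N)%nat -> y s u i = sumN 6 (fun k => v k i * ejiri s u k)) ->
  congruent_to_ejiri N y L Lh.
Proof.
  intros -> -> Hv Hy. destruct (ejiri_complete N v Hv) as [H6 (O & HO & HE)].
  split; [exact H6|].
  exists O, (fun s _ => s), (fun _ u => u), (fun s _ => s), (fun _ u => u).
  repeat split; try (apply smooth2_proj1 || apply smooth2_proj2 || exact HO); auto.
  intros s u i Hi. rewrite HE. auto.
Qed.

(** Serves the case in which the great circle is the first factor: the reparametrization exchanges
    the two parameters. *)
Lemma congruent_swap N y L Lh v :
  L = 2 * PI -> Lh = 2 * PI / sqrt 3 -> orthonormal N 6 v ->
  (forall s u i, (i < N)%nat -> y s u i = sumN 6 (fun k => v k i * ejiri u s k)) ->
  congruent_to_ejiri N y L Lh.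
Proof.
  intros -> -> Hv Hy. destruct (ejiri_complete N v Hv) as [H6 (O & HO & HE)].
  split; [exact H6|].
  exists O, (fun _ u => u), (fun s _ => s), (fun _ u => u), (fun s _ => s).
  repeat split; try (apply smooth2_proj1 || apply smooth2_proj2 || exact HO); auto.
  - intros (p & q & H1 & H2). exists q, p. auto.
  - intros (p & q & H1 & H2). exists q, p. auto.
  - intros s u i Hi. rewrite HE. auto.
Qed.

(** * Surfaces congruent to the Ejiri torus *)

Definition ejiri_s (a b : R) : nat -> R := fun k =>
  match k with
  | 0%nat => - cos b * sin (sqrt 3 * a)
  | 1%nat => - sin b * sin (sqrt 3 * a)
  | 2%nat => cos b * cos (sqrt 3 * a)
  | 3%nat => sin b * cos (sqrt 3 * a)
  | _ => 0
  end.

Definition ejiri_u (a b : R) : nat -> R := fun k =>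
  match k with
  | 0%nat => - sin b * cos (sqrt 3 * a) / sqrt 3
  | 1%nat => cos b * cos (sqrt 3 * a) / sqrt 3
  | 2%nat => - sin b * sin (sqrt 3 * a) / sqrt 3
  | 3%nat => cos b * sin (sqrt 3 * a) / sqrt 3
  | 4%nat => - sqrt 2 * sin b / sqrt 3
  | 5%nat => sqrt 2 * cos b / sqrt 3
  | _ => 0
  end.

Definition ejiri_ss (a b : R) : nat -> R := fun k =>
  match k with
  | 0%nat | 1%nat | 2%nat | 3%nat => -3 * ejiri a b k
  | _ => 0
  end.

Definition ejiri_su (a b : R) : nat -> R := fun k =>
  match k with
  | 0%nat => sin b * sin (sqrt 3 * a)
  | 1%nat => - cos b * sin (sqrt 3 * a)
  | 2%nat => - sin b * cos (sqrt 3 * a)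
  | 3%nat => cos b * cos (sqrt 3 * a)
  | _ => 0
  end.

Definition ejiri_uu (a b : R) : nat -> R := fun k => - ejiri a b k.

Section EjiriChainRule.
Context (f g : R -> R) (x a b : R).
Hypothesis Hf : derivable_pt_lim f x a.
Hypothesis Hg : derivable_pt_lim g x b.

Ltac ejiri_chain :=
  let S3 := fresh in let P3 := fresh in
  assert (S3 : sqrt 3 * sqrt 3 = 3) by (apply sqrt_sqrt; lra);
  assert (P3 : 0 < sqrt 3) by (apply sqrt_lt_R0; lra);
  assert (ex_derive f x) by (exists a; apply is_derive_Reals; exact Hf);
  assert (ex_derive g x) by (exists b; apply is_derive_Reals; exact Hg);
  apply is_derive_Reals; auto_derive; [repeat split; try assumption; lra|];
  try change (Derive (fun x => f x) x) with (Derive f x);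
  try change (Derive (fun x => g x) x) with (Derive g x);
  rewrite ?(is_derive_unique f x a (proj2 (is_derive_Reals _ _ _) Hf)),
    ?(is_derive_unique g x b (proj2 (is_derive_Reals _ _ _) Hg));
  field_simplify_eq; [|lra];
  rewrite ?(pow2_sqrt 3) by lra; try ring.

Lemma ejiri_deriv k :
  derivable_pt_lim (fun x => ejiri (f x) (g x) k) x
    (a * ejiri_s (f x) (g x) k + b * ejiri_u (f x) (g x) k).
Proof.
  do 6 (destruct k as [|k]; [cbn [ejiri ejiri_s ejiri_u]; ejiri_chain|]).
  cbn [ejiri ejiri_s ejiri_u]. rewrite !Rmult_0_r, Rplus_0_r. apply derivable_pt_lim_const.
Qed.

Lemma ejiri_s_deriv k :
  derivable_pt_lim (fun x => ejiri_s (f x) (g x) k) x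
    (a * ejiri_ss (f x) (g x) k + b * ejiri_su (f x) (g x) k).
Proof.
  do 4 (destruct k as [|k]; [cbn [ejiri ejiri_s ejiri_ss ejiri_su]; ejiri_chain|]).
  cbn [ejiri_s ejiri_ss ejiri_su]. rewrite !Rmult_0_r, Rplus_0_r. apply derivable_pt_lim_const.
Qed.

Lemma ejiri_u_deriv k :
  derivable_pt_lim (fun x => ejiri_u (f x) (g x) k) x
    (a * ejiri_su (f x) (g x) k + b * ejiri_uu (f x) (g x) k).
Proof.
  unfold ejiri_uu.
  do 6 (destruct k as [|k]; [cbn [ejiri ejiri_u ejiri_su]; ejiri_chain|]).
  cbn [ejiri ejiri_u ejiri_su]. rewrite Ropp_0, !Rmult_0_r, Rplus_0_r.
  apply derivable_pt_lim_const.
Qed.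

End EjiriChainRule.

Lemma dot_six N (v z : nat -> R) :
  (6 <= N)%nat -> (forall k, (6 <= k)%nat -> v k = 0) -> dot N v z = dot 6 v z.
Proof.
  intros H6 Hv. replace N with (6 + (N - 6))%nat by lia. unfold dot. rewrite sumN_app.
  rewrite (sumN_ext (N - 6) _ (fun _ => 0)), sumN_const; [ring|].
  intros k _. rewrite Hv by lia. ring.
Qed.

Lemma sumN_deriv N (f : nat -> R -> R) f' x :
  (forall k, derivable_pt_lim (f k) x (f' k)) ->
  derivable_pt_lim (fun x => sumN N (fun k => f k x)) x (sumN N f').
Proof.
  intros H. induction N as [|N IH]; simpl; [apply derivable_pt_lim_const|].
  apply deriv_plus; [exact IH|apply H].
Qed.

(** The 6 is |Laplacian E|^2: the first four coordinates are multiplied by -4 and contribute 16/3,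
    the last two by -1 and contribute 2/3. *)
Lemma ejiri_dots N a b : (6 <= N)%nat ->
  dot N (ejiri_s a b) (ejiri_s a b) = 1 /\ dot N (ejiri_s a b) (ejiri_u a b) = 0 /\
  dot N (ejiri_u a b) (ejiri_u a b) = 1 /\
  dot N (fun k => ejiri_ss a b k + ejiri_uu a b k) (fun k => ejiri_ss a b k + ejiri_uu a b k) = 6.
Proof.
  intros H6.
  assert (P3 : 0 < sqrt 3) by (apply sqrt_lt_R0; lra).
  assert (S3 : sqrt 3 * sqrt 3 = 3) by (apply sqrt_sqrt; lra).
  assert (S2 : sqrt 2 * sqrt 2 = 2) by (apply sqrt_sqrt; lra).
  assert (I3 : / sqrt 3 * / sqrt 3 = / 3) by (rewrite <- Rinv_mult, S3; reflexivity).
  assert (A := sin2_cos2 (sqrt 3 * a)). assert (B := sin2_cos2 b). unfold Rsqr in A, B.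
  rewrite !(dot_six N) by (trivial; intros k Hk; do 6 (destruct k as [|k]; [lia|]);
    unfold ejiri_uu; cbn; ring).
  unfold dot, ejiri_uu. cbn [sumN ejiri_s ejiri_u ejiri_ss ejiri_uu ejiri].
  set (c1 := cos (sqrt 3 * a)) in *. set (s1 := sin (sqrt 3 * a)) in *.
  set (c := cos b) in *. set (s := sin b) in *. unfold Rdiv.
  set (r := / sqrt 3) in *. set (q := sqrt 2) in *.
  repeat split.
  - transitivity ((s * s + c * c) * (s1 * s1 + c1 * c1)); [ring|rewrite A, B; ring].
  - ring.
  - transitivity ((s * s + c * c) * (s1 * s1 + c1 * c1) * (r * r) + q * q * (r * r) * (s * s + c * c));
      [ring|rewrite A, B, S2, I3; field].
  - transitivity (16 * ((s * s + c * c) * (s1 * s1 + c1 * c1)) * (r * r)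
      + q * q * (r * r) * (s * s + c * c)); [ring|rewrite A, B, S2, I3; field].
Qed.

Definition omul (N : nat) (O : nat -> nat -> R) (v : nat -> R) : nat -> R :=
  fun i => sumN N (fun j => O i j * v j).

Lemma omul_dot N O v z :
  (forall i j, (i < N)%nat -> (j < N)%nat ->
      sumN N (fun k => O k i * O k j) = if Nat.eqb i j then 1 else 0) ->
  dot N (omul N O v) (omul N O z) = dot N v z.
Proof.
  intros HO.
  rewrite (dot_ext N (omul N O v) (fun i => sumN N (fun a => v a * O i a)) _ (omul N O z));
    [|intros; apply sumN_ext; intros; ring|reflexivity].
  rewrite (dot_sumN_l N N v (fun a i => O i a)).
  apply sumN_ext. intros a Ha. f_equal.
  rewrite dot_comm.
  rewrite (dot_ext N (omul N O z) (fun i => sumN N (fun b => z b * O i b)) _ (fun i => O i a));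
    [|intros; apply sumN_ext; intros; ring|reflexivity].
  rewrite (dot_sumN_l N N z (fun b i => O i b)).
  rewrite (sumN_ext N _ (fun b => (if Nat.eqb b a then 1 else 0) * z b));
    [apply sumN_delta, Ha|].
  intros b Hb. unfold dot. rewrite HO by assumption. ring.
Qed.

Lemma omul_deriv N O (v : R -> nat -> R) v' x i :
  (forall k, derivable_pt_lim (fun x => v x k) x (v' k)) ->
  derivable_pt_lim (fun x => omul N O (v x) i) x (omul N O v' i).
Proof.
  intros H. apply (sumN_deriv N (fun k x => O i k * v x k) (fun k => O i k * v' k)).
  intros k. apply deriv_scal, H.
Qed.

(** By Lagrange's identity the determinant has square 1, and Cramer's rule does the rest. *)
Lemma orthonormal_plane_zero a b c d x y :
  a * a + c * c = 1 -> a * b + c * d = 0 -> b * b + d * d = 1 ->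
  x * a + y * c = 0 -> x * b + y * d = 0 -> x = 0 /\ y = 0.
Proof.
  intros H1 H2 H3 Hx Hy.
  assert (E : (a * d - c * b) * (a * d - c * b) = 1).
  { transitivity ((a * a + c * c) * (b * b + d * d) - (a * b + c * d) * (a * b + c * d));
      [ring|rewrite H1, H2, H3; ring]. }
  assert (Ex : x * (a * d - c * b) = 0).
  { transitivity (d * (x * a + y * c) - c * (x * b + y * d)); [ring|rewrite Hx, Hy; ring]. }
  assert (Ey : y * (a * d - c * b) = 0).
  { transitivity (a * (x * b + y * d) - b * (x * a + y * c)); [ring|rewrite Hx, Hy; ring]. }
  split.
  - rewrite <- (Rmult_1_r x), <- E, <- Rmult_assoc, Ex. ring.
  - rewrite <- (Rmult_1_r y), <- E, <- Rmult_assoc, Ey. ring.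
Qed.

(** With M the matrix, the columns give M^T M = 1, so (M M^T - 1) M = 0 and each row of M M^T - 1
    vanishes by [orthonormal_plane_zero]. *)
Lemma orthogonal_rows a b c d :
  a * a + c * c = 1 -> a * b + c * d = 0 -> b * b + d * d = 1 ->
  a * a + b * b = 1 /\ a * c + b * d = 0 /\ c * c + d * d = 1.
Proof.
  intros H1 H2 H3.
  destruct (orthonormal_plane_zero a b c d (a * a + b * b - 1) (a * c + b * d) H1 H2 H3) as [X1 X2].
  - transitivity (a * (a * a + c * c) + b * (a * b + c * d) - a); [ring|rewrite H1, H2; ring].
  - transitivity (a * (a * b + c * d) + b * (b * b + d * d) - b); [ring|rewrite H2, H3; ring].
  - destruct (orthonormal_plane_zero a b c d (a * c + b * d) (c * c + d * d - 1) H1 H2 H3) as [X3 X4].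
    + transitivity (c * (a * a + c * c) + d * (a * b + c * d) - c); [ring|rewrite H1, H2; ring].
    + transitivity (c * (a * b + c * d) + d * (b * b + d * d) - d); [ring|rewrite H2, H3; ring].
    + repeat split; lra.
Qed.

(* Differentiating the isometry relations shows that every second derivative is orthogonal
   to both first derivatives, hence zero. *)
Lemma plane_isometry_affine (A B : nat -> nat -> R -> R -> R) :
  (forall k l s u, derivable_pt_lim (fun s' => A k l s' u) s (A (S k) l s u) /\
                   derivable_pt_lim (fun u' => A k l s u') u (A k (S l) s u)) ->
  (forall k l s u, derivable_pt_lim (fun s' => B k l s' u) s (B (S k) l s u) /\
                   derivable_pt_lim (fun u' => B k l s u') u (B k (S l) s u)) ->
  (forall s u, A 1%nat 0%nat s u * A 1%nat 0%nat s u + B 1%nat 0%nat s u * B 1%nat 0%nat s u = 1) ->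
  (forall s u, A 1%nat 0%nat s u * A 0%nat 1%nat s u + B 1%nat 0%nat s u * B 0%nat 1%nat s u = 0) ->
  (forall s u, A 0%nat 1%nat s u * A 0%nat 1%nat s u + B 0%nat 1%nat s u * B 0%nat 1%nat s u = 1) ->
  exists a b c d,
    (forall s u, A 1%nat 0%nat s u = a /\ A 0%nat 1%nat s u = b /\
                 B 1%nat 0%nat s u = c /\ B 0%nat 1%nat s u = d) /\
    (forall s u, A 0%nat 0%nat s u = A 0%nat 0%nat 0 0 + a * s + b * u /\
                 B 0%nat 0%nat s u = B 0%nat 0%nat 0 0 + c * s + d * u).
Proof.
  intros HA HB I1 I2 I3.
  assert (Dz : forall (f : R -> R) c x l, (forall y, f y = c) -> derivable_pt_lim f x l -> l = 0).
  { intros f c x l Hc Hl. eapply uniqueness_limite; [exact Hl|].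
    apply (derivable_pt_lim_ext (fun _ => c)); [auto|apply derivable_pt_lim_const]. }
  set (P := fun k l k' l' s u => A k l s u * A k' l' s u + B k l s u * B k' l' s u).
  assert (Ps : forall k l k' l' c s u, (forall s u, P k l k' l' s u = c) ->
    P (S k) l k' l' s u + P k l (S k') l' s u = 0).
  { intros k l k' l' c s u H. apply (Dz (fun s => P k l k' l' s u) c s); [auto|].
    eapply derivable_pt_lim_eq; [|apply deriv_plus; apply deriv_mult;
      first [apply HA|apply HB]]. unfold P; ring. }
  assert (Pu : forall k l k' l' c s u, (forall s u, P k l k' l' s u = c) ->
    P k (S l) k' l' s u + P k l k' (S l') s u = 0).
  { intros k l k' l' c s u H. apply (Dz (fun u => P k l k' l' s u) c u); [auto|].
    eapply derivable_pt_lim_eq; [|apply deriv_plus; apply deriv_mult;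
      first [apply HA|apply HB]]. unfold P; ring. }
  assert (Z : forall s u, (A 2%nat 0%nat s u = 0 /\ B 2%nat 0%nat s u = 0) /\
    (A 1%nat 1%nat s u = 0 /\ B 1%nat 1%nat s u = 0) /\
    (A 0%nat 2%nat s u = 0 /\ B 0%nat 2%nat s u = 0)).
  { intros s u.
    assert (E1 := Ps _ _ _ _ _ s u I1). assert (E2 := Pu _ _ _ _ _ s u I1).
    assert (E3 := Ps _ _ _ _ _ s u I3). assert (E4 := Pu _ _ _ _ _ s u I3).
    assert (E5 := Ps _ _ _ _ _ s u I2). assert (E6 := Pu _ _ _ _ _ s u I2).
    unfold P in *.
    assert (PZ := fun x y => orthonormal_plane_zero _ _ _ _ x y (I1 s u) (I2 s u) (I3 s u)).
    split; [|split]; apply PZ; lra. }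
  assert (Const : forall F : R -> R -> R,
    (forall s u, derivable_pt_lim (fun s' => F s' u) s 0 /\ derivable_pt_lim (fun u' => F s u') u 0) ->
    forall s u, F s u = F 0 0).
  { intros F HF s u. transitivity (F 0 u).
    - apply (deriv_zero_const (fun s => F s u)). intros; apply HF.
    - apply (deriv_zero_const (fun u => F 0 u)). intros; apply HF. }
  assert (CA1 := Const (A 1%nat 0%nat)). assert (CA2 := Const (A 0%nat 1%nat)).
  assert (CB1 := Const (B 1%nat 0%nat)). assert (CB2 := Const (B 0%nat 1%nat)).
  exists (A 1%nat 0%nat 0 0), (A 0%nat 1%nat 0 0), (B 1%nat 0%nat 0 0), (B 0%nat 1%nat 0 0).
  assert (C : forall s u, A 1%nat 0%nat s u = A 1%nat 0%nat 0 0 /\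
    A 0%nat 1%nat s u = A 0%nat 1%nat 0 0 /\
    B 1%nat 0%nat s u = B 1%nat 0%nat 0 0 /\ B 0%nat 1%nat s u = B 0%nat 1%nat 0 0).
  { intros s u. repeat split; first [apply CA1|apply CA2|apply CB1|apply CB2];
      intros s' u'; destruct (Z s' u') as ((z1 & z2) & (z3 & z4) & (z5 & z6)); split;
      first [eapply derivable_pt_lim_eq; [exact z1|apply HA]
            |eapply derivable_pt_lim_eq; [exact z2|apply HB]
            |eapply derivable_pt_lim_eq; [exact z3|apply HA]
            |eapply derivable_pt_lim_eq; [exact z4|apply HB]
            |eapply derivable_pt_lim_eq; [exact z5|apply HA]
            |eapply derivable_pt_lim_eq; [exact z6|apply HB]]. }
  split; [exact C|]. intros s u. split.
  - enough (E : A 0%nat 0%nat s u - A 1%nat 0%nat 0 0 * s - A 0%nat 1%nat 0 0 * u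
              = A 0%nat 0%nat 0 0 - A 1%nat 0%nat 0 0 * 0 - A 0%nat 1%nat 0 0 * 0) by lra.
    apply (Const (fun s u => A 0%nat 0%nat s u - A 1%nat 0%nat 0 0 * s - A 0%nat 1%nat 0 0 * u)).
    intros s' u'. destruct (C s' u') as (c1 & c2 & c3 & c4). split.
    + eapply derivable_pt_lim_eq; [|apply deriv_minus; [apply deriv_minus;
        [apply HA|apply (deriv_scal _ id), derivable_pt_lim_id]|apply derivable_pt_lim_const]].
      rewrite c1; ring.
    + eapply derivable_pt_lim_eq; [|apply deriv_minus; [apply deriv_minus;
        [apply HA|apply derivable_pt_lim_const]|apply (deriv_scal _ id), derivable_pt_lim_id]].
      rewrite c2; ring.
  - enough (E : B 0%nat 0%nat s u - B 1%nat 0%nat 0 0 * s - B 0%nat 1%nat 0 0 * u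
              = B 0%nat 0%nat 0 0 - B 1%nat 0%nat 0 0 * 0 - B 0%nat 1%nat 0 0 * 0) by lra.
    apply (Const (fun s u => B 0%nat 0%nat s u - B 1%nat 0%nat 0 0 * s - B 0%nat 1%nat 0 0 * u)).
    intros s' u'. destruct (C s' u') as (c1 & c2 & c3 & c4). split.
    + eapply derivable_pt_lim_eq; [|apply deriv_minus; [apply deriv_minus;
        [apply HB|apply (deriv_scal _ id), derivable_pt_lim_id]|apply derivable_pt_lim_const]].
      rewrite c3; ring.
    + eapply derivable_pt_lim_eq; [|apply deriv_minus; [apply deriv_minus;
        [apply HB|apply derivable_pt_lim_const]|apply (deriv_scal _ id), derivable_pt_lim_id]].
      rewrite c4; ring.
Qed.

(** Each lattice has integer coordinates in the other, so the two covolumes are integer multiples of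
    one another up to the determinant, which is 1 or -1. *)
Lemma lattice_covolume L Lh P Q a b c d :
  0 < L -> 0 < Lh -> 0 < P -> 0 < Q ->
  a * a + c * c = 1 -> a * b + c * d = 0 -> b * b + d * d = 1 ->
  (forall s u, in_lattice L Lh s u <-> in_lattice P Q (a * s + b * u) (c * s + d * u)) ->
  L * Lh = P * Q.
Proof.
  intros HL HLh HP HQ H1 H2 H3 Hlat.
  assert (E : (a * d - c * b) * (a * d - c * b) = 1).
  { transitivity ((a * a + c * c) * (b * b + d * d) - (a * b + c * d) * (a * b + c * d));
      [ring|rewrite H1, H2, H3; ring]. }
  destruct (orthogonal_rows a b c d H1 H2 H3) as (R1 & R2 & R3).
  assert (A1 : in_lattice L Lh L 0) by (exists 1%Z, 0%Z; split; ring).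
  assert (A2 : in_lattice L Lh 0 Lh) by (exists 0%Z, 1%Z; split; ring).
  apply Hlat in A1. apply Hlat in A2.
  destruct A1 as (p & q & p1 & p2). destruct A2 as (r & t & p3 & p4).
  (* The inverse of the isometry is its transpose, so (a P, b P) is the preimage of the generator
     (P, 0). *)
  assert (B1 : in_lattice L Lh (a * P) (b * P)).
  { apply Hlat. exists 1%Z, 0%Z. split.
    - transitivity ((a * a + b * b) * P); [ring|rewrite R1; ring].
    - transitivity ((a * c + b * d) * P); [ring|rewrite R2; ring]. }
  assert (B2 : in_lattice L Lh (c * Q) (d * Q)).
  { apply Hlat. exists 0%Z, 1%Z. split.
    - transitivity ((a * c + b * d) * Q); [ring|rewrite R2; ring].
    - transitivity ((c * c + d * d) * Q); [ring|rewrite R3; ring]. }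
  destruct B1 as (p' & q' & p5 & p6). destruct B2 as (r' & t' & p7 & p8).
  assert (D1 : (a * d - c * b) * (L * Lh) = IZR (p * t - q * r) * (P * Q)).
  { rewrite minus_IZR, !mult_IZR.
    transitivity ((a * L + b * 0) * (c * 0 + d * Lh) - (c * L + d * 0) * (a * 0 + b * Lh)); [ring|].
    rewrite p1, p2, p3, p4. ring. }
  assert (D2 : (a * d - c * b) * (P * Q) = IZR (p' * t' - q' * r') * (L * Lh)).
  { rewrite minus_IZR, !mult_IZR.
    transitivity ((a * P) * (d * Q) - (b * P) * (c * Q)); [ring|].
    rewrite p5, p6, p7, p8. ring. }
  set (k1 := (p * t - q * r)%Z) in *. set (k2 := (p' * t' - q' * r')%Z) in *.
  assert (HLL : 0 < L * Lh) by (apply Rmult_lt_0_compat; assumption).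
  assert (HPQ : 0 < P * Q) by (apply Rmult_lt_0_compat; assumption).
  assert (K : (k1 * k2 = 1)%Z).
  { apply eq_IZR. rewrite mult_IZR.
    apply Rmult_eq_reg_r with ((P * Q) * (L * Lh));
      [|apply Rgt_not_eq, Rmult_lt_0_compat; assumption].
    transitivity ((IZR k1 * (P * Q)) * (IZR k2 * (L * Lh))); [ring|].
    rewrite <- D1, <- D2.
    transitivity ((a * d - c * b) * (a * d - c * b) * (L * Lh * (P * Q))); [ring|].
    rewrite E. ring. }
  (* Integers with product 1 are units; positivity of both areas then settles the sign. *)
  assert (Hk : k1 = 1%Z \/ k1 = (-1)%Z) by (apply Z.eq_mul_1 with k2; exact K).
  assert (Hdd : a * d - c * b = 1 \/ a * d - c * b = -1).
  { assert (Hz : (a * d - c * b - 1) * (a * d - c * b + 1) = 0) by lra.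
    apply Rmult_integral in Hz. destruct Hz; [left|right]; lra. }
  destruct Hk as [Hk|Hk], Hdd as [Hdd|Hdd]; rewrite Hk, Hdd in D1; lra.
Qed.

(** The curvature identity comes from |y_ss + y_uu|^2 = k^2 + kh^2 + 4, which must equal the value 6
    of the Ejiri torus. *)
Lemma ejiri_congruent_geometry n m G Gh L Lh (gamma gammah : R -> nat -> R) :
  jets n G L -> jets m Gh Lh ->
  (forall i s, (i < S n)%nat -> G i 0%nat s = gamma s i) ->
  (forall j u, (j < S m)%nat -> Gh j 0%nat u = gammah u j) ->
  congruent_to_ejiri (S n * S m) (fun s u => tensor m (gamma s) (gammah u)) L Lh ->
  L * Lh = (2 * PI / sqrt 3) * (2 * PI) /\ forall s u, curv2 n G s + curv2 m Gh u = 2.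
Proof.
  intros HG HGh Hg Hgh
    (H6 & O & phi1 & phi2 & psi1 & psi2 & HO & (A & EA & HA) & (B & EB & HB)
     & _ & _ & _ & _ & Hlat & Hy).
  set (N := (S n * S m)%nat) in *.
  assert (HA' := fun k l => proj2 (HA k l)). assert (HB' := fun k l => proj2 (HB k l)).
  assert (Ds := tens_deriv_s n m G Gh L HG). assert (Du := tens_deriv_u m G Gh Lh HGh).
  assert (H0 : forall s u i, (i < N)%nat ->
    tens m G Gh 0 0 s u i = omul N O (ejiri (A 0%nat 0%nat s u) (B 0%nat 0%nat s u)) i).
  { intros s u i Hi. rewrite EA, EB. unfold omul. rewrite <- Hy by exact Hi.
    unfold tens, tensor. rewrite Hg, Hgh; [reflexivity|apply tensor_mod|apply tensor_div, Hi]. }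
  set (es := fun s u => ejiri_s (A 0%nat 0%nat s u) (B 0%nat 0%nat s u)) in *.
  set (eu := fun s u => ejiri_u (A 0%nat 0%nat s u) (B 0%nat 0%nat s u)) in *.
  assert (H1 : forall s u i, (i < N)%nat -> tens m G Gh 1 0 s u i =
    omul N O (fun k => A 1%nat 0%nat s u * es s u k + B 1%nat 0%nat s u * eu s u k) i).
  { intros s u i Hi. eapply uniqueness_limite; [apply (Ds 0%nat)|].
    eapply derivable_pt_lim_ext; [intros; symmetry; apply H0, Hi|].
    apply omul_deriv. intros k.
    apply (ejiri_deriv (fun s => A 0%nat 0%nat s u) (fun s => B 0%nat 0%nat s u));
      [apply HA'|apply HB']. }
  assert (H2 : forall s u i, (i < N)%nat -> tens m G Gh 0 1 s u i =
    omul N O (fun k => A 0%nat 1%nat s u * es s u k + B 0%nat 1%nat s u * eu s u k) i).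
  { intros s u i Hi. eapply uniqueness_limite; [apply (Du 0%nat 0%nat)|].
    eapply derivable_pt_lim_ext; [intros; symmetry; apply H0, Hi|].
    apply omul_deriv. intros k.
    apply (ejiri_deriv (fun u => A 0%nat 0%nat s u) (fun u => B 0%nat 0%nat s u));
      [apply HA'|apply HB']. }
  assert (Hdot : forall s u a b c d,
    dot N (fun k => a * es s u k + b * eu s u k) (fun k => c * es s u k + d * eu s u k)
    = a * c + b * d).
  { intros s u a b c d.
    destruct (ejiri_dots N (A 0%nat 0%nat s u) (B 0%nat 0%nat s u) H6) as (e1 & e2 & e3 & _).
    rewrite dot_plus_l, !dot_plus_r, !dot_scal_l, !dot_scal_r.
    rewrite (dot_comm N (eu s u) (es s u)). unfold es, eu. rewrite e1, e2, e3. ring. }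
  assert (I1 : forall s u, A 1%nat 0%nat s u * A 1%nat 0%nat s u
                           + B 1%nat 0%nat s u * B 1%nat 0%nat s u = 1).
  { intros s u. rewrite <- (Hdot s u), <- (omul_dot N O _ _ HO).
    rewrite <- (dot_ext N _ _ _ _ (H1 s u) (H1 s u)). unfold N. rewrite dot_tens.
    rewrite (jdot11 HG), (jdot00 HGh). ring. }
  assert (I2 : forall s u, A 1%nat 0%nat s u * A 0%nat 1%nat s u
                           + B 1%nat 0%nat s u * B 0%nat 1%nat s u = 0).
  { intros s u. rewrite <- (Hdot s u), <- (omul_dot N O _ _ HO).
    rewrite <- (dot_ext N _ _ _ _ (H1 s u) (H2 s u)). unfold N. rewrite dot_tens.
    rewrite (jdot01 HGh). ring. }
  assert (I3 : forall s u, A 0%nat 1%nat s u * A 0%nat 1%nat s u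
                           + B 0%nat 1%nat s u * B 0%nat 1%nat s u = 1).
  { intros s u. rewrite <- (Hdot s u), <- (omul_dot N O _ _ HO).
    rewrite <- (dot_ext N _ _ _ _ (H2 s u) (H2 s u)). unfold N. rewrite dot_tens.
    rewrite (jdot11 HGh), (jdot00 HG). ring. }
  destruct (plane_isometry_affine A B HA' HB' I1 I2 I3) as (a & b & c & d & HC & HF).
  specialize (I1 0 0). specialize (I2 0 0). specialize (I3 0 0).
  destruct (HC 0 0) as (c1 & c2 & c3 & c4). rewrite c1, ?c2, c3, ?c4 in *.
  assert (P3 : 0 < sqrt 3) by (apply sqrt_lt_R0; lra). assert (Hpi := PI_RGT_0).
  split.
  - apply (lattice_covolume L Lh _ _ a b c d); try assumption.
    + apply (jets_pos _ _ _ HG).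
    + apply (jets_pos _ _ _ HGh).
    + apply Rdiv_lt_0_compat; lra.
    + lra.
    (* Comparing with the origin removes the translation part of the affine map. *)
    + intros s u. specialize (Hlat s u 0 0). rewrite <- EA, <- EB in Hlat.
      destruct (HF s u) as [-> ->] in Hlat. rewrite !Rminus_0_r in Hlat.
      replace (A 0%nat 0%nat 0 0 + a * s + b * u - A 0%nat 0%nat 0 0) with (a * s + b * u) in Hlat by ring.
      replace (B 0%nat 0%nat 0 0 + c * s + d * u - B 0%nat 0%nat 0 0) with (c * s + d * u) in Hlat by ring.
      exact Hlat.
  - intros s u.
    destruct (orthogonal_rows a b c d I1 I2 I3) as (R1 & R2 & R3).
    set (ess := ejiri_ss (A 0%nat 0%nat s u) (B 0%nat 0%nat s u)).
    set (esu := ejiri_su (A 0%nat 0%nat s u) (B 0%nat 0%nat s u)).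
    set (euu := ejiri_uu (A 0%nat 0%nat s u) (B 0%nat 0%nat s u)).
    assert (H3 : forall i, (i < N)%nat -> tens m G Gh 2 0 s u i =
      omul N O (fun k => a * (a * ess k + c * esu k) + c * (a * esu k + c * euu k)) i).
    { intros i Hi. eapply uniqueness_limite; [apply (Ds 1%nat)|].
      apply (derivable_pt_lim_ext (fun s => omul N O (fun k => a * es s u k + c * eu s u k) i)).
      - intros x. rewrite H1 by exact Hi. destruct (HC x u) as (-> & _ & -> & _). reflexivity.
      - destruct (HC s u) as (k1 & _ & k3 & _).
        apply omul_deriv. intros k. apply deriv_plus; apply deriv_scal.
        + eapply derivable_pt_lim_eq; [|apply (ejiri_s_deriv (fun s => A 0%nat 0%nat s u)
            (fun s => B 0%nat 0%nat s u)); [apply HA'|apply HB']]. rewrite k1, k3; reflexivity.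
        + eapply derivable_pt_lim_eq; [|apply (ejiri_u_deriv (fun s => A 0%nat 0%nat s u)
            (fun s => B 0%nat 0%nat s u)); [apply HA'|apply HB']]. rewrite k1, k3; reflexivity. }
    assert (H4 : forall i, (i < N)%nat -> tens m G Gh 0 2 s u i =
      omul N O (fun k => b * (b * ess k + d * esu k) + d * (b * esu k + d * euu k)) i).
    { intros i Hi. eapply uniqueness_limite; [apply (Du 0%nat 1%nat)|].
      apply (derivable_pt_lim_ext (fun u => omul N O (fun k => b * es s u k + d * eu s u k) i)).
      - intros x. rewrite H2 by exact Hi. destruct (HC s x) as (_ & -> & _ & ->). reflexivity.
      - destruct (HC s u) as (_ & k1 & _ & k3).
        apply omul_deriv. intros k. apply deriv_plus; apply deriv_scal.
        + eapply derivable_pt_lim_eq; [|apply (ejiri_s_deriv (fun u => A 0%nat 0%nat s u)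
            (fun u => B 0%nat 0%nat s u)); [apply HA'|apply HB']]. rewrite k1, k3; reflexivity.
        + eapply derivable_pt_lim_eq; [|apply (ejiri_u_deriv (fun u => A 0%nat 0%nat s u)
            (fun u => B 0%nat 0%nat s u)); [apply HA'|apply HB']]. rewrite k1, k3; reflexivity. }
    (* Orthonormality of the rows cancels the mixed derivative: the flat Laplacian is invariant
       under affine isometries. *)
    assert (H5 : forall i, (i < N)%nat -> tens m G Gh 2 0 s u i + tens m G Gh 0 2 s u i =
      omul N O (fun k => ess k + euu k) i).
    { intros i Hi. rewrite H3, H4 by exact Hi. unfold omul. rewrite <- sumN_plus.
      apply sumN_ext. intros k _.
      transitivity (O i k * ((a * a + b * b) * ess k + 2 * (a * c + b * d) * esu k
                             + (c * c + d * d) * euu k)); [ring|rewrite R1, R2, R3; ring]. }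
    destruct (ejiri_dots N (A 0%nat 0%nat s u) (B 0%nat 0%nat s u) H6) as (_ & _ & _ & e4).
    fold ess euu in e4. rewrite <- (omul_dot N O _ _ HO), <- (dot_ext N _ _ _ _ H5 H5) in e4.
    rewrite dot_plus_l, !dot_plus_r in e4. unfold N in e4. rewrite !dot_tens in e4.
    rewrite (jdot_comm 2 0), (jdot_comm 2 0), (jdot02 HG), (jdot02 HGh),
      (jdot00 HG), (jdot00 HGh) in e4.
    unfold curv2. lra.
Qed.

(** A sum of a function of s and one of u that is constant has constant terms, so the energy is the
    area 4 pi^2 / sqrt 3 times 1 + 2/4. *)
Lemma congruent_energy n m G Gh L Lh w :
  jets n G L -> jets m Gh Lh ->
  w = L * Lh + (Lh * RInt (curv2 n G) 0 L + L * RInt (curv2 m Gh) 0 Lh) / 4 ->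
  L * Lh = (2 * PI / sqrt 3) * (2 * PI) -> (forall s u, curv2 n G s + curv2 m Gh u = 2) ->
  w = 2 * PI ^ 2 * sqrt 3.
Proof.
  intros HG HGh Ew EL Ek.
  assert (P3 : 0 < sqrt 3) by (apply sqrt_lt_R0; lra).
  assert (S3 : sqrt 3 * sqrt 3 = 3) by (apply sqrt_sqrt; lra).
  assert (K1 : RInt (curv2 n G) 0 L = L * curv2 n G 0).
  { rewrite (RInt_ext _ (fun _ => curv2 n G 0)).
    - rewrite RInt_rconst. Rring.
    - intros x _. generalize (Ek x 0) (Ek 0 0). intros; Req; lra. }
  assert (K2 : RInt (curv2 m Gh) 0 Lh = Lh * curv2 m Gh 0).
  { rewrite (RInt_ext _ (fun _ => curv2 m Gh 0)).
    - rewrite RInt_rconst. Rring.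
    - intros x _. generalize (Ek 0 x) (Ek 0 0). intros; Req; lra. }
  rewrite Ew, K1, K2.
  transitivity (L * Lh * (1 + (curv2 n G 0 + curv2 m Gh 0) / 4)); [field|].
  rewrite Ek, EL.
  transitivity (2 * PI^2 * (3 / sqrt 3)); [field; lra|].
  replace (3 / sqrt 3) with (sqrt 3 * sqrt 3 / sqrt 3) by (rewrite S3; reflexivity).
  field. lra.
Qed.

Theorem theorem3p2
  (n m : nat) (gamma gammah : R -> nat -> R) (L Lh : R)
  (hn : (1 <= n)%nat) (hm : (1 <= m)%nat)
  (hgamma : sphere_curve n gamma L) (hgammah : sphere_curve m gammah Lh)
  (hwill : willmore_surface (S n * S m)
             (fun s u => tensor m (gamma s) (gammah u)) L Lh)
  (w : R)
  (hw : is_willmore_value (S n * S m)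
          (fun s u => tensor m (gamma s) (gammah u)) L Lh w) :
  w >= 2 * PI ^ 2 * sqrt 3 /\
  (w = 2 * PI ^ 2 * sqrt 3 <->
   congruent_to_ejiri (S n * S m)
     (fun s u => tensor m (gamma s) (gammah u)) L Lh).
Proof.
  destruct (sphere_curve_jets n gamma L hgamma) as (G & HG & Eg).
  destruct (sphere_curve_jets m gammah Lh hgammah) as (Gh & HGh & Egh).
  destruct hgamma as (_ & _ & _ & _ & _ & Hmin).
  destruct hgammah as (_ & _ & _ & _ & _ & Hminh).
  assert (Ew := tensor_is_willmore_value n m G Gh L Lh HG HGh gamma gammah w Eg Egh hw).
  assert (Hconv : congruent_to_ejiri (S n * S m)
     (fun s u => tensor m (gamma s) (gammah u)) L Lh -> w = 2 * PI ^ 2 * sqrt 3).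
  { intros Hc.
    destruct (ejiri_congruent_geometry n m G Gh L Lh gamma gammah HG HGh Eg Egh Hc) as [EL Ek].
    apply (congruent_energy n m G Gh L Lh); assumption. }
  assert (HJ := willmore_tensor_curvature n m G Gh L Lh HG HGh gamma gammah Eg Egh hwill).
  (* Whichever total curvature vanishes, its factor is the great circle; the two cases differ by
     exchanging the factors. *)
  destruct (Rmult_integral _ _ HJ) as [J0|J0].
  - destruct (great_circle n G L HG) as [EL (E1 & E2 & HE & Hform)].
    + intros T HT. destruct (Hmin T HT) as (s & i & Hi & Hne). exists s, i.
      rewrite !Eg by exact Hi. auto.
    + apply (curv2_RInt_eq0 n G L HG J0).
    + rewrite J0, EL in Ew.
      destruct (great_circle_energy m Gh Lh HGh w) as [Hle Heq]; [rewrite Ew; field|].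
      split; [lra|]. split; [|exact Hconv]. intros Hw.
      destruct (Heq Hw) as [ELh EI].
      destruct (curvature_bound_eq m Gh Lh HGh ELh EI) as (P & Q & C & HP & Hform').
      apply (congruent_swap _ _ L Lh (fun k => tensor m (alt E1 E2 k) (tri P Q C k)) EL ELh).
      * intros a b Ha Hb. cbv beta. rewrite dot_tensor, Rmult_comm. apply dot_tri_alt; assumption.
      * intros s u i Hi. unfold tensor.
        rewrite <- Eg, <- Egh by (apply tensor_mod || apply tensor_div, Hi).
        rewrite Hform, Hform' by (apply tensor_mod || apply tensor_div, Hi).
        cbn [sumN alt tri ejiri]. unfold Rdiv. ring.
  - destruct (great_circle m Gh Lh HGh) as [ELh (E1 & E2 & HE & Hform)].
    + intros T HT. destruct (Hminh T HT) as (s & i & Hi & Hne). exists s, i.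
      rewrite !Egh by exact Hi. auto.
    + apply (curv2_RInt_eq0 m Gh Lh HGh J0).
    + rewrite J0, ELh in Ew.
      destruct (great_circle_energy n G L HG w) as [Hle Heq]; [rewrite Ew; field|].
      split; [lra|]. split; [|exact Hconv]. intros Hw.
      destruct (Heq Hw) as [EL EI].
      destruct (curvature_bound_eq n G L HG EL EI) as (P & Q & C & HP & Hform').
      apply (congruent_id _ _ L Lh (fun k => tensor m (tri P Q C k) (alt E1 E2 k)) EL ELh).
      * intros a b Ha Hb. cbv beta. rewrite dot_tensor. apply dot_tri_alt; assumption.
      * intros s u i Hi. unfold tensor.
        rewrite <- Eg, <- Egh by (apply tensor_mod || apply tensor_div, Hi).
        rewrite Hform, Hform' by (apply tensor_mod || apply tensor_div, Hi).
        cbn [sumN alt tri ejiri]. unfold Rdiv. ring.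
Qed.
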